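(* A symmetric fusion category $\mathcal{C}$ over $\mathbb{R}$ admits an $\mathbb{R}$-linear fiber functor $\mathcal{C}\to\mathrm{Vec}_{\mathbb{R}}$ (that is, $\mathcal{C}$ is Tannakian over $\mathbb{R}$) if and only if there is a finite group $K$ equipped with a $\mathbb{Z}_2$-action (by group automorphisms) such that $\mathcal{C}$ is equivalent, as an $\mathbb{R}$-linear symmetric monoidal category, to $\mathrm{Rep}_{\mathbb{C}/\mathbb{R}}(K\rtimes\mathbb{Z}_2^T)$.
   Context: A fusion category over $\mathbb{R}$ is a rigid monoidal $\mathbb{R}$-linear category whose underlying category is equivalent to finite-dimensional left modules over a semisimple finite-dimensional $\mathbb{R}$-algebra, with simple tensor unit; it is symmetric if equipped with a symmetric braiding. A fiber functor is a faithful exact linear symmetric monoidal functor; $\mathrm{Vec}_{\mathbb{R}}$ is the symmetric monoidal category of finite-dimensional real vector spaces. A $\mathbb{Z}_2$-graded group $(G,s)$ is a group with a homomorphism $s\colon G\to\mathbb{Z}_2=\{0,1\}$. A semi-linear representation of $(G,s)$ is a $\mathbb{C}$-vector space $V$ with a homomorphism $\rho$ from $G$ to real-linear automorphisms of $V$ such that $\rho(g)$ is $\mathbb{C}$-linear if $s(g)=0$ and anti-linear if $s(g)=1$. $\mathrm{Rep}_{\mathbb{C}/\mathbb{R}}(G,s)$ is the $\mathbb{R}$-linear category of finite-dimensional semi-linear representations, with morphisms the $\mathbb{C}$-linear $G$-equivariant maps, tensor product $\otimes_{\mathbb{C}}$ with diagonal action, and the symmetric braiding of complex vector spaces $v\otimes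 w\mapsto w\otimes v$. $K\rtimes\mathbb{Z}_2^T$ denotes the $\mathbb{Z}_2$-graded group $(K\rtimes\mathbb{Z}_2,s)$ with $s$ the projection to $\mathbb{Z}_2$. *)

(* Defs.v *)
From HB Require Import structures.
From mathcomp Require Import all_boot all_order all_fingroup all_solvable.
From mathcomp Require Import all_algebra all_field.
From mathcomp Require Import boolp reals complex.

Set Implicit Arguments.
Unset Strict Implicit.
Unset Printing Implicit Defensive.

Import GRing.Theory VectorInternalTheory.
Local Open Scope ring_scope.
Local Obligation Tactic := idtac.

Record lincat (K : fieldType) := Lincat {
  obj :> Type;
  mor : obj -> obj -> lmodType K;
  idm : forall X, mor X X;
  comp : forall X Y Z, mor Y Z -> mor X Y -> mor X Z;
  comp1m : forall X Y (f : mor X Y), comp (idm Y) f = f;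
  compm1 : forall X Y (f : mor X Y), comp f (idm X) = f;
  compA : forall X Y Z T (h : mor Z T) (g : mor Y Z) (f : mor X Y),
    comp h (comp g f) = comp (comp h g) f;
  comp_linearl : forall X Y Z (f : mor X Y),
    linear (fun g : mor Y Z => comp g f);
  comp_linearr : forall X Y Z (g : mor Y Z),
    linear (fun f : mor X Y => comp g f)
}.

Arguments idm {K C} X : rename.
Notation "g \oc f" := (comp g f) (at level 50, left associativity).

Section CategoryNotions.
Variables (K : fieldType) (C : lincat K).

Definition is_iso (X Y : C) (f : mor X Y) :=
  exists g : mor Y X, g \oc f = idm X /\ f \oc g = idm Y.

Definition is_mono (X Y : C) (f : mor X Y) :=
  forall (Z : C) (g h : mor Z X), f \oc g = f \oc h -> g = h.

(* [idm X <> 0] says that [X] is not a zero object. *)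
Definition is_simple (X : C) :=
  idm X <> 0 /\
  forall (Y : C) (f : mor Y X), is_mono f -> f = 0 \/ is_iso f.

Definition is_kernel (X Y Z : C) (i : mor X Y) (p : mor Y Z) :=
  p \oc i = 0 /\
  forall (T : C) (h : mor T Y), p \oc h = 0 -> exists! u : mor T X, i \oc u = h.

Definition is_cokernel (X Y Z : C) (i : mor X Y) (p : mor Y Z) :=
  p \oc i = 0 /\
  forall (T : C) (h : mor Y T), h \oc i = 0 -> exists! u : mor Z T, u \oc p = h.

Definition short_exact (X Y Z : C) (i : mor X Y) (p : mor Y Z) :=
  is_kernel i p /\ is_cokernel i p.

End CategoryNotions.

Record linfunctor (K : fieldType) (C D : lincat K) := Linfunctor {
  fobj :> C -> D;
  fmap : forall X Y, mor X Y -> mor (fobj X) (fobj Y);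
  fmap_linear : forall X Y, linear (@fmap X Y);
  fmap1 : forall X, fmap (idm X) = idm (fobj X);
  fmapM : forall X Y Z (g : mor Y Z) (f : mor X Y),
    fmap (g \oc f) = fmap g \oc fmap f
}.

Section Functors.
Variable K : fieldType.

Program Definition id_functor (C : lincat K) : linfunctor C C :=
  @Linfunctor K C C id (fun X Y f => f) _ _ _.
Next Obligation. by []. Qed.
Next Obligation. by []. Qed.
Next Obligation. by []. Qed.

Program Definition comp_functor (C D E : lincat K)
    (G : linfunctor D E) (F : linfunctor C D) : linfunctor C E :=
  @Linfunctor K C E (fun X => G (F X)) (fun X Y f => fmap G (fmap F f)) _ _ _.
Next Obligation. by move=> C D E G F X Y a f g; rewrite /= !fmap_linear. Qed.
Next Obligation. by move=> C D E G F X; rewrite /= !fmap1. Qed.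
Next Obligation. by move=> C D E G F X Y Z g f; rewrite /= !fmapM. Qed.

Definition nat_isomorphic (C D : lincat K) (F G : linfunctor C D) :=
  exists eta : forall X, mor (F X) (G X),
    (forall X, is_iso (eta X)) /\
    (forall X Y (f : mor X Y), eta Y \oc fmap F f = fmap G f \oc eta X).

Definition is_equivalence (C D : lincat K) (F : linfunctor C D) :=
  exists G : linfunctor D C,
    nat_isomorphic (comp_functor G F) (id_functor C) /\
    nat_isomorphic (comp_functor F G) (id_functor D).

Definition faithful (C D : lincat K) (F : linfunctor C D) :=
  forall X Y : C, injective (@fmap K C D F X Y).

Definition exact (C D : lincat K) (F : linfunctor C D) :=
  forall (X Y Z : C) (i : mor X Y) (p : mor Y Z),
    short_exact i p -> short_exact (fmap F i) (fmap F p).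

End Functors.

Record moncat (K : fieldType) := Moncat {
  moncat_cat :> lincat K;
  tens : moncat_cat -> moncat_cat -> moncat_cat;
  tensm : forall X X' Y Y' : moncat_cat,
    mor X X' -> mor Y Y' -> mor (tens X Y) (tens X' Y');
  tensm1 : forall X Y, tensm (idm X) (idm Y) = idm (tens X Y);
  tensmM : forall X X' X'' Y Y' Y''
      (f' : mor X' X'') (f : mor X X') (g' : mor Y' Y'') (g : mor Y Y'),
    tensm (f' \oc f) (g' \oc g) = tensm f' g' \oc tensm f g;
  tensm_linearl : forall X X' Y Y' (g : mor Y Y'),
    linear (fun f : mor X X' => tensm f g);
  tensm_linearr : forall X X' Y Y' (f : mor X X'),
    linear (fun g : mor Y Y' => tensm f g);
  unit_ob : moncat_cat;
  assoc : forall X Y Z, mor (tens (tens X Y) Z) (tens X (tens Y Z));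
  associ : forall X Y Z, mor (tens X (tens Y Z)) (tens (tens X Y) Z);
  lunit : forall X, mor (tens unit_ob X) X;
  runit : forall X, mor (tens X unit_ob) X;
  assocK : forall X Y Z, associ X Y Z \oc assoc X Y Z = idm _;
  associK : forall X Y Z, assoc X Y Z \oc associ X Y Z = idm _;
  lunit_iso : forall X, is_iso (lunit X);
  runit_iso : forall X, is_iso (runit X);
  assoc_nat : forall X X' Y Y' Z Z'
      (f : mor X X') (g : mor Y Y') (h : mor Z Z'),
    assoc X' Y' Z' \oc tensm (tensm f g) h =
    tensm f (tensm g h) \oc assoc X Y Z;
  lunit_nat : forall X X' (f : mor X X'),
    lunit X' \oc tensm (idm unit_ob) f = f \oc lunit X;
  runit_nat : forall X X' (f : mor X X'),
    runit X' \oc tensm f (idm unit_ob) = f \oc runit X;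
  pentagon : forall X Y Z T,
    tensm (idm X) (assoc Y Z T) \oc assoc X (tens Y Z) T
      \oc tensm (assoc X Y Z) (idm T) =
    assoc X Y (tens Z T) \oc assoc (tens X Y) Z T;
  triangle : forall X Y,
    tensm (idm X) (lunit Y) \oc assoc X unit_ob Y = tensm (runit X) (idm Y)
}.

Arguments unit_ob {K C} : rename.
Arguments assoc {K C} X Y Z : rename.
Arguments associ {K C} X Y Z : rename.
Arguments lunit {K C} X : rename.
Arguments runit {K C} X : rename.
Notation "X \ox Y" := (tens X Y) (at level 40, left associativity).
Notation "f \oxm g" := (tensm f g) (at level 40, left associativity).

Section Rigidity.
Variables (K : fieldType) (C : moncat K).

Definition is_left_dual (Y X : C) :=
  exists (ev : mor (Y \ox X) unit_ob) (coev : mor unit_ob (X \ox Y)),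
    runit X \oc (idm X \oxm ev) \oc assoc X Y X \oc (coev \oxm idm X)
      = lunit X /\
    lunit Y \oc (ev \oxm idm Y) \oc associ Y X Y \oc (idm Y \oxm coev)
      = runit Y.

Definition rigid :=
  forall X : C, (exists Y, is_left_dual Y X) /\ (exists Z, is_left_dual X Z).

End Rigidity.

(* For an involutive braiding, one hexagon implies the other. *)
Record symmoncat (K : fieldType) := Symmoncat {
  symmoncat_cat :> moncat K;
  braid : forall X Y : symmoncat_cat, mor (X \ox Y) (Y \ox X);
  braid_nat : forall X X' Y Y' (f : mor X X') (g : mor Y Y'),
    braid X' Y' \oc (f \oxm g) = (g \oxm f) \oc braid X Y;
  braidK : forall X Y, braid Y X \oc braid X Y = idm (X \ox Y);
  hexagon : forall X Y Z,
    assoc Y Z X \oc braid X (Y \ox Z) \oc assoc X Y Z =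
    (idm Y \oxm braid X Z) \oc assoc Y X Z \oc (braid X Y \oxm idm Z)
}.

Arguments braid {K C} X Y : rename.

Record symmonfunctor (K : fieldType) (C D : symmoncat K) := Symmonfunctor {
  smf_fun :> linfunctor C D;
  smf_mul : forall X Y : C, mor (smf_fun X \ox smf_fun Y) (smf_fun (X \ox Y));
  smf_one : mor unit_ob (smf_fun unit_ob);
  smf_mul_iso : forall X Y, is_iso (smf_mul X Y);
  smf_one_iso : is_iso smf_one;
  smf_mul_nat : forall (X X' Y Y' : C) (f : mor X X') (g : mor Y Y'),
    smf_mul X' Y' \oc (fmap smf_fun f \oxm fmap smf_fun g) =
    fmap smf_fun (f \oxm g) \oc smf_mul X Y;
  smf_assoc : forall X Y Z : C,
    fmap smf_fun (assoc X Y Z) \oc smf_mul (X \ox Y) Z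
      \oc (smf_mul X Y \oxm idm (smf_fun Z)) =
    smf_mul X (Y \ox Z) \oc (idm (smf_fun X) \oxm smf_mul Y Z)
      \oc assoc (smf_fun X) (smf_fun Y) (smf_fun Z);
  smf_lunit : forall X : C,
    fmap smf_fun (lunit X) \oc smf_mul unit_ob X
      \oc (smf_one \oxm idm (smf_fun X)) = lunit (smf_fun X);
  smf_runit : forall X : C,
    fmap smf_fun (runit X) \oc smf_mul X unit_ob
      \oc (idm (smf_fun X) \oxm smf_one) = runit (smf_fun X);
  smf_braid : forall X Y : C,
    fmap smf_fun (braid X Y) \oc smf_mul X Y =
    smf_mul Y X \oc braid (smf_fun X) (smf_fun Y)
}.

Definition symmon_equivalent (K : fieldType) (C D : symmoncat K) :=
  exists F : symmonfunctor C D, is_equivalence F.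

Section ModuleCategory.
Variables (K : fieldType) (A : falgType K).

Record fdmod := Fdmod {
  fdmod_carrier :> vectType K;
  mact : A -> fdmod_carrier -> fdmod_carrier;
  mact_linearl : forall v, linear (fun a => mact a v);
  mact_linearr : forall a, linear (mact a);
  mact1 : forall v, mact 1 v = v;
  mactM : forall a b v, mact (a * b) v = mact a (mact b v)
}.

Section ModuleHom.
Variables V W : fdmod.

Definition modhom_pred (f : 'Hom(V, W)) : bool :=
  `[< forall a v, f (mact a v) = mact a (f v) >].

Fact modhom_submod : submod_closed modhom_pred.
Proof.
split=> [|k f g /asboolP hf /asboolP hg]; apply/asboolP=> a v.
  have := mact_linearr a (-1) (0 : W) 0.
  by rewrite scaler0 addr0 scaleN1r addNr !zero_lfunE.
by rewrite !add_lfunE !scale_lfunE hf hg mact_linearr.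
Qed.

HB.instance Definition _ := GRing.isSubmodClosed.Build K 'Hom(V, W)
  modhom_pred modhom_submod.

Record modhom := Modhom { modhom_val : 'Hom(V, W); _ : modhom_pred modhom_val }.
HB.instance Definition _ := [isSub for modhom_val].
HB.instance Definition _ := [Choice of modhom by <:].
HB.instance Definition _ := [SubChoice_isSubLmodule of modhom by <:].

Lemma modhomP (f : modhom) a v : val f (mact a v) = mact a (val f v).
Proof. by have /asboolP := valP f. Qed.

End ModuleHom.

Fact modhom_id_proof (V : fdmod) : modhom_pred (\1%VF : 'Hom(V, V)).
Proof. by apply/asboolP=> a v; rewrite !lfunE. Qed.

Fact modhom_comp_proof (V W U : fdmod) (g : modhom W U) (f : modhom V W) :
  modhom_pred (val g \o val f)%VF.
Proof. by apply/asboolP=> a v; rewrite !lfunE /= !modhomP. Qed.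

Program Definition modcat : lincat K :=
  @Lincat K fdmod (fun V W => modhom V W)
    (fun V => Modhom (modhom_id_proof V))
    (fun V W U g f => Modhom (modhom_comp_proof g f)) _ _ _ _ _.
Next Obligation. by move=> V W f; apply/val_inj; exact: comp_lfun1l. Qed.
Next Obligation. by move=> V W f; apply/val_inj; exact: comp_lfun1r. Qed.
Next Obligation. by move=> V W U T h g f; apply/val_inj; exact: comp_lfunA. Qed.
Next Obligation.
move=> V W U f k g g'; apply/val_inj.
by rewrite /= comp_lfunDl comp_lfunZl.
Qed.
Next Obligation.
move=> V W U g k f f'; apply/val_inj.
by rewrite /= comp_lfunDr comp_lfunZr.
Qed.

Definition left_ideal (I : {vspace A}) := forall a x, x \in I -> a * x \in I.

Definition simple_left_ideal (I : {vspace A}) :=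
  [/\ left_ideal I, I <> 0%VS &
      forall J : {vspace A}, left_ideal J -> (J <= I)%VS -> J = 0%VS \/ J = I].

Definition semisimple_alg :=
  exists (n : nat) (I : 'I_n -> {vspace A}),
    [/\ forall i, simple_left_ideal (I i),
        directv (\sum_i I i)%VS & (\sum_i I i)%VS = fullv].

End ModuleCategory.

(* An [falgType] is a nonzero algebra; the zero algebra is anyway excluded    *)
(* here since the unit object is simple.                                      *)
Definition symmetric_fusion (K : fieldType) (C : symmoncat K) :=
  [/\ rigid C,
      exists A : falgType K, semisimple_alg A /\
        exists F : linfunctor C (modcat A), is_equivalence F &
      is_simple (unit_ob : C)].

(* The tensor product of V and W consists of the matrices of coordinates in   *)
(* the products of the standard bases of V and W; [tlift_pure] and [tens_ext] *)
(* give its universal property, which is used to define every map out of it.  *)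
(* The scalars may be twisted by a field endomorphism [sigma], so that the    *)
(* tensor product of two antilinear maps is also covered.                     *)
Section Semilinear.
Variables (K : fieldType) (sigma : {rmorphism K -> K}).

Definition semilin (U V : lmodType K) (f : U -> V) :=
  linear_for (sigma \; *:%R) f.

Section Maps.
Variables (U V : lmodType K) (f : U -> V).
Hypothesis hf : semilin f.

Lemma semilinD : {morph f : x y / x + y}.
Proof. by move=> x y; have := hf 1 x y; rewrite /= scale1r rmorph1 scale1r. Qed.

Lemma semilin0 : f 0 = 0.
Proof. by apply: (addIr (f 0)); rewrite -semilinD !add0r. Qed.

Lemma semilinZ a x : f (a *: x) = sigma a *: f x.
Proof. by have := hf a x 0; rewrite /= addr0 semilin0 addr0. Qed.

Lemma semilinN : {morph f : x / - x}.
Proof. by move=> x; apply: (addrI (f x)); rewrite -semilinD !subrr semilin0. Qed.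

Lemma semilin_sum I (r : seq I) (F : I -> U) :
  f (\sum_(i <- r) F i) = \sum_(i <- r) f (F i).
Proof. by apply: (big_morph f semilinD semilin0). Qed.

End Maps.

Definition bisemilin (U V W : lmodType K) (b : U -> V -> W) :=
  (forall v, semilin (b^~ v)) /\ (forall u, semilin (b u)).

End Semilinear.

Section TensorProduct.
Variable K : fieldType.

Definition vtens (V W : vectType K) : vectType K := 'M[K]_(dim V, dim W).

Definition tpure (V W : vectType K) (v : V) (w : W) : vtens V W :=
  (v2r v)^T *m v2r w.

Definition tbase (V : vectType K) (i : 'I_(dim V)) : V := r2v (delta_mx 0 i).

Definition tlift (sigma : K -> K) (V W : vectType K) (U : lmodType K)
    (b : V -> W -> U) (t : vtens V W) : U :=
  \sum_i \sum_j sigma ((t : 'M[K]_(dim V, dim W)) i j) *: b (tbase i) (tbase j).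

End TensorProduct.

Notation "v \otv w" := (tpure v w) (at level 40, left associativity).

Section TensorTheory.
Variables (K : fieldType).
Implicit Types V W U T S : vectType K.

Lemma tpure_linearl V W (w : W) : linear (fun v : V => v \otv w).
Proof. by move=> a u v; rewrite /tpure linearP linearP /= mulmxDl -scalemxAl. Qed.

Lemma tpure_linearr V W (v : V) : linear (fun w : W => v \otv w).
Proof. by move=> a u w; rewrite /tpure linearP /= mulmxDr -scalemxAr. Qed.

Lemma tbase_sum V (v : V) : v = \sum_i v2r v 0 i *: tbase i.
Proof.
apply: v2r_inj; rewrite linear_sum /= [LHS]row_sum_delta.
by apply: eq_bigr => i _; rewrite linearZ /= /tbase r2vK.
Qed.

Lemma tpure_base V W (t : vtens V W) :
  t = \sum_i \sum_j (t : 'M_(_, _)) i j *: (tbase i \otv tbase j).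
Proof.
rewrite [LHS](matrix_sum_delta (t : 'M_(_, _))).
apply: eq_bigr => i _; apply: eq_bigr => j _; congr (_ *: _).
by rewrite /tpure /tbase !r2vK trmx_delta mul_delta_mx.
Qed.

Section Lift.
Variable sigma : {rmorphism K -> K}.

Lemma tlift_semilin V W (U : lmodType K) (b : V -> W -> U) :
  semilin sigma (tlift sigma b).
Proof.
move=> a s t; rewrite /tlift /= scaler_sumr -big_split; apply: eq_bigr => i _.
rewrite /= scaler_sumr -big_split; apply: eq_bigr => j _ /=.
by rewrite !mxE rmorphD rmorphM scalerDl scalerA.
Qed.

Lemma tlift_pure V W (U : lmodType K) (b : V -> W -> U) :
  bisemilin sigma b -> forall v w, tlift sigma b (v \otv w) = b v w.
Proof.
move=> [hl hr] v w; rewrite [in RHS](tbase_sum v) (semilin_sum (hl w)).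
apply: eq_bigr => i _; rewrite (semilinZ (hl w)).
rewrite [in RHS](tbase_sum w) (semilin_sum (hr _)) scaler_sumr.
apply: eq_bigr => j _; rewrite (semilinZ (hr _)) scalerA -rmorphM.
by rewrite /tpure mxE big_ord1 mxE.
Qed.

Lemma tens_ext V W (U : lmodType K) (f g : vtens V W -> U) :
  semilin sigma f -> semilin sigma g ->
  (forall v w, f (v \otv w) = g (v \otv w)) -> f =1 g.
Proof.
move=> hf hg fg t; rewrite (tpure_base t) (semilin_sum hf) (semilin_sum hg).
apply: eq_bigr => i _; rewrite (semilin_sum hf) (semilin_sum hg).
by apply: eq_bigr => j _; rewrite (semilinZ hf) (semilinZ hg) fg.
Qed.

End Lift.

Section Ext3.
Variable sigma : {rmorphism K -> K}.

Lemma semilin_purel V W (U : lmodType K) (f : vtens V W -> U) w :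
  semilin sigma f -> semilin sigma (fun v => f (v \otv w)).
Proof. by move=> hf a u v; rewrite tpure_linearl hf. Qed.

Lemma semilin_purer V W (U : lmodType K) (f : vtens V W -> U) v :
  semilin sigma f -> semilin sigma (fun w => f (v \otv w)).
Proof. by move=> hf a u w; rewrite tpure_linearr hf. Qed.

Lemma tens_ext3l V W U (T : lmodType K) (f g : vtens (vtens V W) U -> T) :
  semilin sigma f -> semilin sigma g ->
  (forall v w u, f (v \otv w \otv u) = g (v \otv w \otv u)) -> f =1 g.
Proof.
move=> hf hg fg; apply: (tens_ext hf hg) => t u.
apply: (tens_ext (semilin_purel u hf) (semilin_purel u hg)).
by move=> v w; apply: fg.
Qed.

Lemma tens_ext3r V W U (T : lmodType K) (f g : vtens V (vtens W U) -> T) :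
  semilin sigma f -> semilin sigma g ->
  (forall v w u, f (v \otv (w \otv u)) = g (v \otv (w \otv u))) -> f =1 g.
Proof.
move=> hf hg fg; apply: (tens_ext hf hg) => v t.
apply: (tens_ext (semilin_purer v hf) (semilin_purer v hg)).
by move=> w u; apply: fg.
Qed.

Lemma tens_ext4l V W U T (S : lmodType K)
    (f g : vtens (vtens (vtens V W) U) T -> S) :
  semilin sigma f -> semilin sigma g ->
  (forall v w u t, f (v \otv w \otv u \otv t) = g (v \otv w \otv u \otv t)) ->
  f =1 g.
Proof.
move=> hf hg fg; apply: (tens_ext hf hg) => x t.
apply: (tens_ext3l (semilin_purel t hf) (semilin_purel t hg)).
by move=> v w u; apply: fg.
Qed.

End Ext3.

Lemma lfun_semilin V W (f : 'Hom(V, W)) : semilin idfun f.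
Proof. by move=> a u v; rewrite linearP. Qed.

Lemma lift_lfunE V W (U : vectType K) (b : V -> W -> U) :
  (forall w, linear (b^~ w)) -> (forall v, linear (b v)) ->
  forall v w, linfun (tlift idfun b) (v \otv w) = b v w.
Proof.
move=> hl hr v w.
pose F := GRing.isLinear.Build _ _ _ _ _ (@tlift_semilin idfun V W U b).
pose G : {linear vtens V W -> U} := HB.pack (tlift idfun b) F.
by rewrite (lfunE G); apply: (@tlift_pure idfun).
Qed.

End TensorTheory.

Section VectorSpaces.
Variable K : fieldType.
Implicit Types V W U T S : vectType K.

Definition vtensm V V' W W' (f : 'Hom(V, V')) (g : 'Hom(W, W')) :
    'Hom(vtens V W, vtens V' W') :=
  linfun (tlift idfun (fun v w => f v \otv g w)).

Definition vassoc V W U :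
    'Hom(vtens (vtens V W) U, vtens V (vtens W U)) :=
  linfun (tlift idfun (fun t u => tlift idfun (fun v w => v \otv (w \otv u)) t)).

Definition vassoci V W U :
    'Hom(vtens V (vtens W U), vtens (vtens V W) U) :=
  linfun (tlift idfun (fun v t => tlift idfun (fun w u => (v \otv w) \otv u) t)).

Definition vlunit V : 'Hom(vtens K^o V, V) :=
  linfun (tlift idfun (fun (a : K^o) v => (a : K) *: v)).

Definition vlunit_inv V : 'Hom(V, vtens K^o V) :=
  linfun (fun v => (1 : K^o) \otv v).

Definition vrunit V : 'Hom(vtens V K^o, V) :=
  linfun (tlift idfun (fun v (a : K^o) => (a : K) *: v)).

Definition vrunit_inv V : 'Hom(V, vtens V K^o) :=
  linfun (fun v => v \otv (1 : K^o)).

Definition vbraid V W : 'Hom(vtens V W, vtens W V) :=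
  linfun (tlift idfun (fun v w => w \otv v)).

Lemma linfunE V W (f : V -> W) : linear f -> linfun f =1 f.
Proof.
move=> hf; pose F : {linear V -> W} := HB.pack f (GRing.isLinear.Build _ _ _ _ f hf).
exact: (lfunE F).
Qed.

Lemma vtensmE V V' W W' (f : 'Hom(V, V')) (g : 'Hom(W, W')) v w :
  vtensm f g (v \otv w) = f v \otv g w.
Proof.
apply: lift_lfunE => [{}w|{}v] a x y.
  by rewrite linearP tpure_linearl.
by rewrite linearP tpure_linearr.
Qed.

Lemma vassocE V W U (v : V) (w : W) (u : U) :
  vassoc V W U (v \otv w \otv u) = v \otv (w \otv u).
Proof.
rewrite lift_lfunE.
- apply: (@tlift_pure _ idfun); split=> [{}w|{}v] a x y.
    by rewrite tpure_linearl.
  by rewrite tpure_linearl tpure_linearr.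
- by move=> {}u; apply: (@tlift_semilin _ idfun).
move=> t a x y; rewrite /tlift /= scaler_sumr -big_split; apply: eq_bigr => i _.
rewrite /= scaler_sumr -big_split; apply: eq_bigr => j _ /=.
by rewrite !tpure_linearr scalerDr !scalerA mulrC.
Qed.

Lemma vassociE V W U (v : V) (w : W) (u : U) :
  vassoci V W U (v \otv (w \otv u)) = v \otv w \otv u.
Proof.
rewrite lift_lfunE.
- apply: (@tlift_pure _ idfun); split=> [{}u|{}w] a x y.
    by rewrite tpure_linearr tpure_linearl.
  by rewrite tpure_linearr.
- move=> t a x y; rewrite /tlift /= scaler_sumr -big_split.
  apply: eq_bigr => i _; rewrite /= scaler_sumr -big_split.
  apply: eq_bigr => j _ /=.
  by rewrite !tpure_linearl scalerDr !scalerA mulrC.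
by move=> {}v; apply: (@tlift_semilin _ idfun).
Qed.

Lemma vlunitE V (a : K^o) (v : V) : vlunit V (a \otv v) = (a : K) *: v.
Proof.
apply: lift_lfunE => [{}v|{}a] k x y.
  by rewrite scalerDl scalerA.
by rewrite scalerDr !scalerA mulrC.
Qed.

Lemma vrunitE V (a : K^o) (v : V) : vrunit V (v \otv a) = (a : K) *: v.
Proof.
apply: lift_lfunE => [{}a|{}v] k x y.
  by rewrite scalerDr !scalerA mulrC.
by rewrite scalerDl scalerA.
Qed.

Lemma vlunit_invE V (v : V) : vlunit_inv V v = (1 : K^o) \otv v.
Proof. by apply: linfunE; apply: tpure_linearr. Qed.

Lemma vrunit_invE V (v : V) : vrunit_inv V v = v \otv (1 : K^o).
Proof. by apply: linfunE; apply: tpure_linearl. Qed.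

Lemma vbraidE V W (v : V) (w : W) : vbraid V W (v \otv w) = w \otv v.
Proof.
apply: lift_lfunE => [{}w|{}v] k x y; first by rewrite tpure_linearr.
by rewrite tpure_linearl.
Qed.

Lemma tensP V W U (f g : 'Hom(vtens V W, U)) :
  (forall v w, f (v \otv w) = g (v \otv w)) -> f = g.
Proof.
by move=> fg; apply/lfunP/(tens_ext (@lfun_semilin _ _ _ f) (@lfun_semilin _ _ _ g)).
Qed.

Lemma tens3lP V W U T (f g : 'Hom(vtens (vtens V W) U, T)) :
  (forall v w u, f (v \otv w \otv u) = g (v \otv w \otv u)) -> f = g.
Proof.
by move=> fg; apply/lfunP/(tens_ext3l (@lfun_semilin _ _ _ f) (@lfun_semilin _ _ _ g)).
Qed.

Lemma tens3rP V W U T (f g : 'Hom(vtens V (vtens W U), T)) :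
  (forall v w u, f (v \otv (w \otv u)) = g (v \otv (w \otv u))) -> f = g.
Proof.
by move=> fg; apply/lfunP/(tens_ext3r (@lfun_semilin _ _ _ f) (@lfun_semilin _ _ _ g)).
Qed.

Lemma tens4lP V W U T S (f g : 'Hom(vtens (vtens (vtens V W) U) T, S)) :
  (forall v w u t, f (v \otv w \otv u \otv t) = g (v \otv w \otv u \otv t)) ->
  f = g.
Proof.
by move=> fg; apply/lfunP/(tens_ext4l (@lfun_semilin _ _ _ f) (@lfun_semilin _ _ _ g)).
Qed.

Definition vE := (id_lfunE, comp_lfunE, add_lfunE, scale_lfunE, vtensmE,
  vassocE, vassociE, vlunitE, vrunitE, vlunit_invE, vrunit_invE, vbraidE).

Lemma vtensm1 V W : vtensm \1%VF \1%VF = \1%VF :> 'Hom(vtens V W, vtens V W).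
Proof. by apply: tensP => v w; rewrite !vE. Qed.

Lemma vtensmM V V' V'' W W' W'' (f' : 'Hom(V', V'')) (f : 'Hom(V, V'))
    (g' : 'Hom(W', W'')) (g : 'Hom(W, W')) :
  vtensm (f' \o f) (g' \o g) = (vtensm f' g' \o vtensm f g)%VF.
Proof. by apply: tensP => v w; rewrite !vE. Qed.

Lemma vtensm_linearl V V' W W' (g : 'Hom(W, W')) :
  linear (fun f : 'Hom(V, V') => vtensm f g).
Proof.
by move=> k f f'; apply: tensP => v w; rewrite !vE tpure_linearl.
Qed.

Lemma vtensm_linearr V V' W W' (f : 'Hom(V, V')) :
  linear (fun g : 'Hom(W, W') => vtensm f g).
Proof.
by move=> k g g'; apply: tensP => v w; rewrite !vE tpure_linearr.
Qed.

Lemma vassocK V W U : (vassoci V W U \o vassoc V W U = \1)%VF.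
Proof. by apply: tens3lP => v w u; rewrite !vE. Qed.

Lemma vassociK V W U : (vassoc V W U \o vassoci V W U = \1)%VF.
Proof. by apply: tens3rP => v w u; rewrite !vE. Qed.

Lemma vlunitK V : (vlunit_inv V \o vlunit V = \1)%VF.
Proof.
apply: tensP => a v; rewrite !vE.
rewrite (semilinZ (sigma := idfun) (@tpure_linearr _ _ _ _)).
rewrite -(semilinZ (sigma := idfun) (@tpure_linearl _ _ _ _)) /=.
by rewrite /GRing.scale /= mulr1.
Qed.

Lemma vlunit_invK V : (vlunit V \o vlunit_inv V = \1)%VF.
Proof. by apply/lfunP => v; rewrite !vE scale1r. Qed.

Lemma vrunitK V : (vrunit_inv V \o vrunit V = \1)%VF.
Proof.
apply: tensP => v a; rewrite !vE.
rewrite (semilinZ (sigma := idfun) (@tpure_linearl _ _ _ _)).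
rewrite -(semilinZ (sigma := idfun) (@tpure_linearr _ _ _ _)) /=.
by rewrite /GRing.scale /= mulr1.
Qed.

Lemma vrunit_invK V : (vrunit V \o vrunit_inv V = \1)%VF.
Proof. by apply/lfunP => v; rewrite !vE scale1r. Qed.

Lemma vassoc_nat V V' W W' U U' (f : 'Hom(V, V')) (g : 'Hom(W, W'))
    (h : 'Hom(U, U')) :
  (vassoc V' W' U' \o vtensm (vtensm f g) h =
   vtensm f (vtensm g h) \o vassoc V W U)%VF.
Proof. by apply: tens3lP => v w u; rewrite !vE. Qed.

Lemma vlunit_nat V V' (f : 'Hom(V, V')) :
  (vlunit V' \o vtensm \1 f = f \o vlunit V)%VF.
Proof. by apply: tensP => a v; rewrite !vE linearZ. Qed.

Lemma vrunit_nat V V' (f : 'Hom(V, V')) :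
  (vrunit V' \o vtensm f \1 = f \o vrunit V)%VF.
Proof. by apply: tensP => v a; rewrite !vE linearZ. Qed.

Lemma vpentagon V W U T :
  (vtensm \1 (vassoc W U T) \o vassoc V (vtens W U) T
     \o vtensm (vassoc V W U) \1 =
   vassoc V W (vtens U T) \o vassoc (vtens V W) U T)%VF.
Proof. by apply: tens4lP => v w u t; rewrite !vE. Qed.

Lemma vtriangle V W :
  (vtensm \1 (vlunit W) \o vassoc V K^o W = vtensm (vrunit V) \1)%VF.
Proof.
apply: tens3lP => v a w; rewrite !vE.
rewrite (semilinZ (sigma := idfun) (@tpure_linearl _ _ _ _)).
by rewrite (semilinZ (sigma := idfun) (@tpure_linearr _ _ _ _)).
Qed.

Lemma vbraid_nat V V' W W' (f : 'Hom(V, V')) (g : 'Hom(W, W')) :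
  (vbraid V' W' \o vtensm f g = vtensm g f \o vbraid V W)%VF.
Proof. by apply: tensP => v w; rewrite !vE. Qed.

Lemma vbraidK V W : (vbraid W V \o vbraid V W = \1)%VF.
Proof. by apply: tensP => v w; rewrite !vE. Qed.

Lemma vhexagon V W U :
  (vassoc W U V \o vbraid V (vtens W U) \o vassoc V W U =
   vtensm \1 (vbraid V U) \o vassoc W V U \o vtensm (vbraid V W) \1)%VF.
Proof. by apply: tens3lP => v w u; rewrite !vE. Qed.

Lemma vcomp_linearl V W U (f : 'Hom(V, W)) :
  linear (fun g : 'Hom(W, U) => (g \o f)%VF).
Proof. by move=> k g g'; rewrite comp_lfunDl -comp_lfunZl. Qed.

Lemma vcomp_linearr V W U (g : 'Hom(W, U)) :
  linear (fun f : 'Hom(V, W) => (g \o f)%VF).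
Proof. by move=> k f f'; rewrite comp_lfunDr -comp_lfunZr. Qed.

Definition vec_lincat : lincat K :=
  @Lincat K (vectType K) (fun V W => 'Hom(V, W)) (fun V => \1%VF)
    (fun V W U g f => (g \o f)%VF)
    (fun V W => @comp_lfun1l _ V W) (fun V W => @comp_lfun1r _ V W)
    (fun V W U T h g f => comp_lfunA h g f)
    vcomp_linearl vcomp_linearr.

Definition vec_moncat : moncat K :=
  @Moncat K vec_lincat (@vtens K) vtensm vtensm1 vtensmM
    (fun V V' W W' => @vtensm_linearl V V' W W')
    (fun V V' W W' => @vtensm_linearr V V' W W')
    K^o vassoc vassoci vlunit vrunit vassocK vassociK
    (fun V => ex_intro _ (vlunit_inv V) (conj (vlunitK V) (vlunit_invK V)))
    (fun V => ex_intro _ (vrunit_inv V) (conj (vrunitK V) (vrunit_invK V)))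
    vassoc_nat vlunit_nat vrunit_nat vpentagon vtriangle.

Definition Vec : symmoncat K :=
  @Symmoncat K vec_moncat vbraid vbraid_nat vbraidK vhexagon.

End VectorSpaces.

Record Z2group := MkZ2group {
  z2gr :> groupType;
  grading : z2gr -> 'Z_2;
  gradingM : forall g h : z2gr, grading (g * h)%g = grading g + grading h
}.

Section SemilinearRepresentations.
Variables (R : rcfType) (G : Z2group).
Local Notation C := R[i].

Definition twist (b : 'Z_2) : {rmorphism C -> C} :=
  if b == 0 then (idfun : {rmorphism C -> C})
  else (@conjc R : {rmorphism C -> C}).

Lemma twistD a b x : twist (a + b) x = twist a (twist b x).
Proof.
case: a => [[|[|//]] ?]; case: b => [[|[|//]] ?] //=.
by rewrite /twist /= conjcK.
Qed.

Lemma grading1 : grading (1%g : G) = 0.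
Proof. by apply: (addrI (grading (1%g : G))); rewrite -gradingM mulg1 addr0. Qed.

Record semirep := Semirep {
  srep :> vectType C;
  sact : G -> srep -> srep;
  sact_semilin : forall g, semilin (twist (grading g)) (sact g);
  sact1 : forall v, sact 1%g v = v;
  sactM : forall g h v, sact (g * h)%g v = sact g (sact h v)
}.

Implicit Types V W U T : semirep.

Section Hom.
Variables V W : semirep.

Definition equivariant (f : 'Hom(V, W)) : bool :=
  `[< forall g v, f (sact g v) = sact g (f v) >].

Fact equivariant_zmod : zmod_closed equivariant.
Proof.
split=> [|f h /asboolP hf /asboolP hh]; apply/asboolP=> g v.
  by rewrite !zero_lfunE (semilin0 (sact_semilin g)).
rewrite !add_lfunE !opp_lfunE hf hh (semilinD (sact_semilin g)).
by rewrite (semilinN (sact_semilin g)).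
Qed.

HB.instance Definition _ := GRing.isZmodClosed.Build 'Hom(V, W)
  equivariant equivariant_zmod.

Record rephom := Rephom { rephom_val : 'Hom(V, W); _ : equivariant rephom_val }.
HB.instance Definition _ := [isSub for rephom_val].
HB.instance Definition _ := [Choice of rephom by <:].
HB.instance Definition _ := [SubChoice_isSubZmodule of rephom by <:].

Lemma rephomP (f : rephom) g v : val f (sact g v) = sact g (val f v).
Proof. by have /asboolP := valP f. Qed.

Lemma twist_real b (a : R) : twist b a%:C%C = a%:C%C.
Proof. by rewrite /twist; case: ifP => _ //=; rewrite oppr0. Qed.

Fact rephom_scale_proof (a : R) (f : rephom) : equivariant (a%:C%C *: val f).
Proof.
apply/asboolP=> g v; rewrite !scale_lfunE rephomP.
by rewrite (semilinZ (sact_semilin g)) twist_real.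
Qed.

(* The equivariant maps form a vector space over R only: when the grading is  *)
(* nontrivial, they are not stable under multiplication by complex scalars.   *)
Definition rephom_scale a f := Rephom (rephom_scale_proof a f).

Fact rephom_scaleA a b f :
  rephom_scale a (rephom_scale b f) = rephom_scale (a * b) f.
Proof. by apply/val_inj; rewrite /= scalerA rmorphM. Qed.

Fact rephom_scale1 : left_id 1 rephom_scale.
Proof. by move=> f; apply/val_inj; rewrite /= scale1r. Qed.

Fact rephom_scaleDr : right_distributive rephom_scale +%R.
Proof. by move=> a f f'; apply/val_inj; rewrite /= scalerDr. Qed.

Fact rephom_scaleDl f : {morph rephom_scale^~ f : a b / a + b}.
Proof. by move=> a b; apply/val_inj; rewrite /= rmorphD scalerDl. Qed.

HB.instance Definition _ := GRing.Zmodule_isLmodule.Build R rephom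
  rephom_scaleA rephom_scale1 rephom_scaleDr rephom_scaleDl.

Lemma rephomZ a (f : rephom) : val (a *: f) = a%:C%C *: val f.
Proof. by []. Qed.

End Hom.

Fact rep_id_proof V : equivariant (\1%VF : 'Hom(V, V)).
Proof. by apply/asboolP=> g v; rewrite !id_lfunE. Qed.

Fact rep_comp_proof V W U (g : rephom W U) (f : rephom V W) :
  equivariant (val g \o val f)%VF.
Proof. by apply/asboolP=> x v; rewrite !comp_lfunE !rephomP. Qed.

Program Definition rep_lincat : lincat R :=
  @Lincat R semirep (fun V W => rephom V W)
    (fun V => Rephom (rep_id_proof V))
    (fun V W U g f => Rephom (rep_comp_proof g f)) _ _ _ _ _.
Next Obligation. by move=> V W f; apply/val_inj; exact: comp_lfun1l. Qed.
Next Obligation. by move=> V W f; apply/val_inj; exact: comp_lfun1r. Qed.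
Next Obligation. by move=> V W U T h g f; apply/val_inj; exact: comp_lfunA. Qed.
Next Obligation.
by move=> V W U f a g g'; apply/val_inj; exact: vcomp_linearl.
Qed.
Next Obligation.
by move=> V W U g a f f'; apply/val_inj; exact: vcomp_linearr.
Qed.

Section Tensor.
Variables V W : semirep.

Definition tens_act (g : G) : vtens V W -> vtens V W :=
  tlift (twist (grading g)) (fun (v : V) (w : W) => sact g v \otv sact g w).

Lemma tens_act_semilin g : semilin (twist (grading g)) (tens_act g).
Proof. exact: tlift_semilin. Qed.

Lemma tens_actE g v w : tens_act g (v \otv w) = sact g v \otv sact g w.
Proof.
apply: tlift_pure; split=> [{}w|{}v] a x y; rewrite sact_semilin.
  by rewrite tpure_linearl.
by rewrite tpure_linearr.
Qed.

Lemma tens_act1 t : tens_act 1%g t = t.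
Proof.
apply: (@tens_ext _ (twist (grading (1%g : G))) _ _ _ (tens_act 1%g) id).
- exact: tens_act_semilin.
- by move=> a x y; rewrite grading1.
- by move=> v w; rewrite tens_actE !sact1.
Qed.

Lemma tens_actM g h t : tens_act (g * h)%g t = tens_act g (tens_act h t).
Proof.
apply: (@tens_ext _ (twist (grading (g * h)%g)) _ _ _ _
  (fun t => tens_act g (tens_act h t))).
- exact: tens_act_semilin.
- by move=> a x y; rewrite !tens_act_semilin /= gradingM twistD.
- by move=> v w; rewrite !tens_actE !sactM.
Qed.

Definition rep_tens : semirep :=
  Semirep tens_act_semilin tens_act1 tens_actM.

End Tensor.

Definition unit_act (g : G) (a : C^o) : C^o := twist (grading g) a.

Lemma unit_act_semilin g : semilin (twist (grading g)) (unit_act g).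
Proof. by move=> a x y; rewrite /unit_act rmorphD rmorphM. Qed.

Lemma unit_act1 a : unit_act 1%g a = a.
Proof. by rewrite /unit_act grading1. Qed.

Lemma unit_actM g h a : unit_act (g * h)%g a = unit_act g (unit_act h a).
Proof. by rewrite /unit_act gradingM twistD. Qed.

Definition rep_unit : semirep := Semirep unit_act_semilin unit_act1 unit_actM.

Lemma equivariantE (sV : vectType C) U (f : 'Hom(sV, U))
    (h : G -> sV -> sV) (hh : forall g, semilin (twist (grading g)) (h g)) g :
  semilin (twist (grading g)) (fun t => f (h g t)) /\
  semilin (twist (grading g)) (fun t => sact g (f t)).
Proof. by split=> a x y; rewrite ?hh linearP // sact_semilin. Qed.

Lemma equivariant2 V W U (f : 'Hom(vtens V W, U)) :
  (forall g (v : V) (w : W),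
    f (sact g v \otv sact g w) = sact g (f (v \otv w))) ->
  @equivariant (rep_tens V W) U f.
Proof.
move=> fE; apply/asboolP=> g.
have [hl hr] := equivariantE f (@sact_semilin (rep_tens V W)) g.
by apply: (tens_ext hl hr) => v w; rewrite /= tens_actE fE.
Qed.

Lemma equivariant3l V W U T (f : 'Hom(vtens (vtens V W) U, T)) :
  (forall g (v : V) (w : W) (u : U),
    f (sact g v \otv sact g w \otv sact g u) = sact g (f (v \otv w \otv u))) ->
  @equivariant (rep_tens (rep_tens V W) U) T f.
Proof.
move=> fE; apply/asboolP=> g.
have [hl hr] :=
  equivariantE f (@sact_semilin (rep_tens (rep_tens V W) U)) g.
apply: (tens_ext3l hl hr) => v w u.
by rewrite /= (@tens_actE (rep_tens V W) U) /= tens_actE fE.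
Qed.

Lemma equivariant3r V W U T (f : 'Hom(vtens V (vtens W U), T)) :
  (forall g (v : V) (w : W) (u : U),
    f (sact g v \otv (sact g w \otv sact g u)) =
    sact g (f (v \otv (w \otv u)))) ->
  @equivariant (rep_tens V (rep_tens W U)) T f.
Proof.
move=> fE; apply/asboolP=> g.
have [hl hr] :=
  equivariantE f (@sact_semilin (rep_tens V (rep_tens W U))) g.
apply: (tens_ext3r hl hr) => v w u.
by rewrite /= (@tens_actE V (rep_tens W U)) /= tens_actE fE.
Qed.

Fact rep_tensm_proof V V' W W' (f : rephom V V') (g : rephom W W') :
  @equivariant (rep_tens V W) (rep_tens V' W') (vtensm (val f) (val g)).
Proof.
by apply: equivariant2 => x v w; rewrite !vtensmE /= tens_actE !rephomP.
Qed.

Fact rep_assoc_proof V W U :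
  @equivariant (rep_tens (rep_tens V W) U) (rep_tens V (rep_tens W U))
    (vassoc V W U).
Proof.
apply: equivariant3l => x v w u.
by rewrite !vassocE /= (@tens_actE V (rep_tens W U)) /= tens_actE.
Qed.

Fact rep_associ_proof V W U :
  @equivariant (rep_tens V (rep_tens W U)) (rep_tens (rep_tens V W) U)
    (vassoci V W U).
Proof.
apply: equivariant3r => x v w u.
by rewrite !vassociE /= (@tens_actE (rep_tens V W) U) /= tens_actE.
Qed.

Fact rep_lunit_proof V : @equivariant (rep_tens rep_unit V) V (vlunit V).
Proof.
apply: equivariant2 => x a v.
by rewrite !vlunitE (semilinZ (sact_semilin x)).
Qed.

Fact rep_lunit_inv_proof V :
  @equivariant V (rep_tens rep_unit V) (vlunit_inv V).
Proof.
apply/asboolP => x v; rewrite !vlunit_invE /= (@tens_actE rep_unit V) /=.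
by rewrite /unit_act rmorph1.
Qed.

Fact rep_runit_proof V : @equivariant (rep_tens V rep_unit) V (vrunit V).
Proof.
apply: equivariant2 => x v a.
by rewrite !vrunitE (semilinZ (sact_semilin x)).
Qed.

Fact rep_runit_inv_proof V :
  @equivariant V (rep_tens V rep_unit) (vrunit_inv V).
Proof.
apply/asboolP => x v; rewrite !vrunit_invE /= (@tens_actE V rep_unit) /=.
by rewrite /unit_act rmorph1.
Qed.

Fact rep_braid_proof V W :
  @equivariant (rep_tens V W) (rep_tens W V) (vbraid V W).
Proof. by apply: equivariant2 => x v w; rewrite !vbraidE /= tens_actE. Qed.

Program Definition rep_moncat : moncat R :=
  @Moncat R rep_lincat rep_tens
    (fun V V' W W' f g => Rephom (rep_tensm_proof f g)) _ _ _ _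
    rep_unit
    (fun V W U => Rephom (rep_assoc_proof V W U))
    (fun V W U => Rephom (rep_associ_proof V W U))
    (fun V => Rephom (rep_lunit_proof V))
    (fun V => Rephom (rep_runit_proof V)) _ _ _ _ _ _ _ _ _.
Next Obligation. by move=> *; apply/val_inj; exact: vtensm1. Qed.
Next Obligation. by move=> *; apply/val_inj; exact: vtensmM. Qed.
Next Obligation. by move=> *; move=> ? ? ?; apply/val_inj; exact: vtensm_linearl. Qed.
Next Obligation. by move=> *; move=> ? ? ?; apply/val_inj; exact: vtensm_linearr. Qed.
Next Obligation. by move=> *; apply/val_inj; exact: vassocK. Qed.
Next Obligation. by move=> *; apply/val_inj; exact: vassociK. Qed.
Next Obligation.
move=> V; exists (Rephom (rep_lunit_inv_proof V)).
by split; apply/val_inj; [exact: vlunitK | exact: vlunit_invK].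
Qed.
Next Obligation.
move=> V; exists (Rephom (rep_runit_inv_proof V)).
by split; apply/val_inj; [exact: vrunitK | exact: vrunit_invK].
Qed.
Next Obligation. by move=> *; apply/val_inj; exact: vassoc_nat. Qed.
Next Obligation. by move=> *; apply/val_inj; exact: vlunit_nat. Qed.
Next Obligation. by move=> *; apply/val_inj; exact: vrunit_nat. Qed.
Next Obligation. by move=> *; apply/val_inj; exact: vpentagon. Qed.
Next Obligation. by move=> *; apply/val_inj; exact: vtriangle. Qed.

Program Definition Rep_CR : symmoncat R :=
  @Symmoncat R rep_moncat (fun V W => Rephom (rep_braid_proof V W)) _ _ _.
Next Obligation. by move=> *; apply/val_inj; exact: vbraid_nat. Qed.
Next Obligation. by move=> *; apply/val_inj; exact: vbraidK. Qed.
Next Obligation. by move=> *; apply/val_inj; exact: vhexagon. Qed.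

End SemilinearRepresentations.

Section SemidirectProduct.
Variables (kT : finGroupType) (to : groupAction [set: 'Z_2]%G [set: kT]%G).

(* [sdprod_by to] consists of the pairs (a, k), written a * k, so that the    *)
(* projection to Z_2 is the first one; since Z_2 is abelian, the right action *)
(* [to] is the same thing as a left action.                                   *)
Program Definition sdprod_Z2T : Z2group :=
  @MkZ2group (sdprod_by to) (fun u => (pair_of_sd u).1) _.
Next Obligation. by []. Qed.

End SemidirectProduct.

Section FiberFunctors.
Variables (K : fieldType) (C : symmoncat K).

Definition is_fiber_functor (F : symmonfunctor C (Vec K)) :=
  faithful F /\ exact F.

Definition tannakian := exists F : symmonfunctor C (Vec K), is_fiber_functor F.

End FiberFunctors.

(* Main.v *)
From HB Require Import structures.
Require Import Defs.
From mathcomp Require Import all_boot all_order all_fingroup all_solvable.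
From mathcomp Require Import all_algebra all_field.
From mathcomp Require Import boolp reals complex ring.
Import Defs.

Set Implicit Arguments.
Unset Strict Implicit.
Unset Printing Implicit Defensive.

Import GRing.Theory VectorInternalTheory.
Local Open Scope ring_scope.

(** The theorem is Tannaka reconstruction over the reals, carried out over the
    complex numbers while keeping track of the complex conjugation.

    From representations to a fiber functor: the element [(1, 1)] of the semidirect
    product is an involution acting antilinearly, that is, a real structure on
    every semi-linear representation. Its fixed vectors form a real space, and
    taking them is monoidal ([odd_involution_descent], [real_descent]). Exactness
    costs nothing: in a semisimple category every short exact sequence splits
    ([fusion_semisimple], [regular_exact]).

    From a fiber functor [F] to representations: semisimplicity provides an object
    [P] of which every object is a retract of a sum of copies. The natural
    endomorphisms of [F] are then the commutant of the endomorphisms of [P] in the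
    fiber of [P], a finite-dimensional space, and evaluating them at tensor products
    expresses them in tensor products of natural endomorphisms
    ([tensor_commutant], [comult_exists]). The linear forms on this space form a
    commutative algebra, the functions on the group scheme of monoidal
    automorphisms of [F]. Over the complex numbers this algebra is a product of
    copies of the field: a point derivation can be translated to the identity,
    where it is a primitive element, and primitive elements vanish in
    characteristic 0 ([derivation_zero], [primitive_zero]); and
    without derivations the points span all linear forms on the algebra
    ([characters_span]). So the complex points
    form a finite group [K] which is a basis of the complexified natural
    endomorphisms, and the complex conjugation gives an involution [sigma] of [K]
    ([automorphism_group]), hence an action of Z_2.

    The complexified fibers of [F] are semi-linear representations of the
    semidirect product: [K] acts by its points and Z_2 by the conjugation. This
    functor is faithful as [F] is. It is full because equivariant maps are, by
    duality, vectors fixed by [K]; the projection onto the multiples of the unit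
    inside an object is natural, hence a combination of points with coefficients
    adding up to 1, and thus preserves these vectors ([invariant_vector],
    [points_full]). It is essentially surjective because the independence of the
    points in the fiber of [P] makes every representation a retract of a sum of
    copies of this fiber ([rep_retract], [real_retract]); by fullness the idempotent
    comes from the category, where it splits ([realization]). *)

(** * Linear categories *)

Section LinearCategories.
Variables (K : fieldType) (C : lincat K).

Lemma comp0m (X Y Z : C) (f : mor X Y) : (0 : mor Y Z) \oc f = 0.
Proof. by have := comp_linearl f (-1) (0 : mor Y Z) 0; rewrite scaleN1r addNr scaleN1r addNr. Qed.

Lemma compm0 (X Y Z : C) (g : mor Y Z) : g \oc (0 : mor X Y) = 0.
Proof. by have := comp_linearr g (-1) (0 : mor X Y) 0; rewrite scaleN1r addNr scaleN1r addNr. Qed.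

Lemma compDl (X Y Z : C) (f : mor X Y) (g g' : mor Y Z) :
  (g + g') \oc f = (g \oc f) + (g' \oc f).
Proof. by have := comp_linearl f 1 g g'; rewrite !scale1r. Qed.

Lemma compDr (X Y Z : C) (g : mor Y Z) (f f' : mor X Y) :
  g \oc (f + f') = (g \oc f) + (g \oc f').
Proof. by have := comp_linearr g 1 f f'; rewrite !scale1r. Qed.

Lemma compZl (X Y Z : C) a (f : mor X Y) (g : mor Y Z) :
  (a *: g) \oc f = a *: (g \oc f).
Proof. by have := comp_linearl f a g 0; rewrite !addr0 comp0m addr0. Qed.

Lemma compZr (X Y Z : C) a (f : mor X Y) (g : mor Y Z) :
  g \oc (a *: f) = a *: (g \oc f).
Proof. by have := comp_linearr g a f 0; rewrite !addr0 compm0 addr0. Qed.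

Lemma compNl (X Y Z : C) (f : mor X Y) (g : mor Y Z) : (- g) \oc f = - (g \oc f).
Proof. by rewrite -scaleN1r compZl scaleN1r. Qed.

Lemma compNr (X Y Z : C) (f : mor X Y) (g : mor Y Z) : g \oc (- f) = - (g \oc f).
Proof. by rewrite -scaleN1r compZr scaleN1r. Qed.

Lemma comp_suml (X Y Z : C) (f : mor X Y) I (r : seq I) (g : I -> mor Y Z) :
  (\sum_(i <- r) g i) \oc f = \sum_(i <- r) (g i \oc f).
Proof.
by apply: (big_morph (fun g => g \oc f) (compDl f) (comp0m _ f)).
Qed.

Lemma comp_sumr (X Y Z : C) (g : mor Y Z) I (r : seq I) (f : I -> mor X Y) :
  g \oc (\sum_(i <- r) f i) = \sum_(i <- r) (g \oc f i).
Proof.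
by apply: (big_morph (fun f => g \oc f) (compDr g) (compm0 _ g)).
Qed.

Lemma is_iso_mono (X Y Z : C) (f : mor Y Z) (g h : mor X Y) :
  is_iso f -> f \oc g = f \oc h -> g = h.
Proof.
by move=> [f' [f'f _]] /(congr1 (fun k => f' \oc k)); rewrite !compA f'f !comp1m.
Qed.

Lemma is_iso_epi (X Y Z : C) (f : mor X Y) (g h : mor Y Z) :
  is_iso f -> g \oc f = h \oc f -> g = h.
Proof.
by move=> [f' [_ ff']] /(congr1 (fun k => k \oc f')); rewrite -!compA ff' !compm1.
Qed.

(** Von Neumann regularity: every morphism has a generalized inverse. It replaces
    semisimplicity here, as it passes through equivalences at once and needs
    neither kernels nor direct sums. *)
Definition regular := forall (X Y : C) (f : mor X Y), exists g, f \oc g \oc f = f.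

(** A retract of the sum of [n] copies of [P], without forming this sum. *)
Definition retract_of (P X : C) := exists n (f : 'I_n -> mor P X) (g : 'I_n -> mor X P),
  \sum_i (f i \oc g i) = idm X.

(** An idempotent of the sum of [n] copies of [P] is an idempotent matrix over the
    endomorphisms of [P]. *)
Definition splits_idempotents (P : C) := forall n (b : 'I_n -> 'I_n -> mor P P),
  (forall i j, \sum_k (b i k \oc b k j) = b i j) ->
  exists (X : C) (p : 'I_n -> mor P X) (q : 'I_n -> mor X P),
    (forall i j, q i \oc p j = b i j) /\ \sum_i (p i \oc q i) = idm X.

Definition isomorphic (X Y : C) := exists f : mor X Y, is_iso f.

End LinearCategories.

Section LinearFunctors.
Variables (K : fieldType) (C D : lincat K) (F : linfunctor C D).

Lemma fmap0 (X Y : C) : fmap F (0 : mor X Y) = 0.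
Proof. by have := fmap_linear F (-1) (0 : mor X Y) 0; rewrite scaleN1r addNr scaleN1r addNr. Qed.

Lemma fmapD (X Y : C) (f g : mor X Y) : fmap F (f + g) = fmap F f + fmap F g.
Proof. by have := fmap_linear F 1 f g; rewrite !scale1r. Qed.

Lemma fmapZ (X Y : C) a (f : mor X Y) : fmap F (a *: f) = a *: fmap F f.
Proof. by have := fmap_linear F a f 0; rewrite !addr0 fmap0 addr0. Qed.

Lemma fmapN (X Y : C) (f : mor X Y) : fmap F (- f) = - fmap F f.
Proof. by rewrite -scaleN1r fmapZ scaleN1r. Qed.

Lemma fmap_sum (X Y : C) I (r : seq I) (f : I -> mor X Y) :
  fmap F (\sum_(i <- r) f i) = \sum_(i <- r) fmap F (f i).
Proof. by apply: (big_morph _ (@fmapD X Y) (@fmap0 X Y)). Qed.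

Definition full := forall (X Y : C) (h : mor (F X) (F Y)), exists f, fmap F f = h.

Definition essentially_surjective := forall Y : D, exists X : C, isomorphic (F X) Y.

(** A regular category has only split exact sequences, and the equations of a
    splitting are preserved by every linear functor. *)
Lemma regular_exact : regular C -> exact F.
Proof.
move=> Creg X Y Z i p [[pi0 iker] [_ pcok]].
have [r' ir'i] := Creg _ _ i; have [s psp] := Creg _ _ p.
have pepi (T : C) (g h : mor Z T) : g \oc p = h \oc p -> g = h.
  move=> gh; have gpi : g \oc p \oc i = 0 by rewrite -compA pi0 compm0.
  by have [u [_ uP]] := pcok T _ gpi; rewrite -(uP g) // -(uP h).
have imono (T : C) (g h : mor T X) : i \oc g = i \oc h -> g = h.
  move=> gh; have pig : p \oc (i \oc g) = 0 by rewrite compA pi0 comp0m.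
  by have [u [_ uP]] := iker T _ pig; rewrite -(uP g) // -(uP h).
have ps1 : p \oc s = idm Z by apply: pepi; rewrite psp comp1m.
have [r [ir _]] : exists! r, i \oc r = idm Y - (s \oc p).
  by apply: iker; rewrite compDr compNr compm1 compA ps1 comp1m subrr.
have ri1 : r \oc i = idm X.
  by apply: imono; rewrite compA ir compDl comp1m compNl -compA pi0 compm0 subr0 compm1.
have Fpi : fmap F p \oc fmap F i = 0 by rewrite -fmapM pi0 fmap0.
have Fps : fmap F p \oc fmap F s = idm _ by rewrite -fmapM ps1 fmap1.
have Fri : fmap F r \oc fmap F i = idm _ by rewrite -fmapM ri1 fmap1.
have Fir : fmap F i \oc fmap F r = idm _ - (fmap F s \oc fmap F p).
  by rewrite -!fmapM ir fmapD fmapN fmap1.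
split; split=> // T h h0.
  exists (fmap F r \oc h); split=> [|u <-]; last by rewrite compA Fri comp1m.
  by rewrite compA Fir compDl comp1m compNl -compA h0 compm0 subr0.
exists (h \oc fmap F s); split=> [|u <-]; last by rewrite -compA Fps compm1.
have -> : h \oc fmap F s \oc fmap F p = h \oc (idm _ - (fmap F i \oc fmap F r)).
  by rewrite Fir opprB addrC subrK compA.
by rewrite compDr compm1 compNr compA h0 comp0m subr0.
Qed.

Lemma equivalenceP :
  is_equivalence F <-> [/\ faithful F, full & essentially_surjective].
Proof.
split=> [[G [[eta [eta_iso eta_nat]] [theta [th_iso th_nat]]]]|[Ff FF Fes]].
  have GF_faithful (X Y : C) (f g : mor X Y) : fmap G (fmap F f) = fmap G (fmap F g) -> f = g.
    move=> fg; apply: (is_iso_epi (eta_iso X)).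
    by have := eta_nat _ _ f; have := eta_nat _ _ g; rewrite /= fg => <- <-.
  have FG_faithful (X Y : D) (f g : mor X Y) : fmap F (fmap G f) = fmap F (fmap G g) -> f = g.
    move=> fg; apply: (is_iso_epi (th_iso X)).
    by have := th_nat _ _ f; have := th_nat _ _ g; rewrite /= fg => <- <-.
  split=> [X Y f g fg|X Y h|Y].
  - by apply: GF_faithful; rewrite fg.
  - have [e [eK Ke]] := eta_iso X.
    exists (eta Y \oc fmap G h \oc e).
    apply: FG_faithful; congr (fmap F _).
    set f := (_ \oc e); apply: (is_iso_mono (eta_iso Y)).
    have /= -> := eta_nat _ _ f.
    by rewrite /f -compA eK compm1.
  - by exists (G Y), (theta Y); apply: th_iso.
have fmap_inj (X Y : C) := Ff X Y.
pose Gob (Y : D) := projT1 (cid (Fes Y)).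
have Giso0 (Y : D) : isomorphic (F (Gob Y)) Y by rewrite /Gob; case: cid.
pose e (Y : D) : mor (F (Gob Y)) Y := projT1 (cid (Giso0 Y)).
have e_iso Y : is_iso (e Y) by rewrite /e; case: cid.
pose e' (Y : D) : mor Y (F (Gob Y)) := projT1 (cid (e_iso Y)).
have e'e Y : e' Y \oc e Y = idm _ by rewrite /e'; case: cid => ? [].
have ee' Y : e Y \oc e' Y = idm _ by rewrite /e'; case: cid => ? [].
pose lift (X Y : C) (h : mor (F X) (F Y)) := projT1 (cid (FF X Y h)).
have liftE (X Y : C) (h : mor (F X) (F Y)) : fmap F (lift _ _ h) = h.
  by rewrite /lift; case: cid.
pose Gm (X Y : D) (h : mor X Y) := lift _ _ (e' Y \oc h \oc e X).
have Glin (X Y : D) : linear (Gm X Y).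
  move=> a f g; apply: fmap_inj; rewrite fmapD fmapZ !liftE.
  by rewrite compDr compDl compZr compZl.
have G1 (X : D) : Gm _ _ (idm X) = idm (Gob X).
  by apply: fmap_inj; rewrite liftE fmap1 compm1 e'e.
have GM (X Y Z : D) (g : mor Y Z) (f : mor X Y) :
    Gm _ _ (g \oc f) = Gm _ _ g \oc Gm _ _ f.
  apply: fmap_inj; rewrite fmapM !liftE !compA; congr (_ \oc _ \oc _).
  by rewrite -(compA _ (e Y)) ee' compm1.
exists (@Linfunctor K D C Gob Gm Glin G1 GM); split.
- exists (fun X => lift _ _ (e (F X))); split=> [X|X Y f] /=.
    exists (lift _ _ (e' (F X))).
    by split; apply: fmap_inj; rewrite fmapM !liftE ?e'e ?ee' fmap1.
  apply: fmap_inj; rewrite !fmapM !liftE.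
  by rewrite !compA ee' comp1m.
- exists e; split=> [//|X Y f] /=.
  by rewrite liftE !compA ee' comp1m.
Qed.

End LinearFunctors.

Section TransportAlongEquivalence.
Variables (K : fieldType) (C D : lincat K) (F : linfunctor C D).
Hypotheses (Ff : faithful F) (FF : full F) (Fes : essentially_surjective F).

Lemma regular_transport : regular D -> regular C.
Proof.
move=> Dreg X Y f; have [h hP] := Dreg _ _ (fmap F f).
have [g gh] := FF h.
by exists g; apply: Ff; rewrite !fmapM gh.
Qed.

Lemma generator_transport (Q : D) :
  (forall Y : D, retract_of Q Y) -> splits_idempotents Q ->
  exists P : C, (forall X, retract_of P X) /\ splits_idempotents P.
Proof.
move=> Qgen Qsplit; have [P [e [e' [e'e ee']]]] := Fes Q; exists P; split=> [X|n b bb].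
  have [n [f [g fg]]] := Qgen (F X).
  exists n.
  exists (fun i => projT1 (cid (FF (f i \oc e)))).
  exists (fun i => projT1 (cid (FF (e' \oc g i)))).
  apply: Ff; rewrite fmap_sum fmap1 -fg; apply: eq_bigr => i _.
  rewrite fmapM; case: cid => u /= ->; case: cid => v /= ->.
  by rewrite compA -(compA _ e) ee' compm1.
have [|Y [p [q [qp pq]]]] := Qsplit n (fun i j => e \oc fmap F (b i j) \oc e').
  move=> i j; rewrite -bb fmap_sum comp_sumr comp_suml; apply: eq_bigr => k _.
  by rewrite !compA -(compA _ e' e) e'e compm1 fmapM !compA.
have [X [d [d' [d'd dd']]]] := Fes Y; exists X.
exists (fun i => projT1 (cid (FF (d' \oc p i \oc e)))).
exists (fun i => projT1 (cid (FF (e' \oc q i \oc d)))).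
split=> [i j|].
  apply: Ff; rewrite fmapM; case: cid => u /= ->; case: cid => v /= ->.
  rewrite !compA -(compA _ d) dd' compm1 -(compA _ (q i)) qp.
  by rewrite !compA e'e comp1m -compA e'e compm1.
apply: Ff; rewrite fmap_sum fmap1 -d'd.
transitivity (d' \oc (\sum_i (p i \oc q i)) \oc d); last by rewrite pq compm1.
rewrite comp_sumr comp_suml; apply: eq_bigr => i _.
rewrite fmapM; case: cid => u /= ->; case: cid => v /= ->.
by rewrite !compA -(compA _ e e') ee' compm1.
Qed.

End TransportAlongEquivalence.

(** * Modules over a semisimple algebra *)

Section MaximalSubspace.
Variables (K : fieldType) (V : vectType K).

Lemma max_dim_vspace (P : {vspace V} -> Prop) : (exists U, P U) ->
  exists U, P U /\ forall W, P W -> (\dim W <= \dim U)%N.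
Proof.
move=> [U0 PU0]; pose p n := `[< exists U, P U /\ \dim U = n >].
have p0 : exists n, p n by exists (\dim U0); apply/asboolP; exists U0.
have ubp n : p n -> (n <= \dim (@fullv _ V))%N.
  by move=> /asboolP [U [_ <-]]; apply: dimvS; apply: subvf.
case: (ex_maxnP p0 ubp) => n /asboolP [U [PU dU]] nmax.
by exists U; split=> // W PW; rewrite dU; apply: nmax; apply/asboolP; exists W.
Qed.

(** A subspace of largest dimension contained in [P] contains every vector of [P],
    since otherwise this vector could be added to it. *)
Lemma vspace_of_pred (P : V -> Prop) : P 0 ->
  (forall a u v, P u -> P v -> P (a *: u + v)) ->
  exists U : {vspace V}, forall v, v \in U <-> P v.
Proof.
move=> P0 PD; have [|U [UP Umax]] :=
    @max_dim_vspace (fun U => forall v, v \in U -> P v).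
  by exists 0%VS => v; rewrite memv0 => /eqP->.
exists U => v; split=> [|Pv]; first exact: UP.
have /eqP -> : U == (U + <[v]>)%VS.
  rewrite eqEdim addvSl Umax // => _ /memv_addP [u Uu [_ /vlineP [a ->] ->]].
  by rewrite addrC; apply: PD => //; apply: UP.
by apply/memv_addP; exists 0; rewrite ?mem0v //; exists v; rewrite ?memv_line ?add0r.
Qed.

End MaximalSubspace.

Section SemisimpleModules.
Variables (K : fieldType) (A : falgType K).
Hypothesis Ass : semisimple_alg A.
Implicit Types V W M : fdmod A.

Lemma mactDr M a (u v : M) : mact a (u + v) = mact a u + mact a v.
Proof. by have := mact_linearr a 1 u v; rewrite !scale1r. Qed.

Lemma mact0r M a : mact a (0 : M) = 0.
Proof. by apply: (addIr (mact a (0 : M))); rewrite -mactDr !add0r. Qed.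

Lemma mact_suml M I (r : seq I) (a : I -> A) (v : M) :
  mact (\sum_(i <- r) a i) v = \sum_(i <- r) mact (a i) v.
Proof.
have act_lin := @mact_linearl K A M v.
have act0 : mact 0 v = 0.
  by have := act_lin (-1) 0 0; rewrite scaleN1r addNr scaleN1r addNr.
apply: (big_morph (fun a => mact a v) _ act0) => x y.
by have := act_lin 1 x y; rewrite !scale1r.
Qed.

Definition submodule M (N : {vspace M}) := forall a v, v \in N -> mact a v \in N.

Definition orbit_map M (x : M) : 'Hom(A, M) := linfun (fun a => mact a x).

Lemma orbit_mapE M (x : M) a : orbit_map x a = mact a x.
Proof. by rewrite linfunE //; apply: mact_linearl. Qed.

(** The elements of [I] sending [x] into [N] form a left ideal inside the simple
    ideal [I]: it is zero or all of [I]. *)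
Lemma simple_orbit M (N : {vspace M}) (I : {vspace A}) (x : M) :
  submodule N -> simple_left_ideal I ->
  (orbit_map x @: I <= N)%VS \/ (orbit_map x @: I :&: N = 0)%VS.
Proof.
move=> Nsub [Ileft _ Isimple].
pose J := (I :&: (orbit_map x @^-1: N))%VS.
have memJ a : (a \in J) = (a \in I) && (mact a x \in N).
  by rewrite memv_cap -memv_preim orbit_mapE.
have Jleft : left_ideal J.
  move=> a b; rewrite !memJ => /andP [Ib Nb].
  by rewrite Ileft // mactM Nsub.
case: (Isimple J Jleft (capvSl _ _)) => [J0|JI]; [right|left].
  apply/eqP; rewrite -subv0; apply/subvP => _ /memv_capP [/memv_imgP [a Ia ->] Nax].
  rewrite orbit_mapE in Nax *.
  have : a \in J by rewrite memJ Ia.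
  rewrite J0 memv0 => /eqP ->.
  by rewrite -orbit_mapE linear0 mem0v.
apply/subvP => _ /memv_imgP [a Ia ->]; rewrite orbit_mapE.
by move: Ia; rewrite -JI memJ => /andP [].
Qed.

(** A submodule meeting [N] trivially and of maximal dimension is a complement:
    otherwise one of the simple modules generated by a vector outside of the
    sum could be added to it. *)
Lemma submodule_complement M (N : {vspace M}) : submodule N ->
  exists L : {vspace M}, [/\ submodule L, (N :&: L = 0)%VS & (N + L = fullv)%VS].
Proof.
move=> Nsub; have [n [I [Isimple _ Ifull]]] := Ass.
have [|L [[Lsub NL] Lmax]] := @max_dim_vspace _ M
    (fun L => submodule L /\ (N :&: L = 0)%VS).
  exists 0%VS; split; last by rewrite capv0.
  by move=> a v; rewrite memv0 => /eqP ->; rewrite mact0r mem0v.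
exists L; split=> //; apply/eqP; rewrite eqEsubv subvf /=.
apply/subvP => x _.
have NLsub : submodule (N + L)%VS.
  move=> a _ /memv_addP [u Nu [v Lv ->]]; rewrite mactDr memv_add ?Nsub ?Lsub //.
have [a Ia a1] : exists2 a : 'I_n -> A, forall i, a i \in I i & 1 = \sum_i a i.
  have : (1 : A) \in (\sum_i I i)%VS by rewrite Ifull memvf.
  by move=> /memv_sumP [a Ia ->]; exists a => // i; apply: Ia.
have ax i : mact (a i) x \in (N + L)%VS.
  have [|S0] := simple_orbit x NLsub (Isimple i).
    by move/subvP; apply; rewrite -orbit_mapE memv_img.
  set S := (orbit_map x @: I i)%VS in S0.
  have Ssub : submodule S.
    move=> b _ /memv_imgP [c Ic ->]; rewrite orbit_mapE -mactM -orbit_mapE memv_img //.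
    by have [Ileft _ _] := Isimple i; apply: Ileft.
  have /Lmax : submodule (L + S)%VS /\ (N :&: (L + S) = 0)%VS.
    split=> [b _ /memv_addP [u Lu [v Sv ->]]|].
      by rewrite mactDr memv_add ?Lsub ?Ssub.
    apply/eqP; rewrite -subv0; apply/subvP => u /memv_capP [Nu].
    move=> /memv_addP [l Ll [s Ss us]].
    have : s \in (S :&: (N + L))%VS.
      rewrite memv_cap Ss /= -[s](addKr l) -us addrC.
      by rewrite memv_add ?memvN.
    rewrite S0 memv0 => /eqP s0; rewrite s0 addr0 in us.
    by rewrite -NL memv_cap Nu us.
  rewrite (geq_leqif (dimv_leqif_sup (addvSl L S))) => /subvP /(_ (mact (a i) x)) LSL.
  apply: (subvP (addvSr N L)); apply: LSL.
  by apply: (subvP (addvSr L S)); rewrite -orbit_mapE memv_img.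
by rewrite -[x](mact1 x) a1 mact_suml memv_suml.
Qed.

Section Projection.
Variables (M : fdmod A) (N L : {vspace M}).
Hypotheses (Nsub : submodule N) (Lsub : submodule L).
Hypotheses (NL0 : (N :&: L = 0)%VS) (NLf : (N + L = fullv)%VS).

Lemma proj_linear a v : daddv_pi N L (mact a v) = mact a (daddv_pi N L v).
Proof.
have vNL : v \in (N + L)%VS by rewrite NLf memvf.
have LN0 : (L :&: N = 0)%VS by rewrite capvC.
rewrite -{1}(daddv_pi_add NL0 vNL) mactDr linearD /=.
rewrite (daddv_pi_id NL0) ?Nsub ?memv_pi //.
have -> : daddv_pi N L (mact a (daddv_pi L N v)) = 0; last by rewrite addr0.
set w := mact a _; have Lw : w \in L by rewrite Lsub ?memv_pi.
have wNL : w \in (N + L)%VS by rewrite NLf memvf.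
have := daddv_pi_add NL0 wNL.
rewrite (daddv_pi_id LN0 Lw) => /(congr1 (fun z => z - w)).
by rewrite addrK subrr.
Qed.

End Projection.

Lemma submod_lker V W (f : modhom V W) : submodule (lker (val f)).
Proof. by move=> a v; rewrite !memv_ker modhomP => /eqP ->; rewrite mact0r. Qed.

Lemma submod_limg V W (f : modhom V W) : submodule (limg (val f)).
Proof.
by move=> a _ /memv_imgP [v _ ->]; rewrite -modhomP memv_img ?memvf.
Qed.

(** Complements of the kernel and of the image give a generalized inverse: project
    onto the image, lift, and project away from the kernel. *)
Lemma modhom_regular V W (f : modhom V W) :
  exists g : modhom W V, forall v, val f (val g (val f v)) = val f v.
Proof.
have [L [Lsub KL KLf]] := submodule_complement (@submod_lker _ _ f).
have [L' [L'sub IL IL'f]] := submodule_complement (@submod_limg _ _ f).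
set phi := val f in KL KLf IL IL'f *.
have LK : (L :&: lker phi = 0)%VS by rewrite capvC.
have LKf : (L + lker phi = fullv)%VS by rewrite addvC.
pose g0 := (daddv_pi L (lker phi) \o phi^-1 \o daddv_pi (limg phi) L')%VF.
have fpi v : phi (daddv_pi L (lker phi) v) = phi v.
  have vLK : v \in (L + lker phi)%VS by rewrite LKf memvf.
  rewrite -[in RHS](daddv_pi_add LK vLK) linearD /=.
  have : daddv_pi (lker phi) L v \in lker phi by apply: memv_pi.
  by rewrite memv_ker => /eqP ->; rewrite addr0.
have fg0 w : phi (g0 w) = daddv_pi (limg phi) L' w.
  by rewrite /g0 !comp_lfunE fpi limg_lfunVK // memv_pi.
have Lg0 w : g0 w \in L by rewrite /g0 !comp_lfunE memv_pi.
have g0P : modhom_pred g0.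
  apply/asboolP => a w; apply/eqP; rewrite -subr_eq0 -memv0 -KL memv_cap.
  rewrite memv_ker linearB /= [phi (mact _ _)]modhomP -/phi !fg0.
  rewrite (proj_linear (@submod_limg _ _ f) L'sub) //.
  by rewrite subrr eqxx memvB // Lsub.
by exists (Modhom g0P) => v; rewrite /= fg0 daddv_pi_id // memv_img ?memvf.
Qed.

Lemma modcat_regular : regular (modcat A).
Proof.
move=> V W f; have [g fgf] := @modhom_regular V W f; exists g.
by apply/val_inj/lfunP => v; rewrite /= !comp_lfunE; apply: fgf.
Qed.

Definition modhom_of V W (f : V -> W) (f_lin : linear f)
    (fE : forall a v, f (mact a v) = mact a (f v)) : modhom V W :=
  Modhom (introT (asboolP _) (fun a v => eq_trans (linfunE f_lin _)
    (eq_trans (fE a v) (congr1 (mact a) (esym (linfunE f_lin v))))) :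
    modhom_pred (linfun f)).

Lemma modhom_ofE V W (f : V -> W) (f_lin : linear f) fE v :
  val (modhom_of f_lin fE) v = f v.
Proof. exact: linfunE. Qed.

Fact regmod_linearl (v : A) : linear (fun a : A => a * v).
Proof. by move=> k a b; rewrite mulrDl scalerAl. Qed.
Fact regmod_linearr (a : A) : linear (fun v : A => a * v).
Proof. by move=> k u v; rewrite mulrDr scalerAr. Qed.
Definition regmod : fdmod A :=
  @Fdmod K A A *%R regmod_linearl regmod_linearr (@mul1r A)
    (fun a b v => esym (mulrA a b v)).

Section FreeModule.
Variable n : nat.
Let T : vectType K := {ffun 'I_n -> A}.
Let act (a : A) (v : T) : T := [ffun i => a * (v : {ffun 'I_n -> A}) i].

Fact freemod_linearl (v : T) : linear (fun a : A => act a v).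
Proof. by move=> k a b; apply/ffunP => i; rewrite !ffunE mulrDl scalerAl. Qed.
Fact freemod_linearr (a : A) : linear (act a).
Proof. by move=> k u v; apply/ffunP => i; rewrite !ffunE mulrDr scalerAr. Qed.
Fact freemod1 v : act 1 v = v.
Proof. by apply/ffunP => i; rewrite ffunE mul1r. Qed.
Fact freemodM a b v : act (a * b) v = act a (act b v).
Proof. by apply/ffunP => i; rewrite !ffunE mulrA. Qed.

Definition freemod : fdmod A :=
  @Fdmod K A T act freemod_linearl freemod_linearr freemod1 freemodM.

End FreeModule.

(** A basis of [X] gives a surjection from a free module, which has a section
    because it has a generalized inverse. *)
Lemma regmod_generator (X : modcat A) : retract_of (regmod : modcat A) X.
Proof.
pose n := \dim (@fullv _ (fdmod_carrier X)).
pose x i := (vbasis (@fullv _ (fdmod_carrier X)))`_i.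
pose f0 (v : freemod n) : X := \sum_i mact ((v : {ffun 'I_n -> A}) i) (x i).
have f0lin : linear f0.
  move=> k u v; rewrite /f0 scaler_sumr -big_split; apply: eq_bigr => i _ /=.
  by rewrite !ffunE mact_linearl.
have f0E a v : f0 (mact a v) = mact a (f0 v).
  rewrite /f0 (big_morph _ (mactDr a) (mact0r X a)); apply: eq_bigr => i _.
  by rewrite /= ffunE mactM.
pose f : modhom (freemod n) X := modhom_of f0lin f0E.
have fE u : val f u = f0 u by apply: modhom_ofE.
have fS v : exists u, val f u = v.
  pose u : freemod n := [ffun i => (coord (vbasis fullv) i v) *: (1 : A)].
  exists u; rewrite fE /f0 [RHS](coord_vbasis (memvf v)).
  apply: eq_bigr => i _; rewrite ffunE.
  have := @mact_linearl K A X (x i) (coord (vbasis fullv) i v) 1 0.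
  rewrite addr0 => ->; rewrite mact1.
  have := @mact_linearl K A X (x i) (-1) 0 0; rewrite !scaleN1r !addNr => ->.
  by rewrite addr0.
have [g fgf] := modhom_regular f.
have fg v : val f (val g v) = v.
  by have [u <-] := fS v; apply: fgf.
have rl i : linear (fun a : regmod => mact (a : A) (x i) : X).
  by move=> k a b; apply: mact_linearl.
have rE i a (v : regmod) : mact (mact a v : A) (x i) = mact a (mact (v : A) (x i)).
  by rewrite mactM.
have gl i : linear (fun v : X => (val g v : {ffun 'I_n -> A}) i : regmod).
  by move=> k u v; rewrite linearP !ffunE.
have gE i a (v : X) : (val g (mact a v) : {ffun 'I_n -> A}) i =
    mact a ((val g v : {ffun 'I_n -> A}) i : regmod).
  by rewrite modhomP ffunE.
exists n, (fun i => modhom_of (rl i) (rE i)), (fun i => modhom_of (gl i) (gE i)).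
apply/val_inj/lfunP => v; rewrite raddf_sum /= sum_lfunE lfunE /= -[RHS]fg fE.
apply: eq_bigr => i _; by rewrite comp_lfunE (linfunE (gl i)) (linfunE (rl i)).
Qed.

Section Submodule.
Variables (M : fdmod A) (U : {vspace M}).
Hypothesis Usub : submodule U.
Let act (a : A) (u : subvs_of U) : subvs_of U := Subvs (Usub a (subvsP u)).

Fact sub_linearl (u : subvs_of U) : linear (fun a : A => act a u).
Proof. by move=> k a b; apply/val_inj; rewrite /= mact_linearl. Qed.
Fact sub_linearr (a : A) : linear (act a).
Proof. by move=> k u v; apply/val_inj; rewrite /= mact_linearr. Qed.
Fact sub_act1 v : act 1 v = v.
Proof. by apply/val_inj; rewrite /= mact1. Qed.
Fact sub_actM a b v : act (a * b) v = act a (act b v).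
Proof. by apply/val_inj; rewrite /= mactM. Qed.

Definition submod : fdmod A :=
  @Fdmod K A (subvs_of U) act sub_linearl sub_linearr sub_act1 sub_actM.

End Submodule.

(** The splitting object is the image of the idempotent in the free module. *)
Lemma regmod_splits : splits_idempotents (regmod : modcat A).
Proof.
move=> n b bb.
have bbE i j v : \sum_k val (b i k) (val (b k j) v) = val (b i j) v.
  rewrite -bb raddf_sum /= sum_lfunE; apply: eq_bigr => k _.
  by rewrite /= comp_lfunE.
pose e0 (v : freemod n) : freemod n :=
  [ffun i => \sum_j val (b i j) ((v : {ffun 'I_n -> A}) j)].
have e0lin : linear e0.
  move=> k u v; apply/ffunP => i; rewrite !ffunE scaler_sumr -big_split.
  by apply: eq_bigr => j _; rewrite !ffunE linearP.
have e0E a v : e0 (mact a v) = mact a (e0 v).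
  apply/ffunP => i; rewrite !ffunE mulr_sumr; apply: eq_bigr => j _.
  by rewrite ffunE (modhomP (b i j) a).
have e0e0 v : e0 (e0 v) = e0 v.
  apply/ffunP => i; rewrite !ffunE; under eq_bigr do rewrite ffunE linear_sum.
  by rewrite exchange_big; apply: eq_bigr => j _; rewrite bbE.
pose e : modhom (freemod n) (freemod n) := modhom_of e0lin e0E.
pose X : modcat A := submod (@submod_limg _ _ e).
have eX (u : X) : e0 (vsval u) = vsval u.
  have /memv_imgP [w _ ->] := subvsP u.
  by rewrite /= (linfunE e0lin) e0e0.
have eI v : e0 v \in limg (val e) by rewrite -(linfunE e0lin) memv_img ?memvf.
pose single j (a : regmod) : freemod n := [ffun i => if i == j then a : A else 0].
have single_lin j : linear (single j).
  move=> k u v; apply/ffunP => i; rewrite !ffunE; case: ifP => // _.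
  by rewrite scaler0 addr0.
pose p j (a : regmod) : X := Subvs (eI (single j a)).
have plin j : linear (p j).
  by move=> k u v; apply/val_inj; rewrite /= single_lin e0lin.
have pE j a v : p j (mact a v) = mact a (p j v).
  apply/val_inj; transitivity (e0 (mact a (single j v))); last exact: e0E.
  congr e0.
  by apply/ffunP => i; rewrite !ffunE; case: ifP => // _; rewrite mulr0.
pose q i (u : X) : regmod := (vsval u : {ffun 'I_n -> A}) i.
have qlin i : linear (q i) by move=> k u v; rewrite /q linearP !ffunE.
have qE i a v : q i (mact a v) = mact a (q i v) by rewrite /q ffunE.
exists X, (fun j => modhom_of (plin j) (pE j)), (fun i => modhom_of (qlin i) (qE i)).
split=> [i j|].
  apply/val_inj/lfunP => a; rewrite /= comp_lfunE (linfunE (plin j)) (linfunE (qlin i)) /q /p /= ffunE.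
  rewrite (bigD1 j) //= big1 => [|k kj]; first by rewrite ffunE eqxx addr0.
  by rewrite ffunE (negPf kj) linear0.
apply/val_inj/lfunP => u; apply/val_inj.
rewrite raddf_sum /= sum_lfunE lfunE /= -[RHS]eX raddf_sum /=.
transitivity (\sum_i e0 (single i (q i u))).
  by apply: eq_bigr => i _; rewrite comp_lfunE (linfunE (qlin i)) (linfunE (plin i)).
pose F := GRing.isLinear.Build _ _ _ _ _ e0lin.
pose G : {linear freemod n -> freemod n} := HB.pack e0 F.
rewrite -(raddf_sum G) /=; congr e0; apply/ffunP => i.
rewrite sum_ffunE (bigD1 i) //= big1 => [|k ki]; first by rewrite ffunE eqxx addr0.
by rewrite ffunE eq_sym (negPf ki).
Qed.

End SemisimpleModules.

Lemma fusion_semisimple (K : fieldType) (C : symmoncat K) : symmetric_fusion C ->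
  regular C /\
  exists P : C, (forall X : C, retract_of P X) /\ splits_idempotents P.
Proof.
move=> [_ [A [Ass [F /equivalenceP [Ff FF Fes]]]] _]; split.
  exact: regular_transport Ff FF (modcat_regular Ass).
apply: (generator_transport Ff FF Fes); last exact: regmod_splits.
exact: regmod_generator.
Qed.

(** * Complexification *)

(** The field R[i] known only through its real and imaginary parts. Keeping it
    abstract hides the tower of algebraic structures built on pairs. *)
Record complex_field (R : rcfType) := ComplexField {
  cfield :> numClosedFieldType;
  rc : {rmorphism R -> cfield};
  cI : cfield;
  cRe : cfield -> R;
  cIm : cfield -> R;
  conj : {rmorphism cfield -> cfield};
  complex_decomp : forall x, x = rc (cRe x) + cI * rc (cIm x);
  cRe_decomp : forall a b, cRe (rc a + cI * rc b) = a;
  cIm_decomp : forall a b, cIm (rc a + cI * rc b) = b;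
  cI2 : cI * cI = -1;
  conj_rc : forall a, conj (rc a) = rc a;
  conj_cI : conj cI = - cI
}.

Arguments rc {R C} : rename.
Arguments cI {R C} : rename.
Arguments cRe {R C} : rename.
Arguments cIm {R C} : rename.
Arguments conj {R C} : rename.

Section ComplexField.
Variables (R : rcfType) (C : complex_field R).
Implicit Types x y : C.

Lemma rcE (a : R) : rc a = rc a + cI * rc 0 :> C.
Proof. by rewrite rmorph0 mulr0 addr0. Qed.

Lemma cRe_rc (a : R) : cRe (rc a : C) = a.
Proof. by rewrite rcE cRe_decomp. Qed.

Lemma cIm_rc (a : R) : cIm (rc a : C) = 0.
Proof. by rewrite rcE cIm_decomp. Qed.

Lemma complex_combE (a : C) x y : a * x + y =
  rc (cRe a * cRe x - cIm a * cIm x + cRe y) + cI * rc (cRe a * cIm x + cIm a * cRe x + cIm y).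
Proof.
rewrite [in LHS](complex_decomp a) [in LHS](complex_decomp x) [in LHS](complex_decomp y).
rewrite !(rmorphD, rmorphN, rmorphM).
transitivity (rc (cRe a) * rc (cRe x) + cI * cI * (rc (cIm a) * rc (cIm x)) + rc (cRe y) +
  cI * (rc (cRe a) * rc (cIm x) + rc (cIm a) * rc (cRe x) + rc (cIm y)) : C); first by ring.
by rewrite cI2; ring.
Qed.

Lemma cRe_comb (a : C) x y : cRe (a * x + y) = cRe a * cRe x - cIm a * cIm x + cRe y.
Proof. by rewrite complex_combE cRe_decomp. Qed.

Lemma cIm_comb (a : C) x y : cIm (a * x + y) = cRe a * cIm x + cIm a * cRe x + cIm y.
Proof. by rewrite complex_combE cIm_decomp. Qed.

Lemma conjK x : conj (conj x) = x.
Proof.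
rewrite {1}(complex_decomp x) !(rmorphD conj, rmorphM conj) !conj_rc conj_cI.
by rewrite rmorphN conj_cI opprK -complex_decomp.
Qed.

Lemma conj_fixed x : conj x = x -> x = rc (cRe x).
Proof.
move=> xfix; have := congr1 (fun z => cIm z) xfix.
have -> : conj x = rc (cRe x) + cI * rc (- cIm x).
  by rewrite {1}(complex_decomp x) rmorphD rmorphM !conj_rc conj_cI rmorphN mulNr mulrN.
rewrite cIm_decomp => /eqP; rewrite eq_sym -addr_eq0 -mulr2n -mulr_natl.
rewrite mulf_eq0 Num.Theory.pnatr_eq0 /= => /eqP x0.
by rewrite {1}(complex_decomp x) x0 rmorph0 mulr0 addr0.
Qed.

End ComplexField.

Section ComplexVectors.
Variables (R : rcfType) (C : complex_field R).

Lemma scale_interchange (F : comPzRingType) (U : lmodType F) (a b : F) (p q r s : U) :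
  a *: p + q + b *: (a *: r + s) = a *: (p + b *: r) + (q + b *: s).
Proof. by rewrite !scalerDr !scalerA [b * a]mulrC addrACA. Qed.

Definition cplx (V : vectType R) : vectType C := 'rV[C]_(dim V).

Definition real_linear (V : lmodType R) (U : lmodType C) (f : V -> U) :=
  forall a u v, f (a *: u + v) = rc a *: f u + f v.

Section RealLinear.
Variables (V : lmodType R) (U : lmodType C) (f : V -> U).
Hypothesis fl : real_linear f.

Lemma real_linearD : {morph f : u v / u + v}.
Proof. by move=> u v; have := fl 1 u v; rewrite rmorph1 !scale1r. Qed.

Lemma real_linear0 : f 0 = 0.
Proof. by apply: (addIr (f 0)); rewrite -real_linearD !add0r. Qed.

Lemma real_linearZ a u : f (a *: u) = rc a *: f u.
Proof. by have := fl a u 0; rewrite real_linear0 !addr0. Qed.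

Lemma real_linear_sum I (r : seq I) (F : I -> V) :
  f (\sum_(i <- r) F i) = \sum_(i <- r) f (F i).
Proof. exact: (big_morph f real_linearD real_linear0). Qed.

End RealLinear.

Section OneSpace.
Variable V : vectType R.

Definition iota (v : V) : cplx V := map_mx (@rc R C) (v2r v).
Definition rpart (x : cplx V) : V := r2v (map_mx (@cRe R C) x).
Definition ipart (x : cplx V) : V := r2v (map_mx (@cIm R C) x).
Definition cconj (x : cplx V) : cplx V := map_mx (@conj R C) x.

Lemma iota_real_linear : real_linear iota.
Proof. by move=> a u v; rewrite /iota linearP /=; apply/rowP => i; rewrite !mxE rmorphD rmorphM. Qed.

Lemma rpart_iota v : rpart (iota v) = v.
Proof. by apply: v2r_inj; rewrite r2vK; apply/rowP => i; rewrite !mxE cRe_rc. Qed.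

Lemma ipart_iota v : ipart (iota v) = 0.
Proof. by apply: v2r_inj; rewrite r2vK linear0; apply/rowP => i; rewrite !mxE cIm_rc. Qed.

Lemma iota_inj : injective iota.
Proof. exact: can_inj rpart_iota. Qed.

Lemma cplxE (x : cplx V) : x = iota (rpart x) + cI *: iota (ipart x).
Proof.
by apply/rowP => i; rewrite !mxE !r2vK !mxE [LHS]complex_decomp.
Qed.

Lemma rpartE u v : rpart (iota u + cI *: iota v) = u.
Proof.
by apply: v2r_inj; rewrite r2vK; apply/rowP => i; rewrite !mxE cRe_decomp.
Qed.

Lemma ipartE u v : ipart (iota u + cI *: iota v) = v.
Proof.
by apply: v2r_inj; rewrite r2vK; apply/rowP => i; rewrite !mxE cIm_decomp.
Qed.

Lemma cplx_inj (u v u' v' : V) :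
  iota u + cI *: iota v = iota u' + cI *: iota v' -> u = u' /\ v = v'.
Proof.
move=> e; split; first by rewrite -[u](rpartE u v) e rpartE.
by rewrite -[v](ipartE u v) e ipartE.
Qed.

Lemma cconj_semilin : semilin (@conj R C) cconj.
Proof. by move=> a x y; apply/rowP => i; rewrite !mxE rmorphD rmorphM. Qed.

Lemma cconj_iota v : cconj (iota v) = iota v.
Proof. by apply/rowP => i; rewrite !mxE conj_rc. Qed.

Lemma cconjK : involutive cconj.
Proof. by move=> x; apply/rowP => i; rewrite !mxE conjK. Qed.

Lemma cconj_fixed x : cconj x = x -> x = iota (rpart x).
Proof.
move=> xfix; apply/rowP => i; rewrite mxE r2vK mxE; apply: conj_fixed.
by have /rowP /(_ i) := xfix; rewrite mxE.
Qed.

Lemma rpart_real a (x y : cplx V) : rpart (rc a *: x + y) = a *: rpart x + rpart y.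
Proof.
apply: v2r_inj; rewrite r2vK linearP /= !r2vK; apply/rowP => i; rewrite !mxE.
by rewrite cRe_comb cRe_rc cIm_rc mul0r subr0.
Qed.

Lemma ipart_real a (x y : cplx V) : ipart (rc a *: x + y) = a *: ipart x + ipart y.
Proof.
apply: v2r_inj; rewrite r2vK linearP /= !r2vK; apply/rowP => i; rewrite !mxE.
by rewrite cIm_comb cRe_rc cIm_rc mul0r addr0.
Qed.

Section Ext.
Variables (sigma : {rmorphism C -> C}) (U : lmodType C).

Lemma cplx_ext (f g : cplx V -> U) : semilin sigma f -> semilin sigma g ->
  (forall v, f (iota v) = g (iota v)) -> f =1 g.
Proof.
move=> fl gl fg x; rewrite (cplxE x) (semilinD fl) (semilinD gl).
by rewrite (semilinZ fl) (semilinZ gl) !fg.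
Qed.

End Ext.

Section Lift.
Variables (U : lmodType C) (f : V -> U).
Definition clift (x : cplx V) : U := f (rpart x) + cI *: f (ipart x).

Hypothesis fl : real_linear f.

Lemma clift_semilin : semilin idfun clift.
Proof.
move=> a x y; rewrite /clift /=.
have reE : rpart (a *: x + y) = cRe a *: rpart x - cIm a *: ipart x + rpart y.
  apply: v2r_inj; rewrite r2vK linearD linearB !linearZ /= !r2vK.
  by apply/rowP => i; rewrite !mxE cRe_comb ?mulrN.
have imE : ipart (a *: x + y) = cRe a *: ipart x + cIm a *: rpart x + ipart y.
  apply: v2r_inj; rewrite r2vK !linearD !linearZ /= !r2vK.
  by apply/rowP => i; rewrite !mxE cIm_comb.
rewrite reE imE -scaleNr !(real_linearD fl) !(real_linearZ fl).
rewrite !scalerDr !scalerA [in RHS](complex_decomp a) !scalerDl.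
rewrite mulrDl !scalerDl -!addrA rmorphN.
have -> : cI * rc (cIm a) * cI = - rc (cIm a) :> C.
  by rewrite mulrAC cI2 mulN1r.
rewrite [rc (cRe a) * cI]mulrC.
by rewrite !addrA [LHS](ACl (1*5*4*2*3*6)%AC).
Qed.

Lemma clift_iota v : clift (iota v) = f v.
Proof. by rewrite /clift rpart_iota ipart_iota (real_linear0 fl) scaler0 addr0. Qed.

End Lift.

End OneSpace.

End ComplexVectors.

Global Opaque cplx iota rpart ipart cconj.

Section ComplexMaps.
Variables (R : rcfType) (C : complex_field R).
Local Notation cplx := (@cplx R C).
Local Notation iota := (@iota R C _).
Implicit Types V W U : vectType R.

(** The map of complex spaces extending a real linear map. *)
Definition cx V W (f : 'Hom(V, W)) : 'Hom(cplx V, cplx W) :=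
  linfun (clift (fun v => iota (f v))).

Fact cx_subproof V W (f : 'Hom(V, W)) : real_linear (fun v => iota (f v)).
Proof. by move=> a u v; rewrite linearP /= iota_real_linear. Qed.

Lemma cx_iota V W (f : 'Hom(V, W)) v : cx f (iota v) = iota (f v).
Proof.
have l := clift_semilin (@cx_subproof _ _ f).
by rewrite (linfunE l) (clift_iota (@cx_subproof _ _ f)).
Qed.

Opaque cx.

Lemma cplxP V (X : vectType C) (f g : 'Hom(cplx V, X)) :
  (forall v, f (iota v) = g (iota v)) -> f = g.
Proof.
move=> fg; apply/lfunP; exact: (cplx_ext (@lfun_semilin _ _ _ f) (@lfun_semilin _ _ _ g)).
Qed.

Lemma cx1 V : cx \1%VF = \1%VF :> 'End(cplx V).
Proof. by apply: cplxP => v; rewrite cx_iota !id_lfunE. Qed.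

Lemma cxM V W U (g : 'Hom(W, U)) (f : 'Hom(V, W)) : cx (g \o f)%VF = (cx g \o cx f)%VF.
Proof. by apply: cplxP => v; rewrite !comp_lfunE !cx_iota comp_lfunE. Qed.

Lemma cx_real_linear V W : real_linear (@cx V W).
Proof.
move=> a f g; apply: cplxP => v.
rewrite add_lfunE scale_lfunE !cx_iota.
by rewrite add_lfunE scale_lfunE iota_real_linear.
Qed.

Lemma cx_inj V W : injective (@cx V W).
Proof.
by move=> f g fg; apply/lfunP => v; apply: (@iota_inj R C); rewrite -!cx_iota fg.
Qed.

Lemma cx_cconj V W (f : 'Hom(V, W)) x : cx f (cconj x) = cconj (cx f x).
Proof.
apply: (@cplx_ext _ _ _ (@conj R C) _ (fun x => cx f (cconj x)) (fun x => cconj (cx f x))) x.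
- by move=> a x y; rewrite cconj_semilin linearP.
- by move=> a x y; rewrite linearP cconj_semilin.
- by move=> v; rewrite !(cx_iota, cconj_iota).
Qed.

Definition rpart_lfun V W (f : 'Hom(cplx V, cplx W)) : 'Hom(V, W) :=
  linfun (fun v => rpart (f (iota v))).
Definition ipart_lfun V W (f : 'Hom(cplx V, cplx W)) : 'Hom(V, W) :=
  linfun (fun v => ipart (f (iota v))).

Lemma rpart_lfunE V W (f : 'Hom(cplx V, cplx W)) v :
  rpart_lfun f v = rpart (f (iota v)).
Proof.
by apply: linfunE => a x y; rewrite iota_real_linear linearP /= rpart_real.
Qed.

Lemma ipart_lfunE V W (f : 'Hom(cplx V, cplx W)) v :
  ipart_lfun f v = ipart (f (iota v)).
Proof.
by apply: linfunE => a x y; rewrite iota_real_linear linearP /= ipart_real.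
Qed.

Lemma cx_split V W (f : 'Hom(cplx V, cplx W)) :
  f = cx (rpart_lfun f) + cI *: cx (ipart_lfun f).
Proof.
apply: cplxP => v.
rewrite add_lfunE scale_lfunE !cx_iota rpart_lfunE ipart_lfunE.
exact: cplxE.
Qed.

(** Such an [f] maps the real vectors, being the fixed points of the conjugation, to
    real vectors. *)
Lemma cx_descend V W (f : 'Hom(cplx V, cplx W)) :
  (forall x, f (cconj x) = cconj (f x)) -> cx (rpart_lfun f) = f.
Proof.
move=> fc; apply: cplxP => v; rewrite cx_iota rpart_lfunE.
by rewrite -cconj_fixed // -fc cconj_iota.
Qed.

(** The canonical isomorphism between the complex tensor product of
    complexifications and the complexification of the real tensor product. *)
Section TensorComparison.
Variables V W : vectType R.

Let mu_fun (x : cplx V) (y : cplx W) : cplx (vtens V W) :=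
  clift (fun w => clift (fun v => iota (v \otv w)) x) y.

Let mu_real (w : W) : real_linear (fun v : V => iota (v \otv w)).
Proof. by move=> a u v; rewrite tpure_linearl iota_real_linear. Qed.

Let mu_real' x : real_linear (fun w : W => clift (fun v : V => iota (v \otv w)) x).
Proof.
move=> a u v; rewrite /clift !tpure_linearr !iota_real_linear.
exact: scale_interchange.
Qed.

Let mu_bilin : bisemilin idfun mu_fun.
Proof.
split=> [y|x]; last by apply: clift_semilin; apply: mu_real'.
pose m (w : W) := clift (fun v : V => iota (v \otv w)).
have mE x : mu_fun x y = m (rpart y) x + cI *: m (ipart y) x by [].
have ml w a x x' : m w (a *: x + x') = a *: m w x + m w x'.
  exact: (clift_semilin (mu_real w)).
move=> a x x'.
rewrite (mE (a *: x + x')) (mE x) (mE x') (ml (rpart y)) (ml (ipart y)).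
exact: scale_interchange.
Qed.

Definition cmu : 'Hom(vtens (cplx V) (cplx W), cplx (vtens V W)) :=
  linfun (tlift idfun mu_fun).

Lemma cmu_iota v w : cmu (iota v \otv iota w) = iota (v \otv w).
Proof.
rewrite lift_lfunE; try by case: mu_bilin.
by rewrite /mu_fun !clift_iota.
Qed.

Let nu_fun (t : vtens V W) : vtens (cplx V) (cplx W) :=
  \sum_i \sum_j rc ((t : 'M[R]_(dim V, dim W)) i j) *:
     (iota (tbase i) \otv iota (tbase j)).

Let nu_real : real_linear nu_fun.
Proof.
move=> a s t; rewrite /nu_fun scaler_sumr -big_split; apply: eq_bigr => i _.
rewrite /= scaler_sumr -big_split; apply: eq_bigr => j _.
by rewrite /= !mxE rmorphD rmorphM scalerDl scalerA.
Qed.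

Let nu_pure v w : nu_fun (v \otv w) = iota v \otv iota w.
Proof.
rewrite [in RHS](tbase_sum v) (real_linear_sum (@iota_real_linear _ C _)).
rewrite (semilin_sum (sigma := idfun) (@tpure_linearl _ _ _ _)); apply: eq_bigr => i _.
rewrite (real_linearZ (@iota_real_linear _ C _)).
rewrite (semilinZ (sigma := idfun) (@tpure_linearl _ _ _ _)) /=.
rewrite [in RHS](tbase_sum w) (real_linear_sum (@iota_real_linear _ C _)).
rewrite (semilin_sum (sigma := idfun) (@tpure_linearr _ _ _ _)) scaler_sumr.
apply: eq_bigr => j _.
rewrite (real_linearZ (@iota_real_linear _ C _)).
rewrite (semilinZ (sigma := idfun) (@tpure_linearr _ _ _ _)) /= scalerA -rmorphM.
by rewrite /tpure mxE big_ord1 mxE.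
Qed.

Definition cmu_inv : 'Hom(cplx (vtens V W), vtens (cplx V) (cplx W)) :=
  linfun (clift nu_fun).

Lemma cmu_inv_iota v w : cmu_inv (iota (v \otv w)) = iota v \otv iota w.
Proof.
have l : linear (clift nu_fun) by apply: (clift_semilin nu_real).
by rewrite (linfunE l) (clift_iota nu_real) nu_pure.
Qed.

Lemma cplx_tensP (X : vectType C) (f g : 'Hom(cplx (vtens V W), X)) :
  (forall v w, f (iota (v \otv w)) = g (iota (v \otv w))) -> f = g.
Proof.
move=> fg; apply: cplxP => t; rewrite (tpure_base t).
rewrite !(real_linear_sum (@iota_real_linear _ C _)) !linear_sum; apply: eq_bigr => i _.
rewrite !(real_linear_sum (@iota_real_linear _ C _)) !linear_sum; apply: eq_bigr => j _.
by rewrite !(real_linearZ (@iota_real_linear _ C _)) !linearZ /= fg.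
Qed.

Section TensExt.
Variables (sigma : {rmorphism C -> C}) (U : lmodType C).

Lemma tens_cplx_ext (f g : vtens (cplx V) (cplx W) -> U) :
  semilin sigma f -> semilin sigma g ->
  (forall v w, f (iota v \otv iota w) = g (iota v \otv iota w)) -> f =1 g.
Proof.
move=> fl gl fg; apply: (tens_ext fl gl) => x y.
apply: (cplx_ext (semilin_purel y fl) (semilin_purel y gl)) x => v.
by apply: (cplx_ext (semilin_purer _ fl) (semilin_purer _ gl)) y => w.
Qed.

End TensExt.

Lemma tens_cplxP (X : vectType C) (f g : 'Hom(vtens (cplx V) (cplx W), X)) :
  (forall v w, f (iota v \otv iota w) = g (iota v \otv iota w)) -> f = g.
Proof.
move=> fg; apply/lfunP.
exact: (tens_cplx_ext (@lfun_semilin _ _ _ f) (@lfun_semilin _ _ _ g)).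
Qed.

Lemma cmuK : (cmu_inv \o cmu = \1)%VF.
Proof. by apply: tens_cplxP => v w; rewrite comp_lfunE cmu_iota cmu_inv_iota id_lfunE. Qed.

Lemma cmu_invK : (cmu \o cmu_inv = \1)%VF.
Proof. by apply: cplx_tensP => v w; rewrite comp_lfunE cmu_inv_iota cmu_iota id_lfunE. Qed.

Lemma cconj_cmu x y : cconj (cmu (x \otv y)) = cmu (cconj x \otv cconj y).
Proof.
have l1 (y0 : cplx W) : semilin (@conj R C) (fun x => cconj (cmu (x \otv y0))).
  by move=> a u v; rewrite tpure_linearl linearP cconj_semilin.
have l2 (y0 : cplx W) : semilin (@conj R C) (fun x => cmu (cconj x \otv y0)).
  by move=> a u v; rewrite cconj_semilin tpure_linearl linearP.
have l3 (x0 : cplx V) : semilin (@conj R C) (fun y => cconj (cmu (x0 \otv y))).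
  by move=> a u v; rewrite tpure_linearr linearP cconj_semilin.
have l4 (x0 : cplx V) : semilin (@conj R C) (fun y => cmu (x0 \otv cconj y)).
  by move=> a u v; rewrite cconj_semilin tpure_linearr linearP.
apply: (cplx_ext (l1 y) (l2 (cconj y))) x => v; rewrite cconj_iota.
apply: (cplx_ext (l3 _) (l4 _)) y => w.
by rewrite !cmu_iota !cconj_iota cmu_iota.
Qed.

End TensorComparison.

Lemma cmu_nat V V' W W' (f : 'Hom(V, V')) (g : 'Hom(W, W')) :
  (cmu V' W' \o vtensm (cx f) (cx g) = cx (vtensm f g) \o cmu V W)%VF.
Proof.
by apply: tens_cplxP => v w; rewrite !comp_lfunE vtensmE !cx_iota !cmu_iota cx_iota vtensmE.
Qed.

Lemma cmu_assoc V W U :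
  (cx (vassoc V W U) \o cmu (vtens V W) U \o vtensm (cmu V W) \1 =
   cmu V (vtens W U) \o vtensm \1 (cmu W U) \o vassoc (cplx V) (cplx W) (cplx U))%VF.
Proof.
apply: tens3lP => x y z; rewrite !vE.
pose f x y z := cx (vassoc V W U) (cmu (vtens V W) U (cmu V W (x \otv y) \otv z)).
pose g x y z := cmu V (vtens W U) (x \otv cmu W U (y \otv z)).
change (f x y z = g x y z).
have fx y0 z0 : semilin idfun (fun x => f x y0 z0).
  by move=> a u v; rewrite /f !(tpure_linearl, linearP).
have gx y0 z0 : semilin idfun (fun x => g x y0 z0).
  by move=> a u v; rewrite /g !(tpure_linearl, linearP).
have fy x0 z0 : semilin idfun (fun y => f x0 y z0).
  by move=> a u v; rewrite /f tpure_linearr linearP tpure_linearl !linearP.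
have gy x0 z0 : semilin idfun (fun y => g x0 y z0).
  by move=> a u v; rewrite /g tpure_linearl linearP tpure_linearr !linearP.
have fz x0 y0 : semilin idfun (fun z => f x0 y0 z).
  by move=> a u v; rewrite /f tpure_linearr !linearP.
have gz x0 y0 : semilin idfun (fun z => g x0 y0 z).
  by move=> a u v; rewrite /g tpure_linearr linearP tpure_linearr !linearP.
apply: (cplx_ext (fx y z) (gx y z)) x => v.
apply: (cplx_ext (fy _ z) (gy _ z)) y => w.
apply: (cplx_ext (fz _ _) (gz _ _)) z => u.
by rewrite /f /g !cmu_iota cx_iota vassocE.
Qed.

Lemma cmu_braid V W : (cx (vbraid V W) \o cmu V W = cmu W V \o vbraid _ _)%VF.
Proof.
by apply: tens_cplxP => v w; rewrite !comp_lfunE vbraidE !cmu_iota cx_iota vbraidE.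
Qed.

(** The unit comparison C = cplx R. *)
Definition cone : 'Hom(((C : fieldType)^o : vectType C), cplx (R^o : vectType R)) :=
  linfun (fun a : (C : fieldType)^o => (a : C) *: iota (1 : R^o)).
Definition cone_inv : 'Hom(cplx (R^o : vectType R), ((C : fieldType)^o : vectType C)) :=
  linfun (clift (fun a : R^o => rc a : (C : fieldType)^o)).

Lemma coneE (a : (C : fieldType)^o) : cone a = (a : C) *: iota (1 : R^o).
Proof. by apply: linfunE => k x y; rewrite scalerDl scalerA. Qed.

Lemma cone_inv_iota (a : R^o) : cone_inv (iota a) = rc a.
Proof.
have rl : real_linear (fun a : R^o => rc a : (C : fieldType)^o) by move=> k x y; rewrite rmorphD rmorphM.
have l := clift_semilin rl.
by rewrite (linfunE l) (clift_iota rl).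
Qed.

Lemma coneK : (cone_inv \o cone = \1)%VF.
Proof.
apply/lfunP => a; rewrite comp_lfunE id_lfunE coneE linearZ /= cone_inv_iota rmorph1.
by rewrite /GRing.scale /= mulr1.
Qed.

Lemma cone_invK : (cone \o cone_inv = \1)%VF.
Proof.
apply: cplxP => a; rewrite comp_lfunE id_lfunE cone_inv_iota coneE.
by rewrite -(real_linearZ (@iota_real_linear _ C _)) /GRing.scale /= mulr1.
Qed.

Lemma cmu_lunit V :
  (cx (vlunit V) \o cmu (R^o : vectType R) V \o vtensm cone \1 = vlunit (cplx V))%VF.
Proof.
apply: tensP => a x.
rewrite vlunitE.
rewrite !comp_lfunE.
rewrite vtensmE id_lfunE coneE.
rewrite (semilinZ (sigma := idfun) (@tpure_linearl _ _ _ _)) /= !linearZ /=; congr (_ *: _).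
pose f x := cx (vlunit V) (cmu (R^o : vectType R) V (iota (1 : R^o) \otv x)).
have fl : semilin idfun f by move=> k u v; rewrite /f tpure_linearr !linearP.
apply: (cplx_ext fl (g := id)) x => // v.
by rewrite /f cmu_iota cx_iota vlunitE scale1r.
Qed.

Lemma cmu_runit V :
  (cx (vrunit V) \o cmu V (R^o : vectType R) \o vtensm \1 cone = vrunit (cplx V))%VF.
Proof.
apply: tensP => x a.
rewrite vrunitE !comp_lfunE vtensmE id_lfunE coneE.
rewrite (semilinZ (sigma := idfun) (@tpure_linearr _ _ _ _)) /= !linearZ /=; congr (_ *: _).
pose f x := cx (vrunit V) (cmu V (R^o : vectType R) (x \otv iota (1 : R^o))).
have fl : semilin idfun f by move=> k u v; rewrite /f tpure_linearl !linearP.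
apply: (cplx_ext fl (g := id)) x => // v.
by rewrite /f cmu_iota cx_iota vrunitE scale1r.
Qed.

Lemma cconj_cone (a : (C : fieldType)^o) : cconj (cone a) = cone ((@conj R C) a).
Proof. by rewrite !coneE (semilinZ (@cconj_semilin _ C _)) cconj_iota. Qed.

End ComplexMaps.

Global Opaque cmu cmu_inv cx cone cone_inv.

(** * Characters of finite-dimensional commutative algebras *)

Section Characters.
Variables (F : numClosedFieldType) (m : nat).
Variables (c : 'I_m -> 'I_m -> 'I_m -> F) (e : 'I_m -> F).
Implicit Types g d x h : 'rV[F]_m.

(** [c] and [e] present an algebra by a basis [a_j] with
    [a_j * a_k = \sum_i c i j k a_i] and [1 = \sum_i e i a_i]; a row vector [x]
    stands for the linear form [a_i |-> x_i]. The characters are the points of the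
    spectrum of the algebra, and the derivations the tangent vectors there. *)
Definition is_character x :=
  (forall j k, \sum_i x 0 i * c i j k = x 0 j * x 0 k) /\ \sum_i e i * x 0 i = 1.

Definition is_derivation g d :=
  forall j k, \sum_i d 0 i * c i j k = g 0 j * d 0 k + d 0 j * g 0 k.

Hypothesis cC : forall i j k, c i j k = c i k j.
Hypothesis cA : forall i a b k, \sum_l c i l k * c l a b = \sum_l c i a l * c l b k.
Hypothesis c1 : forall i k, \sum_j e j * c i j k = (i == k)%:R.

Let M (j : 'I_m) : 'M[F]_m := \matrix_(i, k) c i k j.

Let mulE h j k : (h *m M j) 0 k = \sum_i h 0 i * c i k j.
Proof. by rewrite mxE; apply: eq_bigr => i _; rewrite mxE. Qed.

Let MM j k : M j *m M k = \sum_l c l k j *: M l.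
Proof.
apply/matrixP => i k'; rewrite mxE summxE.
transitivity (\sum_l c i l j * c l k' k); first by apply: eq_bigr => l _; rewrite !mxE.
by rewrite cA; apply: eq_bigr => l _; rewrite !mxE mulrC.
Qed.

Let MC j k : M j *m M k = M k *m M j.
Proof. by rewrite !MM; apply: eq_bigr => l _; rewrite cC. Qed.

Let M1 : \sum_j e j *: M j = 1%:M.
Proof.
apply/matrixP => i k; rewrite summxE [RHS]mxE -c1; apply: eq_bigr => j _.
by rewrite !mxE cC.
Qed.

Let char_eigen x j : is_character x -> x *m M j = x 0 j *: x.
Proof. by move=> [xM _]; apply/rowP => k; rewrite mulE xM mxE mulrC. Qed.

(** Dedekind's argument: a character in the span of independent characters
    is one of them, as its coordinates are constant where they do not vanish. *)
Lemma character_span s g : free s -> (forall x, x \in s -> is_character x) ->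
  is_character g -> g \in <<s>>%VS -> g \in s.
Proof.
move=> sfree schar gchar gs; pose X := in_tuple s; pose a t := coord X t g.
have gE : g = \sum_t a t *: X`_t by apply: coord_span.
clearbody a.
have Xmem (t : 'I_(size s)) : X`_t \in s by apply: mem_nth (ltn_ord t).
have Xchar (t : 'I_(size s)) : is_character X`_t by apply: schar.
have aX (t : 'I_(size s)) j : a t * (X`_t 0 j) = g 0 j * a t.
  have : \sum_t (a t * X`_t 0 j) *: X`_t = \sum_t (g 0 j * a t) *: X`_t.
    transitivity (g *m M j).
      rewrite gE mulmx_suml; apply: eq_bigr => u _.
      by rewrite -scalemxAl char_eigen // scalerA.
    rewrite char_eigen // {2}gE scaler_sumr; apply: eq_bigr => u _.
    by rewrite scalerA.
  by move=> /(congr1 (coord X t)); rewrite !coord_sum_free.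
have [t at0|a0] := pickP (fun t => a t != 0).
  suff -> : g = X`_t by [].
  apply/rowP => j; apply: (mulfI at0); rewrite aX mulrC.
  by [].
case: gchar => _ /eqP; rewrite big1 ?(eq_sym 0) ?oner_eq0 // => i _.
rewrite gE big1 ?mxE ?mulr0 // => t _.
by have /negbFE/eqP -> := a0 t; rewrite scale0r.
Qed.

(** Characters being independent, a longest free list of characters lists them
    all. *)
Lemma maximal_characters : exists s : seq 'rV[F]_m,
  free s /\ forall x, x \in s <-> is_character x.
Proof.
pose p n := `[< exists s : seq 'rV[F]_m,
  [/\ free s, forall x, x \in s -> is_character x & size s = n] >].
have p0 : exists n, p n by exists 0%N; apply/asboolP; exists [::]; split => //; apply: nil_free.
have ubp n : p n -> (n <= \dim (fullv : {vspace 'rV[F]_m}))%N.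
  move=> /asboolP [s [sfree _ <-]]; have /eqP <- : \dim <<s>> == size s by [].
  by apply: dimvS; apply: subvf.
case: (ex_maxnP p0 ubp) => n /asboolP [s [sfree schar sn]] nmax.
exists s; split=> // x; split=> [|xchar]; first exact: schar.
apply: (character_span sfree schar xchar); apply: contraT => xs.
suff : (size (x :: s) <= n)%N by rewrite /= sn ltnn.
apply: nmax; apply/asboolP; exists (x :: s); split=> //.
  by rewrite free_cons xs.
by move=> y; rewrite inE => /predU1P [->|/schar].
Qed.

Section Span.
Variable s : seq 'rV[F]_m.
Hypotheses (sfree : free s) (schar : forall x, x \in s <-> is_character x).

Let X := in_tuple s.
Let Xmem (t : 'I_(size s)) : X`_t \in s.
Proof. exact: mem_nth (ltn_ord t). Qed.

Let Xchar (t : 'I_(size s)) : is_character X`_t.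
Proof. exact/schar. Qed.

Let spanE x : x \in <<s>>%VS -> x = \sum_t coord X t x *: X`_t.
Proof. exact: (@coord_span _ _ _ X). Qed.

(** The multiplications act on the quotient by the span of the characters, and
    being commuting operators they have a common eigenvector there. *)
Lemma quotient_eigenvector : <<s>>%VS != fullv ->
  exists2 h, h \notin <<s>>%VS & exists chi : 'rV[F]_m,
    forall j, h *m M j - chi 0 j *: h \in <<s>>%VS.
Proof.
move=> sNfull.
pose L : 'M[F]_(size s, m) := \matrix_t X`_t.
have inL x : (x \in <<s>>%VS) = (x <= L)%MS.
  apply/idP/idP => [xs|/submxP [D ->]].
    rewrite [x](spanE xs).
    apply: summx_sub => t _; apply: scalemx_sub.
    by apply: (@submx_trans _ _ _ _ _ _ (row t L)); rewrite ?row_sub // rowK.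
  rewrite mulmx_sum_row rpred_sum // => t _; rewrite rowK rpredZ //.
  by rewrite memv_span.
have [n [B [B' [n_gt0 BB' B'0]]]] : exists n (B : 'M[F]_(n, m)) (B' : 'M[F]_(m, n)),
    [/\ (0 < n)%N, B *m B' = 1%:M & forall x, (x \in <<s>>%VS) = (x *m B' == 0)].
  exists (\rank (cokermx L)), (pinvmx (col_base (cokermx L))), (col_base (cokermx L)).
  split=> [||x].
  - rewrite lt0n mxrank_eq0; apply: contraNneq sNfull => L0.
    by apply/eqP/vspaceP => x; rewrite memvf inL submxE L0 mulmx0 eqxx.
  - by rewrite mulVpmx // col_base_full.
  - by rewrite inL submxE -{1}[cokermx L]mulmx_base mulmxA mulmx_free_eq0 // row_base_free.
pose A j := B *m M j *m B'.
have AE j : A j = B *m M j *m B' by [].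
clearbody A.
have stab x j : x \in <<s>>%VS -> x *m M j \in <<s>>%VS.
  move=> xs; rewrite [x](spanE xs).
  rewrite mulmx_suml rpred_sum // => t _.
  by rewrite -scalemxAl rpredZ // char_eigen // rpredZ // memv_span.
have MB' j : M j *m B' = B' *m A j.
  apply/row_matrixP => i; rewrite !rowE; set x := delta_mx _ _.
  rewrite AE !mulmxA; apply/eqP; rewrite -subr_eq0 -!mulmxBl. rewrite -B'0 stab // B'0.
  by rewrite mulmxBl -!mulmxA BB' mulmx1 subrr.
have AC j k : A j *m A k = A k *m A j.
  rewrite -[A j *m _]mul1mx -[A k *m _]mul1mx -BB' -!mulmxA; congr (B *m _).
  by rewrite !(mulmxA B') -!MB' -!mulmxA -!MB' !mulmxA MC.
have [|v v0 /allP vA] := @common_eigenvector _ _ [seq A j | j <- enum 'I_m] n_gt0.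
  by move=> _ _ /mapP [j _ ->] /mapP [k _ ->]; apply: AC.
have /all_sig [chi chiE] j : {a | v *m A j = a *: v}.
  apply: cid; apply/sub_rVP.
  by apply: vA; rewrite map_f // mem_enum.
exists (v *m B).
  by rewrite B'0 -mulmxA BB' mulmx1.
exists (\row_j chi j) => j; rewrite B'0 mxE mulmxBl -scalemxAl -(mulmxA v B B') BB' mulmx1.
by rewrite -chiE AE !mulmxA subrr.
Qed.

Hypothesis no_derivation : forall g d, is_character g -> is_derivation g d -> d = 0.

(** A finite-dimensional commutative algebra over an algebraically closed field
    without tangent vectors at its points is a product of copies of the field.
    Otherwise take an eigenvector [h] modulo the characters [X_t], so that
    [h M_j = chi_j h + \sum_t gam_t,j X_t]. Associativity shows that [chi] is a character and, with commutativity, that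
    [(chi - X_t)_j gam_t,k] is symmetric in [j] and [k]. Hence [gam_t] is a
    multiple of [chi - X_t] or, when [chi = X_t], a derivation, which is zero.
    Evaluating the relation at the unit now puts [h] in the span. *)
Lemma characters_span : <<s>>%VS = fullv.
Proof.
apply/eqP/negPn/negP => /quotient_eigenvector [h hs [chi chiP]].
pose gam t : 'rV[F]_m := \row_j coord X t (h *m M j - chi 0 j *: h).
have hM j : h *m M j = chi 0 j *: h + \sum_t gam t 0 j *: X`_t.
  rewrite -[LHS](subrK (chi 0 j *: h)) addrC; congr (_ + _).
  by rewrite {1}(spanE (chiP j)); apply: eq_bigr => t _; rewrite mxE.
clearbody gam.
have indep a b (f g : 'I_(size s) -> F) :
    a *: h + \sum_t f t *: X`_t = b *: h + \sum_t g t *: X`_t -> a = b /\ f =1 g.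
  have Xin (k : 'I_(size s) -> F) : \sum_t k t *: X`_t \in <<s>>%VS.
    by rewrite rpred_sum // => t _; rewrite rpredZ // memv_span.
  move=> fg; have fg' : a *: h + \sum_t f t *: X`_t = \sum_t g t *: X`_t + b *: h.
    by rewrite fg addrC.
  have ab : a = b.
    apply/eqP; rewrite -subr_eq0; apply: contraNT hs => ab0.
    rewrite -[h](scalerK ab0) rpredZ // scalerBl.
    have -> : a *: h - b *: h = \sum_t g t *: X`_t - \sum_t f t *: X`_t.
      by apply/eqP; rewrite subr_eq addrAC -fg' addrK.
    by rewrite rpredB.
  split=> // t; move: fg; rewrite ab => /addrI /(congr1 (coord X t)).
  by rewrite !coord_sum_free.
have relMM j k :
    (forall t, \sum_l gam t 0 l * c l k j = chi 0 j * gam t 0 k + gam t 0 j * X`_t 0 k)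
    /\ \sum_l chi 0 l * c l k j = chi 0 j * chi 0 k.
  have : h *m M j *m M k = h *m (\sum_l c l k j *: M l) by rewrite -mulmxA MM.
  have -> : h *m (\sum_l c l k j *: M l) =
      (\sum_l chi 0 l * c l k j) *: h + \sum_t (\sum_l gam t 0 l * c l k j) *: X`_t.
    rewrite mulmx_sumr scaler_suml.
    under [X in _ + X]eq_bigr do rewrite scaler_suml.
    rewrite exchange_big -big_split; apply: eq_bigr => l _ /=.
    rewrite -scalemxAr hM scalerDr scalerA [c l k j * _]mulrC; congr (_ + _).
    by rewrite scaler_sumr; apply: eq_bigr => t _; rewrite scalerA mulrC.
  have -> : h *m M j *m M k = (chi 0 j * chi 0 k) *: h +
      \sum_t (chi 0 j * gam t 0 k + gam t 0 j * X`_t 0 k) *: X`_t.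
    rewrite hM mulmxDl -scalemxAl hM scalerDr scalerA -addrA; congr (_ + _).
    rewrite scaler_sumr mulmx_suml -big_split; apply: eq_bigr => t _ /=.
    by rewrite -scalemxAl char_eigen // !scalerA scalerDl.
  by move=> /indep [-> gE]; split=> // t; rewrite gE.
have chichar : is_character chi.
  split=> [j k|]; first by have [_ ->] := relMM k j; rewrite mulrC.
  have : h = (\sum_j e j * chi 0 j) *: h + \sum_t (\sum_j e j * gam t 0 j) *: X`_t.
    rewrite -{1}[h]mulmx1 -M1 mulmx_sumr scaler_suml.
    under [X in _ + X]eq_bigr do rewrite scaler_suml.
    rewrite exchange_big -big_split; apply: eq_bigr => j _ /=.
    rewrite -scalemxAr hM scalerDr scalerA scaler_sumr; congr (_ + _).
    by apply: eq_bigr => t _; rewrite scalerA.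
  rewrite -{1}[h]scale1r -[1 *: h]addr0.
  rewrite -{1}(_ : \sum_(t < size s) (0 : F) *: X`_t = 0); last by rewrite big1 // => t _; rewrite scale0r.
  by move=> /indep [<-].
have gam_span t : gam t \in <<s>>%VS.
  have gamC j k : (chi 0 j - X`_t 0 j) * gam t 0 k = (chi 0 k - X`_t 0 k) * gam t 0 j.
    have [/(_ t) e1 _] := relMM j k; have [/(_ t) e2 _] := relMM k j.
    have : chi 0 j * gam t 0 k + gam t 0 j * X`_t 0 k = chi 0 k * gam t 0 j + gam t 0 k * X`_t 0 j.
      by rewrite -e1 -e2; apply: eq_bigr => l _; rewrite cC.
    move=> /eqP; rewrite -subr_eq0 => /eqP e0; apply/eqP; rewrite -subr_eq0 -e0.
    by apply/eqP; ring.
  have [k dk|eqX] := pickP (fun k => chi 0 k != X`_t 0 k).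
    have -> : gam t = (gam t 0 k / (chi 0 k - X`_t 0 k)) *: (chi - X`_t).
      apply/rowP => j; rewrite !mxE mulrAC [gam t 0 k * _]mulrC gamC.
      by rewrite mulrC mulKf // subr_eq0.
    rewrite rpredZ // rpredB // memv_span //.
    by apply/schar.
  have -> : gam t = 0; last by rewrite mem0v.
  apply: (no_derivation (Xchar t)) => j k.
  have [/(_ t) gE _] := relMM k j; rewrite gE.
  by have /negbFE/eqP -> := eqX k; rewrite addrC [X in X + _]mulrC [X in _ + X]mulrC.
case/negP: hs.
have -> : h = (\sum_k e k * h 0 k) *: chi + \sum_t gam t.
  apply/rowP => j; rewrite !mxE summxE.
  transitivity (\sum_k e k * (h *m M j) 0 k).
    under eq_bigr do rewrite mulE mulr_sumr.
    rewrite exchange_big (bigD1 j) //= [X in _ + X]big1 ?addr0.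
      transitivity (h 0 j * \sum_k e k * c j k j); first by rewrite c1 eqxx mulr1.
      by rewrite mulr_sumr; apply: eq_bigr => k _; rewrite mulrCA.
    move=> i ij; transitivity (h 0 i * \sum_k e k * c i k j).
      by rewrite mulr_sumr; apply: eq_bigr => k _; rewrite mulrCA.
    by rewrite c1 (negPf ij) mulr0.
  under eq_bigr do rewrite hM mxE mulrDr mxE summxE mulr_sumr.
  rewrite big_split /= mulr_suml; congr (_ + _).
    by apply: eq_bigr => k _; rewrite mulrCA mulrC.
  rewrite exchange_big; apply: eq_bigr => t _ /=.
  have [_ X1] := Xchar t.
  rewrite -[RHS]mulr1 -X1 mulr_sumr; apply: eq_bigr => k _.
  by rewrite mxE mulrCA.
rewrite rpredD ?rpred_sum // rpredZ // memv_span //.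
by apply/schar.
Qed.

End Span.
End Characters.

(** * Natural endomorphisms of a fiber functor *)

Section TensorIndependence.
Variable K : fieldType.
Implicit Types V W : vectType K.

Definition independent (U : lmodType K) n (u : 'I_n -> U) :=
  forall a : 'I_n -> K, \sum_j a j *: u j = 0 -> forall j, a j = 0.

Lemma independent_eq (U : lmodType K) n (u : 'I_n -> U) a b : independent u ->
  \sum_j a j *: u j = \sum_j b j *: u j -> a =1 b.
Proof.
move=> uI ab j; apply/eqP; rewrite -subr_eq0; apply/eqP.
apply: (uI (fun j => a j - b j)).
under eq_bigr do rewrite scalerBl.
by rewrite sumrB ab subrr.
Qed.

Lemma linear_comb (U U' : lmodType K) (f : U -> U') I (r : seq I) (a : I -> K) (x : I -> U) :
  linear f -> f (\sum_(i <- r) a i *: x i) = \sum_(i <- r) a i *: f (x i).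
Proof.
move=> fl; rewrite (semilin_sum (sigma := idfun) fl).
by apply: eq_bigr => i _; rewrite (semilinZ (sigma := idfun) fl).
Qed.

Lemma vtensm_combr V V' W W' (f : 'Hom(V, V')) I (r : seq I) (a : I -> K) (g : I -> 'Hom(W, W')) :
  vtensm f (\sum_(i <- r) a i *: g i) = \sum_(i <- r) a i *: vtensm f (g i).
Proof. exact/linear_comb/vtensm_linearr. Qed.

Lemma vtensm_combl V V' W W' (g : 'Hom(W, W')) I (r : seq I) (a : I -> K) (f : I -> 'Hom(V, V')) :
  vtensm (\sum_(i <- r) a i *: f i) g = \sum_(i <- r) a i *: vtensm (f i) g.
Proof. exact: (linear_comb _ _ _ (vtensm_linearl g)). Qed.

Lemma comp_combr V V' W (g : 'Hom(V', W)) I (r : seq I) (a : I -> K) (f : I -> 'Hom(V, V')) :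
  (g \o (\sum_(i <- r) a i *: f i) = \sum_(i <- r) a i *: (g \o f i))%VF.
Proof. exact: (linear_comb _ _ _ (vcomp_linearr g)). Qed.

Lemma comp_combl V V' W (f : 'Hom(V, V')) I (r : seq I) (a : I -> K) (g : I -> 'Hom(V', W)) :
  ((\sum_(i <- r) a i *: g i) \o f = \sum_(i <- r) a i *: (g i \o f))%VF.
Proof. exact: (linear_comb _ _ _ (vcomp_linearl f)). Qed.

Lemma comp_lfun_suml V W U (f : 'Hom(V, W)) I (r : seq I) (g : I -> 'Hom(W, U)) :
  ((\sum_(i <- r) g i) \o f = \sum_(i <- r) (g i \o f))%VF.
Proof.
by apply: (big_morph (fun h => (h \o f)%VF)) => [h h'|]; rewrite ?comp_lfunDl ?comp_lfun0l.
Qed.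

Lemma comp_lfun_sumr V W U (g : 'Hom(W, U)) I (r : seq I) (f : I -> 'Hom(V, W)) :
  (g \o (\sum_(i <- r) f i) = \sum_(i <- r) (g \o f i))%VF.
Proof.
by apply: (big_morph (fun h => (g \o h)%VF)) => [h h'|]; rewrite ?comp_lfunDr ?comp_lfun0r.
Qed.

Lemma tensm_indep V V' W W' n (u : 'I_n -> 'Hom(V, V')) (y : 'I_n -> 'Hom(W, W')) :
  independent u -> \sum_j vtensm (u j) (y j) = 0 -> forall j, y j = 0.
Proof.
move=> uI uy0 j; apply/lfunP => w; rewrite zero_lfunE.
apply: v2r_inj; rewrite linear0; apply/rowP => i; rewrite mxE.
apply: (uI (fun j => v2r (y j w) 0 i)); apply/lfunP => v.
rewrite zero_lfunE; apply: v2r_inj; rewrite linear0; apply/rowP => p; rewrite mxE.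
have : \sum_j (u j v \otv y j w) = 0.
  have := congr1 (fun f : 'Hom(_, _) => f (v \otv w)) uy0.
  rewrite /= zero_lfunE sum_lfunE => uy1; rewrite -[RHS]uy1.
  by apply: eq_bigr => k _; rewrite vtensmE.
move=> /matrixP /(_ p i); rewrite [RHS]mxE => <-.
rewrite sum_lfunE linear_sum [LHS]summxE [RHS]summxE; apply: eq_bigr => k _.
by rewrite scale_lfunE linearZ mxE /tpure mxE big_ord1 mxE mulrC.
Qed.

Lemma tensm_indep_r V V' W W' n (u : 'I_n -> 'Hom(W, W')) (y : 'I_n -> 'Hom(V, V')) :
  independent u -> \sum_j vtensm (y j) (u j) = 0 -> forall j, y j = 0.
Proof.
move=> uI uy0; apply: (tensm_indep uI).
transitivity (vbraid V' W' \o (\sum_j vtensm (y j) (u j)) \o vbraid W V)%VF.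
  apply: tensP => w v; rewrite !comp_lfunE !sum_lfunE vbraidE linear_sum.
  by apply: eq_bigr => j _; rewrite /= !vtensmE vbraidE.
by rewrite uy0 comp_lfun0r comp_lfun0l.
Qed.

Lemma tensm_indep2 V V' W W' n n' (u : 'I_n -> 'Hom(V, V')) (w : 'I_n' -> 'Hom(W, W')) a b :
  independent u -> independent w ->
  \sum_i \sum_j a i j *: vtensm (u i) (w j) = \sum_i \sum_j b i j *: vtensm (u i) (w j) ->
  forall i j, a i j = b i j.
Proof.
move=> uI wI ab i; apply: (independent_eq wI).
apply/eqP; rewrite -subr_eq0; apply/eqP.
pose y i := \sum_j a i j *: w j - \sum_j b i j *: w j.
apply: (tensm_indep uI (y := y)).
have -> : \sum_i vtensm (u i) (y i) =
    \sum_i (\sum_j a i j *: vtensm (u i) (w j) - \sum_j b i j *: vtensm (u i) (w j)).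
  apply: eq_bigr => k _; rewrite -!vtensm_combr.
  by rewrite (semilinD (sigma := idfun) (vtensm_linearr _)) (semilinN (sigma := idfun) (vtensm_linearr _)).
by rewrite sumrB ab subrr.
Qed.

Section TensorCommutant.
Variables (V : vectType K) (S : 'End(V) -> Prop) (m : nat) (e : 'I_m -> 'End(V)).
Hypothesis eI : independent e.
Hypothesis e_span : forall a : 'End(V), (forall b, S b -> (b \o a = a \o b)%VF) ->
  exists x, a = \sum_j x j *: e j.

(** The commutant of a tensor product is the tensor product of the commutants:
    contracting [theta] on the second factor gives maps in the span of the [e j],
    so that [theta] is a sum of [e j] tensored with some [y j]; as the [e j] are
    independent, each [y j] commutes with [S] too. *)
Lemma tensor_commutant (theta : 'End(vtens V V)) :
  (forall b, S b -> (vtensm b \1 \o theta = theta \o vtensm b \1)%VF) ->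
  (forall b, S b -> (vtensm \1 b \o theta = theta \o vtensm \1 b)%VF) ->
  exists t, theta = \sum_j \sum_k t j k *: vtensm (e j) (e k).
Proof.
move=> thl thr.
pose crd (q : 'I_(dim V)) : 'Hom(V, K^o) := linfun (fun w => v2r w 0 q : K^o).
have crdE q w : crd q w = v2r w 0 q.
  by apply: linfunE => a u v; rewrite linearP !mxE.
pose sl q : 'Hom(vtens V V, V) := (vrunit V \o vtensm \1 (crd q))%VF.
have slE q v w : sl q (v \otv w) = v2r w 0 q *: v.
  by rewrite comp_lfunE vtensmE vrunitE crdE id_lfunE.
clearbody sl.
pose ins p : 'Hom(V, vtens V V) := linfun (fun v => v \otv tbase p).
have insE p v : ins p v = v \otv tbase p by apply: linfunE; apply: tpure_linearl.
clearbody ins.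
pose th p q : 'End(V) := (sl q \o theta \o ins p)%VF.
have /all_sig2 [x xE _] pq : {x | th pq.1 pq.2 = \sum_j x j *: e j & True}.
  suff /cid [x xE] : exists x, th pq.1 pq.2 = \sum_j x j *: e j by exists x.
  apply: e_span => b Sb; have bsl q : (b \o sl q = sl q \o vtensm b \1)%VF.
    by apply: tensP => v w; rewrite !comp_lfunE vtensmE !slE linearZ id_lfunE.
  have bins p : (vtensm b \1 \o ins p = ins p \o b)%VF.
    by apply/lfunP => v; rewrite !comp_lfunE !insE vtensmE id_lfunE.
  by rewrite /th !comp_lfunA bsl -(comp_lfunA (sl _)) thl // -!comp_lfunA bins.
pose E p q : 'End(V) := linfun (fun w => v2r w 0 p *: tbase q).
have EE p q w : E p q w = v2r w 0 p *: tbase q.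
  by apply: linfunE => a u v; rewrite linearP !mxE scalerDl scalerA.
clearbody E.
pose y j := \sum_p \sum_q x (p, q) j *: E p q.
have thE : theta = \sum_j vtensm (e j) (y j).
  have tE t : t = \sum_q sl q t \otv tbase q.
    pose id' : 'End(vtens V V) := \sum_q (linfun (fun v => v \otv tbase q) \o sl q)%VF.
    transitivity (id' t); last first.
      rewrite sum_lfunE; apply: eq_bigr => q _.
      by rewrite comp_lfunE linfunE //; apply: tpure_linearl.
    rewrite -[LHS](id_lfunE t); congr (fun_of_lfun _ t); apply: tensP => v w.
    rewrite id_lfunE sum_lfunE {1}(tbase_sum w) (semilin_sum (sigma := idfun) (@tpure_linearr _ _ _ _)).
    apply: eq_bigr => q _; rewrite comp_lfunE slE linfunE; last exact: tpure_linearl.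
    rewrite (semilinZ (sigma := idfun) (@tpure_linearr _ _ _ _)).
    by rewrite (semilinZ (sigma := idfun) (@tpure_linearl _ _ _ _)).
  apply: tensP => v w; rewrite [LHS]tE.
  transitivity (\sum_q \sum_p th p q v \otv E p q w).
    apply: eq_bigr => q _.
    rewrite {1}(tbase_sum w) (semilin_sum (sigma := idfun) (@tpure_linearr _ _ _ _)).
    rewrite !linear_sum /= (semilin_sum (sigma := idfun) (@tpure_linearl _ _ _ _)).
    apply: eq_bigr => p _; rewrite EE /th !comp_lfunE insE.
    rewrite !(semilinZ (sigma := idfun) (@tpure_linearr _ _ _ _)) !linearZ /=.
    by rewrite (semilinZ (sigma := idfun) (@tpure_linearl _ _ _ _)).
  transitivity (\sum_q \sum_p \sum_j x (p, q) j *: (e j v \otv E p q w)).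
    apply: eq_bigr => q _; apply: eq_bigr => p _.
    rewrite (xE (p, q)) sum_lfunE (semilin_sum (sigma := idfun) (@tpure_linearl _ _ _ _)).
    apply: eq_bigr => j _; rewrite scale_lfunE.
    by rewrite (semilinZ (sigma := idfun) (@tpure_linearl _ _ _ _)).
  rewrite sum_lfunE exchange_big; under eq_bigr do rewrite exchange_big.
  rewrite exchange_big; apply: eq_bigr => j _ /=; rewrite vtensmE /y.
  rewrite sum_lfunE (semilin_sum (sigma := idfun) (@tpure_linearr _ _ _ _)).
  apply: eq_bigr => p _.
  rewrite sum_lfunE (semilin_sum (sigma := idfun) (@tpure_linearr _ _ _ _)).
  apply: eq_bigr => q _; rewrite scale_lfunE.
  by rewrite (semilinZ (sigma := idfun) (@tpure_linearr _ _ _ _)).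
have yE j : exists t, y j = \sum_k t k *: e k.
  apply: e_span => b Sb.
  apply/eqP; rewrite -subr_eq0; apply/eqP; move: j.
  apply: (tensm_indep eI).
  transitivity ((vtensm \1 b \o theta) - (theta \o vtensm \1 b))%VF; last by rewrite thr // subrr.
  rewrite thE; apply: tensP => v w.
  rewrite add_lfunE opp_lfunE !comp_lfunE vtensmE !sum_lfunE linear_sum -sumrB.
  apply: eq_bigr => j _; rewrite /= !vtensmE add_lfunE opp_lfunE !comp_lfunE !id_lfunE.
  rewrite (semilinD (sigma := idfun) (@tpure_linearr _ _ _ _)).
  by rewrite (semilinN (sigma := idfun) (@tpure_linearr _ _ _ _)).
have /all_sig [t tE] j : {t | y j = \sum_k t k *: e k} by apply: cid.
exists t; rewrite thE; apply: eq_bigr => j _; rewrite tE.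
exact: vtensm_combr.
Qed.

End TensorCommutant.
End TensorIndependence.

Lemma lfun_regular (K : fieldType) (V : vectType K) (f : 'Hom((K^o : vectType K), V)) x :
  f x = (x : K) *: f 1.
Proof.
by rewrite -linearZ /=; congr (fun_of_lfun f _); rewrite /GRing.scale /= mulr1.
Qed.

Section FunctorToVec.
Variables (K : fieldType) (C : symmoncat K) (F : symmonfunctor C (Vec K)).

(** The data of a functor to vector spaces, with the types of linear algebra. *)
Definition FO (X : C) : vectType K := F X.
Definition Fm (X Y : C) (f : mor X Y) : 'Hom(FO X, FO Y) := fmap F f.
Definition FJ (X Y : C) : 'Hom(vtens (FO X) (FO Y), FO (X \ox Y)) := smf_mul F X Y.
Definition F1 : 'Hom(K^o : vectType K, FO unit_ob) := smf_one F.

Lemma Fm1 X : Fm (idm X) = \1%VF.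
Proof. exact: (fmap1 F). Qed.

Lemma FmM X Y Z (g : mor Y Z) (f : mor X Y) : Fm (g \oc f) = (Fm g \o Fm f)%VF.
Proof. exact: (fmapM F). Qed.

Lemma Fm_linear X Y : linear (@Fm X Y).
Proof. exact: (fmap_linear F). Qed.

Lemma Fm_sum X Y I (r : seq I) (f : I -> mor X Y) :
  Fm (\sum_(i <- r) f i) = \sum_(i <- r) Fm (f i).
Proof. exact: (fmap_sum F). Qed.

Lemma FJ_nat X X' Y Y' (f : mor X X') (g : mor Y Y') :
  (FJ X' Y' \o vtensm (Fm f) (Fm g) = Fm (f \oxm g) \o FJ X Y)%VF.
Proof. exact: (smf_mul_nat F). Qed.

Lemma FJ_assoc X Y Z :
  (Fm (assoc X Y Z) \o FJ (X \ox Y) Z \o vtensm (FJ X Y) \1 =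
   FJ X (Y \ox Z) \o vtensm \1 (FJ Y Z) \o vassoc (FO X) (FO Y) (FO Z))%VF.
Proof. exact: (smf_assoc F). Qed.

Lemma FJ_lunit X : (Fm (lunit X) \o FJ unit_ob X \o vtensm F1 \1 = vlunit (FO X))%VF.
Proof. exact: (smf_lunit F). Qed.

Lemma FJ_runit X : (Fm (runit X) \o FJ X unit_ob \o vtensm \1 F1 = vrunit (FO X))%VF.
Proof. exact: (smf_runit F). Qed.

Lemma FJ_braid X Y : (Fm (braid X Y) \o FJ X Y = FJ Y X \o vbraid (FO X) (FO Y))%VF.
Proof. exact: (smf_braid F). Qed.

Lemma FJ_iso X Y : exists G : 'Hom(FO (X \ox Y), vtens (FO X) (FO Y)),
  (G \o FJ X Y = \1)%VF /\ (FJ X Y \o G = \1)%VF.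
Proof. exact: (smf_mul_iso F). Qed.

Lemma F1_iso : exists G : 'Hom(FO unit_ob, K^o : vectType K),
  (G \o F1 = \1)%VF /\ (F1 \o G = \1)%VF.
Proof. exact: (smf_one_iso F). Qed.

Lemma unit_scalar (t : 'End(FO unit_ob)) : exists a, (t \o F1 = a *: F1)%VF.
Proof.
have [G [GF FG]] := F1_iso; exists (G (t (F1 1))).
have -> : (t \o F1 = F1 \o (G \o t \o F1))%VF.
  by rewrite !comp_lfunA FG comp_lfun1l.
pose h : 'End(K^o : vectType K) := (G \o t \o F1)%VF.
have -> : G (t (F1 1)) = h 1 by rewrite /h !comp_lfunE.
apply/lfunP => x; rewrite -/h scale_lfunE comp_lfunE (lfun_regular h x) linearZ /=.
rewrite (lfun_regular F1 (h 1)) (lfun_regular F1 x) !scalerA; congr (_ *: _).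
exact: mulrC.
Qed.

Lemma F1_neq0 : F1 != 0.
Proof.
have [G [GF _]] := F1_iso; apply/eqP => F0.
have /lfunP /(_ 1) := GF; rewrite F0 comp_lfun0r zero_lfunE id_lfunE => /eqP.
by rewrite eq_sym oner_eq0.
Qed.

End FunctorToVec.

Section LinearIso.
Variable K : fieldType.
Implicit Types V W U : vectType K.

Definition lfun_iso V W (f : 'Hom(V, W)) :=
  exists g : 'Hom(W, V), (g \o f = \1)%VF /\ (f \o g = \1)%VF.

Lemma lfun_iso_epi V W U (f : 'Hom(V, W)) (g h : 'Hom(W, U)) :
  lfun_iso f -> (g \o f = h \o f)%VF -> g = h.
Proof.
move=> [f' [_ ff']] /(congr1 (fun k => (k \o f')%VF)).
by rewrite -!comp_lfunA ff' !comp_lfun1r.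
Qed.

Lemma lfun_iso_mono V W U (f : 'Hom(W, U)) (g h : 'Hom(V, W)) :
  lfun_iso f -> (f \o g = f \o h)%VF -> g = h.
Proof.
move=> [f' [f'f _]] /(congr1 (fun k => (f' \o k)%VF)).
by rewrite !comp_lfunA f'f !comp_lfun1l.
Qed.

Lemma lfun_iso_comp V W U (f : 'Hom(V, W)) (g : 'Hom(W, U)) :
  lfun_iso f -> lfun_iso g -> lfun_iso (g \o f)%VF.
Proof.
move=> [f' [f'f ff']] [g' [g'g gg']]; exists (f' \o g')%VF; split.
  by rewrite comp_lfunA -(comp_lfunA f') g'g comp_lfun1r.
by rewrite comp_lfunA -(comp_lfunA g) ff' comp_lfun1r.
Qed.

Lemma lfun_iso_tens V V' W W' (f : 'Hom(V, V')) (g : 'Hom(W, W')) :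
  lfun_iso f -> lfun_iso g -> lfun_iso (vtensm f g).
Proof.
move=> [f' [f'f ff']] [g' [g'g gg']]; exists (vtensm f' g').
by rewrite -!vtensmM f'f ff' g'g gg' !vtensm1.
Qed.

Lemma lfun_iso1 V : lfun_iso (\1%VF : 'End(V)).
Proof. by exists \1%VF; rewrite comp_lfun1l. Qed.

Lemma vassoc_iso V W U : lfun_iso (vassoc V W U).
Proof. by exists (vassoci V W U); split; [apply: vassocK | apply: vassociK]. Qed.

Lemma vbraid_iso V W : lfun_iso (vbraid V W).
Proof. by exists (vbraid W V); split; apply: vbraidK. Qed.

Lemma vlunit_iso V : lfun_iso (vlunit V).
Proof. by exists (vlunit_inv V); split; [apply: vlunitK | apply: vlunit_invK]. Qed.

End LinearIso.

Section NaturalEndomorphisms.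
Variables (K : fieldType) (C : symmoncat K) (F : symmonfunctor C (Vec K)).
Variables (P : C) (Pgen : forall X : C, retract_of P X).
Local Notation FO := (FO F).
Local Notation Fm := (Fm F).
Local Notation FJ := (FJ F).
Local Notation F1 := (F1 F).

Definition natural (a : forall X, 'End(FO X)) :=
  forall X Y (f : mor X Y), (Fm f \o a X = a Y \o Fm f)%VF.

Let S (b : 'End(FO P)) := exists f : mor P P, b = Fm f.
Let commutes (a : 'End(FO P)) := forall b, S b -> (b \o a = a \o b)%VF.

Lemma commutant_vspace : exists U : {vspace 'End(FO P)}, forall a, a \in U <-> commutes a.
Proof.
apply: vspace_of_pred => [b _|k u v uS vS b Sb]; first by rewrite comp_lfun0l comp_lfun0r.
by rewrite comp_lfunDl comp_lfunDr -comp_lfunZl -comp_lfunZr uS ?vS.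
Qed.

Definition endo_space : {vspace 'End(FO P)} := projT1 (cid commutant_vspace).

Definition endo_dim := \dim endo_space.

Definition endo_base (j : 'I_endo_dim) : 'End(FO P) := (vbasis endo_space)`_j.

Let spaceP a : a \in endo_space <-> commutes a.
Proof. by rewrite /endo_space; case: cid. Qed.

Lemma endo_base_indep : independent endo_base.
Proof.
by move=> a; apply: (elimT freeP (basis_free (vbasisP endo_space))).
Qed.

Let base_commutes j : commutes (endo_base j).
Proof. by apply/spaceP/vbasis_mem/memt_nth. Qed.

Let commutes_comb a : commutes a -> exists x, a = \sum_j x j *: endo_base j.
Proof.
move=> /spaceP aU; exists (fun j => coord (vbasis endo_space) j a).
exact: coord_vbasis.
Qed.

Let rn X := projT1 (cid (Pgen X)).
Let Pgen_f X : exists f : 'I_(rn X) -> mor P X, exists g : 'I_(rn X) -> mor X P,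
  \sum_i (f i \oc g i) = idm X.
Proof. by rewrite /rn; case: cid. Qed.
Let rf X := projT1 (cid (Pgen_f X)).
Arguments rf : clear implicits.
Let Pgen_g X : exists g : 'I_(rn X) -> mor X P, \sum_i (rf X i \oc g i) = idm X.
Proof. by rewrite /rf; case: cid. Qed.
Let rg X := projT1 (cid (Pgen_g X)).
Arguments rg : clear implicits.
Let rfg X : \sum_i (rf X i \oc rg X i) = idm X.
Proof. by rewrite /rg; case: cid. Qed.

Let Frfg X : \sum_i (Fm (rf X i) \o Fm (rg X i))%VF = \1%VF.
Proof. by rewrite -Fm1 -rfg Fm_sum; apply: eq_bigr => i _; rewrite FmM. Qed.

(** An endomorphism of the generator extends to all objects through their
    presentation as retracts of sums of copies of the generator. *)
Let ext (a : 'End(FO P)) X : 'End(FO X) := \sum_i (Fm (rf X i) \o a \o Fm (rg X i))%VF.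

Let ext_nat a : commutes a -> natural (ext a).
Proof.
move=> ca X Y h.
transitivity (\sum_j \sum_i (Fm (rf Y j) \o Fm (rg Y j \oc h \oc rf X i) \o a \o Fm (rg X i))%VF).
  rewrite /ext -[LHS]comp_lfun1l -Frfg comp_lfun_suml; apply: eq_bigr => j _.
  rewrite !comp_lfun_sumr; apply: eq_bigr => i _.
  by rewrite !FmM !comp_lfunA.
rewrite /ext -[RHS]comp_lfun1r -Frfg comp_lfun_sumr exchange_big; apply: eq_bigr => i _ /=.
rewrite !comp_lfun_suml; apply: eq_bigr => j _.
rewrite -[in LHS](comp_lfunA (Fm (rf Y j))) ca; last by eexists.
by rewrite !FmM !comp_lfunA.
Qed.

Lemma natural_retract (a b : forall X, 'End(FO X)) : natural a -> natural b ->
  a P = b P -> forall X, a X = b X.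
Proof.
move=> na nb ab X; rewrite -[a X]comp_lfun1r -[b X]comp_lfun1r -Frfg !comp_lfun_sumr.
by apply: eq_bigr => i _; rewrite !comp_lfunA -na -nb ab.
Qed.

(** The natural endomorphisms of [F] are the commutant of the endomorphisms of the
    generator; [endo] is a basis of them. *)
Definition endo (j : 'I_endo_dim) X : 'End(FO X) := ext (endo_base j) X.

Lemma endo_nat j : natural (endo j).
Proof. exact: ext_nat. Qed.

Lemma endoP j : endo j P = endo_base j.
Proof.
rewrite /endo /ext -[RHS]comp_lfun1r -Frfg comp_lfun_sumr; apply: eq_bigr => i _.
by rewrite (@base_commutes j) ?comp_lfunA //; eexists.
Qed.

Lemma natural_comb (I : finType) (x : I -> K) (a : I -> forall X, 'End(FO X)) :
  (forall i, natural (a i)) -> natural (fun X => \sum_i x i *: a i X).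
Proof.
move=> na X Y f; rewrite comp_combr comp_combl; apply: eq_bigr => i _.
by rewrite na.
Qed.

Lemma natural_coords a : natural a ->
  exists x, forall X, a X = \sum_j x j *: endo j X.
Proof.
move=> na; have [|x xE] := @commutes_comb (a P); first by move=> _ [f ->]; apply: na.
exists x; apply: natural_retract => //.
  by apply: natural_comb => j; apply: endo_nat.
by rewrite xE; apply: eq_bigr => j _; rewrite endoP.
Qed.

Lemma endo_indep x y : \sum_j x j *: endo j P = \sum_j y j *: endo j P -> x =1 y.
Proof.
move=> xy; apply: (independent_eq endo_base_indep).
by move: xy; under eq_bigr do rewrite endoP; under [RHS]eq_bigr do rewrite endoP.
Qed.

Lemma natural_tens a X Y X' Y' (f : mor X X') (g : mor Y Y') : natural a ->
  (a (X' \ox Y') \o FJ X' Y' \o vtensm (Fm f) (Fm g) =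
   Fm (f \oxm g) \o a (X \ox Y) \o FJ X Y)%VF.
Proof. by move=> na; rewrite -comp_lfunA FJ_nat comp_lfunA na. Qed.

(** At [P], the family [X, Y |-> endo j (X \ox Y)], moved to the tensor product of
    the fibers, commutes with the endomorphisms of both factors, hence belongs to
    the tensor product of the commutants. *)
Lemma comult_exists j : exists t : 'I_endo_dim -> 'I_endo_dim -> K, forall X Y,
  (endo j (X \ox Y) \o FJ X Y =
   FJ X Y \o \sum_k \sum_l t k l *: vtensm (endo k X) (endo l Y))%VF.
Proof.
have [G [GJ JG]] := FJ_iso F P P.
pose theta : 'End(vtens (FO P) (FO P)) := (G \o endo j (P \ox P) \o FJ P P)%VF.
have Jtheta : (FJ P P \o theta = endo j (P \ox P) \o FJ P P)%VF.
  by rewrite /theta !comp_lfunA JG comp_lfun1l.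
clearbody theta.
have J_mono (U : vectType K) (f g : 'Hom(U, vtens (FO P) (FO P))) :
    (FJ P P \o f = FJ P P \o g)%VF -> f = g.
  by apply: lfun_iso_mono; exists G.
have thcomm (f g : mor P P) :
    (vtensm (Fm f) (Fm g) \o theta = theta \o vtensm (Fm f) (Fm g))%VF.
  apply: J_mono; rewrite !comp_lfunA Jtheta natural_tens; last exact: endo_nat.
  by rewrite FJ_nat -comp_lfunA Jtheta comp_lfunA.
have [_ [f ->]|_ [f ->]|t tE] := tensor_commutant endo_base_indep commutes_comb (theta := theta).
- by have := thcomm f (idm P); rewrite Fm1.
- by have := thcomm (idm P) f; rewrite Fm1.
exists t => X Y.
pose D X Y : 'End(vtens (FO X) (FO Y)) :=
  \sum_k \sum_l t k l *: vtensm (endo k X) (endo l Y).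
have Dnat (f : mor P X) (g : mor P Y) :
    (D X Y \o vtensm (Fm f) (Fm g) = vtensm (Fm f) (Fm g) \o D P P)%VF.
  rewrite /D comp_lfun_suml comp_lfun_sumr; apply: eq_bigr => k _.
  rewrite comp_combr comp_combl; apply: eq_bigr => l _.
  by rewrite -!vtensmM !endo_nat.
have DP : D P P = theta.
  by rewrite tE; apply: eq_bigr => k _; apply: eq_bigr => l _; rewrite !endoP.
have id_tens : \1%VF = \sum_i \sum_k (vtensm (Fm (rf X i)) (Fm (rf Y k)) \o
     vtensm (Fm (rg X i)) (Fm (rg Y k)))%VF.
  rewrite -vtensm1 -Frfg (semilin_sum (sigma := idfun) (@vtensm_linearl _ _ _ _ _ _)).
  apply: eq_bigr => i _; rewrite -Frfg.
  rewrite (semilin_sum (sigma := idfun) (@vtensm_linearr _ _ _ _ _ _)).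
  by apply: eq_bigr => k _; rewrite vtensmM.
rewrite -/(D X Y); clearbody D.
rewrite -[LHS]comp_lfun1r -[RHS]comp_lfun1r id_tens !comp_lfun_sumr; apply: eq_bigr => i _.
rewrite !comp_lfun_sumr; apply: eq_bigr => k _; rewrite !comp_lfunA; congr (_ \o _)%VF.
rewrite natural_tens; last exact: endo_nat.
by rewrite -[RHS]comp_lfunA Dnat DP comp_lfunA FJ_nat -!comp_lfunA Jtheta.
Qed.

Definition comult j : 'I_endo_dim -> 'I_endo_dim -> K := projT1 (cid (comult_exists j)).

Lemma comultE j X Y : (endo j (X \ox Y) \o FJ X Y =
   FJ X Y \o \sum_k \sum_l comult j k l *: vtensm (endo k X) (endo l Y))%VF.
Proof. by rewrite /comult; case: cid. Qed.

Lemma counit_exists j : exists a, (endo j unit_ob \o F1 = a *: F1)%VF.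
Proof. exact: unit_scalar. Qed.

Definition counit j : K := projT1 (cid (counit_exists j)).

Lemma counitE j : (endo j unit_ob \o F1 = counit j *: F1)%VF.
Proof. by rewrite /counit; case: cid. Qed.

Let endo2_indep a b :
  \sum_k \sum_l a k l *: vtensm (endo k P) (endo l P) =
  \sum_k \sum_l b k l *: vtensm (endo k P) (endo l P) -> forall k l, a k l = b k l.
Proof.
move=> ab; apply: (tensm_indep2 endo_base_indep endo_base_indep).
have E a' : \sum_k \sum_l a' k l *: vtensm (endo_base k) (endo_base l) =
  \sum_k \sum_l a' k l *: vtensm (endo k P) (endo l P).
  by apply: eq_bigr => k _; apply: eq_bigr => l _; rewrite !endoP.
by rewrite !E.
Qed.

(** The symmetric monoidal structure makes [comult] and [counit] the structure
    constants of a commutative algebra, the functions on the group of monoidal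
    automorphisms of [F]: the naturality of [endo i] at the braiding, the
    associator and the unitor gives commutativity, associativity and unit. *)
Lemma comultC i j k : comult i j k = comult i k j.
Proof.
pose D := \sum_k \sum_l comult i k l *: vtensm (endo k P) (endo l P).
pose D' := \sum_k \sum_l comult i l k *: vtensm (endo k P) (endo l P).
apply: (@endo2_indep (comult i) (fun k l => comult i l k)); rewrite -/D -/D'.
have vD : (vbraid (FO P) (FO P) \o D = D' \o vbraid (FO P) (FO P))%VF.
  rewrite comp_lfun_sumr comp_lfun_suml.
  under eq_bigr do rewrite comp_combr; under [RHS]eq_bigr do rewrite comp_combl.
  rewrite exchange_big; apply: eq_bigr => l _; apply: eq_bigr => k' _.
  by rewrite vbraid_nat.
apply: (lfun_iso_epi (vbraid_iso (FO P) (FO P))); rewrite -vD.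
apply: (lfun_iso_mono (FJ_iso F P P)).
have DE : (FJ P P \o D = endo i (P \ox P) \o FJ P P)%VF by rewrite comultE.
rewrite comp_lfunA DE -comp_lfunA -FJ_braid !comp_lfunA -FJ_braid -[RHS]comp_lfunA DE.
by rewrite !comp_lfunA endo_nat.
Qed.

Let endo3_indep a b :
  \sum_z vtensm (\sum_x \sum_y a x y z *: vtensm (endo x P) (endo y P)) (endo z P) =
  \sum_z vtensm (\sum_x \sum_y b x y z *: vtensm (endo x P) (endo y P)) (endo z P) ->
  forall x y z, a x y z = b x y z.
Proof.
move=> ab x y z; apply: (@endo2_indep (fun x y => a x y z) (fun x y => b x y z)).
apply/eqP; rewrite -subr_eq0; apply/eqP; move: z.
apply: (tensm_indep_r endo_base_indep).
under eq_bigr do rewrite (semilinD (sigma := idfun) (@vtensm_linearl _ _ _ _ _ _))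
  (semilinN (sigma := idfun) (@vtensm_linearl _ _ _ _ _ _)) -endoP.
by rewrite sumrB ab subrr.
Qed.

Lemma comultA i a b k :
  \sum_l comult i l k * comult l a b = \sum_l comult i a l * comult l b k.
Proof.
apply: (@endo3_indep (fun a b k => \sum_l comult i l k * comult l a b)
  (fun a b k => \sum_l comult i a l * comult l b k)).
set L := \sum_z _; set L' := \sum_z _.
pose D l := \sum_x \sum_y comult l x y *: vtensm (endo x P) (endo y P).
have DE l : (endo l (P \ox P) \o FJ P P = FJ P P \o D l)%VF by apply: comultE.
have DZ c l : c *: D l = \sum_x \sum_y (c * comult l x y) *: vtensm (endo x P) (endo y P).
  rewrite scaler_sumr; apply: eq_bigr => x _; rewrite scaler_sumr.
  by apply: eq_bigr => y _; rewrite scalerA.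
have LE : (endo i (P \ox P \ox P) \o (FJ (P \ox P) P \o vtensm (FJ P P) \1) =
    (FJ (P \ox P) P \o vtensm (FJ P P) \1) \o L)%VF.
  rewrite comp_lfunA comultE -!comp_lfunA; congr (_ \o _)%VF.
  transitivity (\sum_l \sum_z comult i l z *:
      (vtensm (FJ P P) \1 \o vtensm (D l) (endo z P))%VF).
    rewrite comp_lfun_suml; apply: eq_bigr => l _.
    rewrite comp_combl; apply: eq_bigr => z _.
    by rewrite -!vtensmM DE comp_lfun1l comp_lfun1r.
  rewrite exchange_big comp_lfun_sumr; apply: eq_bigr => z _ /=.
  rewrite -comp_combr -vtensm_combl; congr (_ \o vtensm _ _)%VF.
  rewrite (eq_bigr _ (fun l _ => DZ _ l)) exchange_big; apply: eq_bigr => x _ /=.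
  by rewrite exchange_big; apply: eq_bigr => y _; rewrite scaler_suml.
pose L2 := \sum_x vtensm (endo x P) (\sum_y \sum_z
  (\sum_l comult i x l * comult l y z) *: vtensm (endo y P) (endo z P)).
have LE2 : (endo i (P \ox (P \ox P)) \o (FJ P (P \ox P) \o vtensm \1 (FJ P P)) =
    (FJ P (P \ox P) \o vtensm \1 (FJ P P)) \o L2)%VF.
  rewrite comp_lfunA comultE -!comp_lfunA; congr (_ \o _)%VF.
  transitivity (\sum_x \sum_l comult i x l *:
      (vtensm \1 (FJ P P) \o vtensm (endo x P) (D l))%VF).
    rewrite comp_lfun_suml; apply: eq_bigr => x _.
    rewrite comp_combl; apply: eq_bigr => l _.
    by rewrite -!vtensmM DE comp_lfun1l comp_lfun1r.
  rewrite comp_lfun_sumr; apply: eq_bigr => x _ /=.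
  rewrite -comp_combr -vtensm_combr; congr (_ \o vtensm _ _)%VF.
  rewrite (eq_bigr _ (fun l _ => DZ _ l)) exchange_big; apply: eq_bigr => y _ /=.
  by rewrite exchange_big; apply: eq_bigr => z _; rewrite scaler_suml.
have L2E : (vassoc _ _ _ \o L' = L2 \o vassoc (FO P) (FO P) (FO P))%VF.
  transitivity (\sum_z \sum_x \sum_y (\sum_l comult i x l * comult l y z) *:
      (vtensm (endo x P) (vtensm (endo y P) (endo z P)) \o vassoc (FO P) (FO P) (FO P))%VF).
    rewrite comp_lfun_sumr; apply: eq_bigr => z _.
    rewrite (semilin_sum (sigma := idfun) (@vtensm_linearl _ _ _ _ _ _)) comp_lfun_sumr.
    apply: eq_bigr => x _; rewrite vtensm_combl comp_combr; apply: eq_bigr => y _.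
    by rewrite vassoc_nat.
  rewrite exchange_big comp_lfun_suml; apply: eq_bigr => x _ /=.
  rewrite (semilin_sum (sigma := idfun) (@vtensm_linearr _ _ _ _ _ _)) comp_lfun_suml.
  rewrite exchange_big; apply: eq_bigr => y _ /=.
  by rewrite vtensm_combr comp_combl.
clearbody L L' L2.
apply: (lfun_iso_mono (@vassoc_iso _ (FO P) (FO P) (FO P))); rewrite L2E.
have iJ : lfun_iso (FJ P (P \ox P) \o vtensm \1 (FJ P P))%VF.
  by apply: lfun_iso_comp; [apply: lfun_iso_tens; [apply: lfun_iso1 | apply: FJ_iso] | apply: FJ_iso].
apply: (lfun_iso_mono iJ).
rewrite [LHS]comp_lfunA [RHS]comp_lfunA -LE2 -[in RHS]comp_lfunA -FJ_assoc.
by rewrite -(comp_lfunA (Fm _)) -(comp_lfunA (Fm _)) -LE !comp_lfunA endo_nat.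
Qed.

Lemma comult1 i k : \sum_j counit j * comult i j k = (i == k)%:R.
Proof.
have := @endo_indep (fun k => \sum_j counit j * comult i j k) (fun k => (i == k)%:R).
apply; rewrite [RHS](bigD1 i) //= eqxx scale1r [X in _ = _ + X]big1 ?addr0; last first.
  by move=> j /negPf ij; rewrite eq_sym ij scale0r.
apply: (lfun_iso_epi (vlunit_iso (FO P))).
rewrite -vlunit_nat -FJ_lunit.
transitivity (Fm (lunit P) \o (FJ unit_ob P \o
    \sum_j \sum_k comult i j k *: vtensm (endo j unit_ob) (endo k P)) \o vtensm F1 \1)%VF;
  last by rewrite -comultE !comp_lfunA endo_nat.
rewrite -!comp_lfunA; congr (_ \o (_ \o _))%VF.
rewrite -vtensmM comp_lfun1l comp_lfun1r vtensm_combr comp_lfun_suml.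
transitivity (\sum_k \sum_j comult i j k *: (counit j *: vtensm F1 (endo k P))).
  apply: eq_bigr => k' _; rewrite scaler_suml; apply: eq_bigr => j _.
  by rewrite scalerA mulrC.
rewrite exchange_big; apply: eq_bigr => j _; rewrite comp_combl; apply: eq_bigr => k' _.
rewrite -vtensmM counitE comp_lfun1r.
by rewrite (semilinZ (sigma := idfun) (@vtensm_linearl _ _ _ _ _ _)).
Qed.

End NaturalEndomorphisms.

(** * Complex points of the automorphism group *)

Section ComplexFamilies.
Variables (R : rcfType) (L : complex_field R).
Variables (C : symmoncat R) (F : symmonfunctor C (Vec R)).
Local Notation FO := (FO F).
Local Notation Fm := (Fm F).
Local Notation FJ := (FJ F).
Local Notation F1 := (F1 F).
Local Notation cx := (@cx R L _ _).

(** The complexification of a functor to real vector spaces, with its monoidal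
    structure. *)
Definition CO (X : C) : vectType L := cplx L (FO X).
Definition Cm (X Y : C) (f : mor X Y) : 'Hom(CO X, CO Y) := cx (Fm f).
Definition CJ (X Y : C) : 'Hom(vtens (CO X) (CO Y), CO (X \ox Y)) :=
  locked (cx (FJ X Y) \o cmu L (FO X) (FO Y))%VF.
Definition C1 : 'Hom(((L : fieldType)^o : vectType L), CO unit_ob) :=
  locked (cx F1 \o cone L)%VF.

Lemma CJE X Y : CJ X Y = (cx (FJ X Y) \o cmu L (FO X) (FO Y))%VF.
Proof. by rewrite /CJ -lock. Qed.

Lemma C1E : C1 = (cx F1 \o cone L)%VF.
Proof. by rewrite /C1 -lock. Qed.

Lemma Cm1 X : Cm (idm X) = \1%VF.
Proof. by rewrite /Cm Fm1 cx1. Qed.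

Lemma CmM X Y Z (g : mor Y Z) (f : mor X Y) : Cm (g \oc f) = (Cm g \o Cm f)%VF.
Proof. by rewrite /Cm FmM cxM. Qed.

Lemma cx_iso (V W : vectType R) (f : 'Hom(V, W)) : lfun_iso f -> lfun_iso (cx f).
Proof. by move=> [g [gf fg]]; exists (cx g); rewrite -!cxM gf fg !cx1. Qed.

Lemma CJ_iso X Y : lfun_iso (CJ X Y).
Proof.
rewrite CJE; apply: lfun_iso_comp; last by apply: cx_iso; apply: FJ_iso.
by exists (cmu_inv L _ _); split; [apply: cmuK | apply: cmu_invK].
Qed.

Lemma C1_iso : lfun_iso C1.
Proof.
rewrite C1E; apply: lfun_iso_comp; last by apply: cx_iso; apply: F1_iso.
by exists (cone_inv L); split; [apply: coneK | apply: cone_invK].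
Qed.

Lemma CJ_nat X X' Y Y' (f : mor X X') (g : mor Y Y') :
  (CJ X' Y' \o vtensm (Cm f) (Cm g) = Cm (f \oxm g) \o CJ X Y)%VF.
Proof. by rewrite !CJE -comp_lfunA cmu_nat !comp_lfunA -!cxM FJ_nat. Qed.

Lemma CJ_assoc X Y Z :
  (Cm (assoc X Y Z) \o CJ (X \ox Y) Z \o vtensm (CJ X Y) \1 =
   CJ X (Y \ox Z) \o vtensm \1 (CJ Y Z) \o vassoc (CO X) (CO Y) (CO Z))%VF.
Proof.
have splitl : vtensm (CJ X Y) \1%VF =
    (vtensm (cx (FJ X Y)) (cx \1%VF) \o vtensm (cmu L (FO X) (FO Y)) \1)%VF :> 'Hom(_, vtens _ (CO Z)).
  by rewrite -vtensmM cx1 comp_lfun1l ?CJE ?C1E.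
have splitr : vtensm \1%VF (CJ Y Z) =
    (vtensm (cx \1%VF) (cx (FJ Y Z)) \o vtensm \1 (cmu L (FO Y) (FO Z)))%VF :> 'Hom(vtens (CO X) _, _).
  by rewrite -vtensmM cx1 comp_lfun1l ?CJE ?C1E.
transitivity (cx (Fm (assoc X Y Z) \o FJ (X \ox Y) Z \o vtensm (FJ X Y) \1) \o
    (cmu L _ _ \o vtensm (cmu L (FO X) (FO Y)) \1))%VF.
  rewrite splitl !CJE /Cm !cxM -!comp_lfunA; congr (_ \o (_ \o _))%VF.
  by rewrite !comp_lfunA cmu_nat.
rewrite FJ_assoc.
transitivity (cx (FJ X (Y \ox Z) \o vtensm \1 (FJ Y Z)) \o
    (cmu L _ _ \o vtensm \1 (cmu L (FO Y) (FO Z)) \o vassoc _ _ _))%VF.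
  by rewrite cxM -comp_lfunA; congr (_ \o _)%VF; rewrite -cmu_assoc !comp_lfunA.
rewrite splitr CJE cxM -!comp_lfunA; congr (_ \o _)%VF.
by rewrite !comp_lfunA cmu_nat.
Qed.

Lemma CJ_lunit X : (Cm (lunit X) \o CJ unit_ob X \o vtensm C1 \1 = vlunit (CO X))%VF.
Proof.
have -> : vtensm C1 \1%VF = (vtensm (cx F1) (cx \1%VF) \o vtensm (cone L) \1)%VF
    :> 'Hom(_, vtens _ (CO X)) by rewrite -vtensmM cx1 comp_lfun1l ?CJE ?C1E.
rewrite !CJE /Cm -!comp_lfunA (comp_lfunA (cmu _ _ _)) cmu_nat.
by rewrite !comp_lfunA -!cxM FJ_lunit cmu_lunit.
Qed.

Lemma CJ_runit X : (Cm (runit X) \o CJ X unit_ob \o vtensm \1 C1 = vrunit (CO X))%VF.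
Proof.
have -> : vtensm \1%VF C1 = (vtensm (cx \1%VF) (cx F1) \o vtensm \1 (cone L))%VF
    :> 'Hom(vtens (CO X) _, _) by rewrite -vtensmM cx1 comp_lfun1l ?CJE ?C1E.
rewrite !CJE /Cm -!comp_lfunA (comp_lfunA (cmu _ _ _)) cmu_nat.
by rewrite !comp_lfunA -!cxM FJ_runit cmu_runit.
Qed.

Lemma CJ_braid X Y : (Cm (braid X Y) \o CJ X Y = CJ Y X \o vbraid (CO X) (CO Y))%VF.
Proof. by rewrite !CJE /Cm comp_lfunA -cxM FJ_braid cxM -!comp_lfunA cmu_braid. Qed.

Lemma cconj_CJ X Y x y : cconj (CJ X Y (x \otv y)) = CJ X Y (cconj x \otv cconj y).
Proof. by rewrite !CJE !comp_lfunE -cx_cconj cconj_cmu. Qed.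

Lemma cconj_C1 a : cconj (C1 a) = C1 (conj a).
Proof. by rewrite C1E !comp_lfunE -cx_cconj cconj_cone. Qed.

Lemma Cm_cconj X Y (f : mor X Y) x : Cm f (cconj x) = cconj (Cm f x).
Proof. exact: cx_cconj. Qed.

(** The morphism obtained from [u] by bending the dual [D] back into its source
    is computed by the same bending in linear algebra. *)
Lemma transposeE X Y D (ev : mor (D \ox X) unit_ob) (u : mor unit_ob (Y \ox D))
    (cev : 'Hom(vtens (CO D) (CO X), (L : fieldType)^o))
    (cu : 'Hom((L : fieldType)^o, vtens (CO Y) (CO D))) :
  (C1 \o cev = Cm ev \o CJ D X)%VF -> (CJ Y D \o cu = Cm u \o C1)%VF ->
  (Cm (runit Y \oc (idm Y \oxm ev) \oc assoc Y D X \oc (u \oxm idm X)) \o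
     CJ unit_ob X \o vtensm C1 \1 =
   vrunit (CO Y) \o vtensm \1 cev \o vassoc _ _ _ \o vtensm cu \1)%VF.
Proof.
move=> cevE cuE.
have s1 : (Cm (u \oxm idm X) \o CJ unit_ob X \o vtensm C1 \1 =
    CJ (Y \ox D) X \o vtensm (CJ Y D) \1 \o vtensm cu \1)%VF.
  by rewrite -CJ_nat -!comp_lfunA -!vtensmM Cm1 comp_lfun1l cuE.
have s3 : (Cm (idm Y \oxm ev) \o CJ Y (D \ox X) \o vtensm \1 (CJ D X) =
    CJ Y unit_ob \o vtensm \1 C1 \o vtensm \1 cev)%VF.
  by rewrite -CJ_nat -!comp_lfunA -!vtensmM Cm1 comp_lfun1l cevE.
rewrite !CmM.
transitivity (Cm (runit Y) \o Cm (idm Y \oxm ev) \o Cm (assoc Y D X) \o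
  (CJ (Y \ox D) X \o vtensm (CJ Y D) \1 \o vtensm cu \1))%VF.
  by rewrite -s1 !comp_lfunA.
transitivity (Cm (runit Y) \o Cm (idm Y \oxm ev) \o
  (CJ Y (D \ox X) \o vtensm \1 (CJ D X) \o vassoc _ _ _) \o vtensm cu \1)%VF.
  by rewrite -CJ_assoc !comp_lfunA.
transitivity (Cm (runit Y) \o (CJ Y unit_ob \o vtensm \1 C1 \o vtensm \1 cev) \o
  vassoc _ _ _ \o vtensm cu \1)%VF.
  by rewrite -s3 !comp_lfunA.
by rewrite !comp_lfunA CJ_runit.
Qed.

Lemma dual_zigzag X Y (ev : mor (Y \ox X) unit_ob) (coev : mor unit_ob (X \ox Y)) :
  runit X \oc (idm X \oxm ev) \oc assoc X Y X \oc (coev \oxm idm X) = lunit X ->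
  exists (cev : 'Hom(vtens (CO Y) (CO X), (L : fieldType)^o))
    (ccoev : 'Hom((L : fieldType)^o, vtens (CO X) (CO Y))),
  [/\ (C1 \o cev = Cm ev \o CJ Y X)%VF, (CJ X Y \o ccoev = Cm coev \o C1)%VF &
   (vrunit (CO X) \o vtensm \1 cev \o vassoc _ _ _ \o vtensm ccoev \1 = vlunit (CO X))%VF].
Proof.
move=> zigzag; have [G [GC CG]] := C1_iso; have [H [HJ JH]] := CJ_iso X Y.
exists (G \o Cm ev \o CJ Y X)%VF, (H \o Cm coev \o C1)%VF.
set cev := (G \o _ \o _)%VF; set ccoev := (H \o _ \o _)%VF.
have cevE : (C1 \o cev = Cm ev \o CJ Y X)%VF by rewrite /cev !comp_lfunA CG comp_lfun1l.
have ccoevE : (CJ X Y \o ccoev = Cm coev \o C1)%VF by rewrite /ccoev !comp_lfunA JH comp_lfun1l.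
by split=> //; rewrite -(transposeE cevE ccoevE) zigzag CJ_lunit.
Qed.

(** ** Monoidal natural endomorphisms *)

Definition cnatural (a : forall X, 'End(CO X)) :=
  forall X Y (f : mor X Y), (Cm f \o a X = a Y \o Cm f)%VF.

Definition cmonoidal (a : forall X, 'End(CO X)) :=
  (forall X Y, (a (X \ox Y) \o CJ X Y = CJ X Y \o vtensm (a X) (a Y))%VF) /\
  (a unit_ob \o C1 = C1)%VF.

Lemma lfun_right_inverse (K : fieldType) (V : vectType K) (f g : 'End(V)) :
  (f \o g = \1)%VF -> (g \o f = \1)%VF.
Proof.
move=> fg; have g0 : lker g == 0%VS.
  apply/lker0P => u v guv.
  by rewrite -[u]id_lfunE -[v]id_lfunE -fg !comp_lfunE guv.
have -> : f = (g^-1)%VF.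
  by rewrite -[f]comp_lfun1r -(lker0_compfV g0) comp_lfunA fg comp_lfun1l.
by rewrite lker0_compfV.
Qed.

Section Inverse.
Hypothesis Crigid : rigid C.

(** A monoidal natural endomorphism is inverted by its transpose on the dual
    object. *)
Lemma cmonoidal_iso a X : cnatural a -> cmonoidal a -> lfun_iso (a X).
Proof.
move=> na [aM a1]; have [[Y [ev [coev [zz _]]]] _] := Crigid X.
have [cev [ccoev [_ ccoevE zzC]]] := dual_zigzag zz.
have acoev : (vtensm (a X) (a Y) \o ccoev = ccoev)%VF.
  apply: (lfun_iso_mono (CJ_iso X Y)).
  by rewrite comp_lfunA -aM -comp_lfunA ccoevE comp_lfunA -na -comp_lfunA a1.
pose b := (vrunit (CO X) \o vtensm \1 cev \o vtensm \1 (vtensm (a Y) \1) \o vassoc _ _ _ \o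
  vtensm ccoev \1 \o vlunit_inv _)%VF.
suff ab : (a X \o b = \1)%VF by exists b; split=> //; apply: lfun_right_inverse.
have ar : (a X \o vrunit (CO X) = vrunit (CO X) \o vtensm (a X) \1)%VF by rewrite vrunit_nat.
have m1 : (vtensm (a X) \1 \o vtensm \1 cev \o vtensm \1 (vtensm (a Y) \1) =
    vtensm \1 cev \o vtensm (a X) (vtensm (a Y) \1))%VF.
  by rewrite -!vtensmM !comp_lfun1l !comp_lfun1r.
have m2 : (vtensm (vtensm (a X) (a Y)) \1 \o vtensm ccoev \1 = vtensm ccoev \1
    :> 'Hom(vtens _ (CO X), _))%VF.
  by rewrite -vtensmM acoev comp_lfun1l.
rewrite -(vlunit_invK (CO X)) -zzC /b !comp_lfunA ar; congr (_ \o _)%VF.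
rewrite -!(comp_lfunA (vrunit _)) m1 -!comp_lfunA (comp_lfunA (vtensm (a X) _)) -vassoc_nat.
by rewrite -!comp_lfunA m2.
Qed.

Lemma cmonoidal_inverse a : cnatural a -> cmonoidal a ->
  exists b, [/\ cnatural b, cmonoidal b, forall X, (b X \o a X = \1)%VF &
    forall X, (a X \o b X = \1)%VF].
Proof.
move=> na ma; have ia X := cmonoidal_iso X na ma; have [aM a1] := ma.
pose b X := projT1 (cid (ia X)).
have ba X : (b X \o a X = \1)%VF by rewrite /b; case: cid => ? [].
have ab X : (a X \o b X = \1)%VF by rewrite /b; case: cid => ? [].
clearbody b; exists b; split=> //.
  move=> X Y f; apply: (lfun_iso_epi (ia X)); rewrite -comp_lfunA ba comp_lfun1r.
  by rewrite -comp_lfunA na comp_lfunA ba comp_lfun1l.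
split=> [X Y|]; last by apply: (lfun_iso_mono (ia _)); rewrite comp_lfunA ab comp_lfun1l a1.
apply: (lfun_iso_mono (ia _)); rewrite comp_lfunA ab comp_lfun1l comp_lfunA aM.
by rewrite -comp_lfunA -vtensmM !ab vtensm1 comp_lfun1r.
Qed.

End Inverse.
End ComplexFamilies.

Section ComplexCoordinates.
Variables (R : rcfType) (L : complex_field R).
Variables (C : symmoncat R) (F : symmonfunctor C (Vec R)).
Variables (P : C) (Pgen : forall X : C, retract_of P X).
Local Notation FO := (FO F).
Local Notation Fm := (Fm F).
Local Notation FJ := (FJ F).
Local Notation F1 := (F1 F).
Local Notation cx := (@cx R L _ _).
Local Notation CO := (CO L F).
Local Notation Cm := (Cm L F).
Local Notation CJ := (CJ L F).
Local Notation C1 := (C1 L F).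
Local Notation cnatural := (@cnatural R L C F).
Local Notation cmonoidal := (@cmonoidal R L C F).
Local Notation m := (endo_dim F P).
Local Notation endo := (@endo _ _ F _ Pgen).

Definition rho (x : 'rV[L]_m) X : 'End(CO X) := \sum_j x 0 j *: cx (endo j X).

Lemma cnatural_comb (I : finType) (x : I -> L) (a : I -> forall X, 'End(CO X)) :
  (forall i, cnatural (a i)) -> cnatural (fun X => \sum_i x i *: a i X).
Proof.
move=> na X Y f; rewrite comp_combr comp_combl; apply: eq_bigr => i _.
by rewrite na.
Qed.

Lemma cx_natural (a : forall X, 'End(FO X)) : natural a -> cnatural (fun X => cx (a X)).
Proof. by move=> na X Y f; rewrite -!cxM na. Qed.

Lemma rho_natural x : cnatural (rho x).
Proof. by apply: cnatural_comb => j; apply: cx_natural; apply: endo_nat. Qed.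

Lemma cx_independent (V W : vectType R) n (u : 'I_n -> 'Hom(V, W)) :
  independent u -> independent (fun j => cx (u j)).
Proof.
move=> uI a; under eq_bigr do rewrite [a _]complex_decomp scalerDl -scalerA.
rewrite big_split /= -scaler_sumr.
have cxc (b : 'I_n -> R) : \sum_j rc (b j) *: cx (u j) = cx (\sum_j b j *: u j).
  rewrite (real_linear_sum (@cx_real_linear _ _ _ _)); apply: eq_bigr => j _.
  by rewrite (real_linearZ (@cx_real_linear _ _ _ _)).
rewrite !cxc => e0.
have e v : (\sum_j cRe (a j) *: u j) v = 0 /\ (\sum_j cIm (a j) *: u j) v = 0.
  apply: (@cplx_inj _ L); rewrite (real_linear0 (@iota_real_linear _ _ _)) scaler0 addr0.
  by rewrite -!cx_iota -scale_lfunE -add_lfunE e0 zero_lfunE.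
have re0 : \sum_j cRe (a j) *: u j = 0 by apply/lfunP => v; rewrite zero_lfunE; have [] := e v.
have im0 : \sum_j cIm (a j) *: u j = 0 by apply/lfunP => v; rewrite zero_lfunE; have [] := e v.
by move=> j; rewrite [a j]complex_decomp (uI _ re0) (uI _ im0) !rmorph0 mulr0 addr0.
Qed.

Lemma rho_P x : rho x P = \sum_j x 0 j *: cx (endo_base j).
Proof. by apply: eq_bigr => j _; rewrite endoP. Qed.

Lemma rho_inj x y : rho x P = rho y P -> x = y.
Proof.
rewrite !rho_P => xy; apply/rowP => j.
exact: (independent_eq (cx_independent (@endo_base_indep _ _ F P)) xy).
Qed.

Lemma rho_linear X : linear (fun x => rho x X).
Proof.
move=> a x y; rewrite /rho scaler_sumr -big_split; apply: eq_bigr => j _.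
by rewrite !mxE scalerDl scalerA.
Qed.

(** The real and imaginary parts of a natural family are natural. *)
Lemma cnatural_coords a : cnatural a -> exists x, forall X, a X = rho x X.
Proof.
move=> na.
have rp (V W : vectType R) (f : 'Hom(V, W)) (x : cplx L V) : rpart (cx f x) = f (rpart x).
  rewrite {1}(cplxE x) linearD linearZ /= !cx_iota; exact: rpartE.
have ip (V W : vectType R) (f : 'Hom(V, W)) (x : cplx L V) : ipart (cx f x) = f (ipart x).
  rewrite {1}(cplxE x) linearD linearZ /= !cx_iota; exact: ipartE.
have [|r rE] := @natural_coords _ _ F _ Pgen (fun X => rpart_lfun (a X)).
  move=> X Y f; apply/lfunP => v; rewrite !comp_lfunE !rpart_lfunE -rp.
  by have /lfunP /(_ (iota L v)) := na X Y f; rewrite !comp_lfunE cx_iota => ->.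
have [|i iE] := @natural_coords _ _ F _ Pgen (fun X => ipart_lfun (a X)).
  move=> X Y f; apply/lfunP => v; rewrite !comp_lfunE !ipart_lfunE -ip.
  by have /lfunP /(_ (iota L v)) := na X Y f; rewrite !comp_lfunE cx_iota => ->.
exists (\row_j (rc (r j) + cI * rc (i j))) => X; rewrite (cx_split (a X)) rE iE.
rewrite !(real_linear_sum (@cx_real_linear _ _ _ _)) scaler_sumr -big_split.
apply: eq_bigr => j _; rewrite mxE scalerDl -scalerA.
by rewrite !(real_linearZ (@cx_real_linear _ _ _ _)).
Qed.

Lemma cnatural_retract (a b : forall X, 'End(CO X)) : cnatural a -> cnatural b ->
  a P = b P -> forall X, a X = b X.
Proof.
move=> na nb ab X; have [x xE] := cnatural_coords na; have [y yE] := cnatural_coords nb.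
by rewrite xE yE (_ : x = y) //; apply: rho_inj; rewrite -xE -yE.
Qed.

Definition ccomult i j k : L := rc (@comult _ _ F _ Pgen i j k).
Definition ccounit i : L := rc (@counit _ _ F _ Pgen i).

(** The coordinates of [rho x] at a tensor product are the values of the linear form
    [x] on the products of basis elements. *)
Lemma rho_tens x X Y : (rho x (X \ox Y) \o CJ X Y = CJ X Y \o
  \sum_k \sum_l (\sum_i x 0 i * ccomult i k l) *: vtensm (cx (endo k X)) (cx (endo l Y)))%VF.
Proof.
have step i : (cx (endo i (X \ox Y)) \o CJ X Y = CJ X Y \o
    \sum_k \sum_l ccomult i k l *: vtensm (cx (endo k X)) (cx (endo l Y)))%VF.
  rewrite CJE comp_lfunA -cxM comultE cxM -!comp_lfunA; congr (_ \o _)%VF.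
  apply: tens_cplxP => v w; rewrite !comp_lfunE cmu_iota cx_iota !sum_lfunE.
  rewrite (real_linear_sum (@iota_real_linear _ _ _)) linear_sum; apply: eq_bigr => k _ /=.
  rewrite !sum_lfunE (real_linear_sum (@iota_real_linear _ _ _)) linear_sum.
  apply: eq_bigr => l _ /=; rewrite !scale_lfunE linearZ /= !vtensmE !cx_iota cmu_iota.
  by rewrite (real_linearZ (@iota_real_linear _ _ _)).
rewrite /rho comp_combl.
under eq_bigr do rewrite step.
rewrite -comp_combr; congr (_ \o _)%VF.
under eq_bigr do rewrite scaler_sumr.
rewrite exchange_big; apply: eq_bigr => k _ /=.
under eq_bigr do rewrite scaler_sumr.
rewrite exchange_big; apply: eq_bigr => l _ /=.
by rewrite scaler_suml; apply: eq_bigr => i _; rewrite scalerA.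
Qed.

Lemma tens_rho x y X Y : vtensm (rho x X) (rho y Y) =
  \sum_k \sum_l (x 0 k * y 0 l) *: vtensm (cx (endo k X)) (cx (endo l Y)).
Proof.
rewrite /rho vtensm_combl; apply: eq_bigr => k _.
rewrite vtensm_combr scaler_sumr; apply: eq_bigr => l _.
by rewrite scalerA.
Qed.

Lemma rho_unit x : (rho x unit_ob \o C1 = (\sum_i ccounit i * x 0 i) *: C1)%VF.
Proof.
rewrite /rho comp_combl scaler_suml; apply: eq_bigr => i _.
rewrite mulrC -scalerA; congr (_ *: _); rewrite C1E comp_lfunA -cxM counitE.
by rewrite (real_linearZ (@cx_real_linear _ _ _ _)) comp_lfunZl.
Qed.

Lemma ctens_indep a b :
  (CJ P P \o \sum_k \sum_l a k l *: vtensm (cx (endo k P)) (cx (endo l P)) =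
   CJ P P \o \sum_k \sum_l b k l *: vtensm (cx (endo k P)) (cx (endo l P)))%VF ->
  forall k l, a k l = b k l.
Proof.
move=> /(lfun_iso_mono (@CJ_iso _ L _ F P P)) ab.
have eI : independent (fun j => cx (endo j P)).
  have -> : (fun j => cx (endo j P)) = (fun j => cx (endo_base j)).
    by apply: funext => j; rewrite endoP.
  exact: (cx_independent (@endo_base_indep _ _ F P)).
exact: (tensm_indep2 eI eI).
Qed.

Lemma C1_neq0 : C1 != 0.
Proof.
have [G [GC _]] := C1_iso L F; apply/eqP => C0.
have /lfunP /(_ 1) := GC; rewrite C0 comp_lfun0r zero_lfunE id_lfunE => /eqP.
by rewrite eq_sym oner_eq0.
Qed.

Lemma characterP x : is_character ccomult ccounit x <-> cmonoidal (rho x).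
Proof.
split=> [[xM x1]|[xM x1]]; split.
- move=> X Y; rewrite rho_tens tens_rho; congr (_ \o _)%VF.
  by apply: eq_bigr => k _; apply: eq_bigr => l _; rewrite xM.
- by rewrite rho_unit x1 scale1r.
- by apply: (@ctens_indep _ (fun j k => x 0 j * x 0 k)); rewrite -rho_tens -tens_rho xM.
- have := rho_unit x; rewrite x1 => /eqP; rewrite -[X in X == _]scale1r.
  rewrite -subr_eq0 -scalerBl scaler_eq0 (negPf C1_neq0) orbF subr_eq0 => /eqP.
  by move=> <-.
Qed.

Lemma derivationE g d X Y : is_derivation ccomult g d ->
  (rho d (X \ox Y) \o CJ X Y =
   CJ X Y \o (vtensm (rho g X) (rho d Y) + vtensm (rho d X) (rho g Y)))%VF.
Proof.
move=> gd; rewrite rho_tens !tens_rho -big_split; congr (_ \o _)%VF.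
apply: eq_bigr => k _; rewrite -big_split; apply: eq_bigr => l _ /=.
by rewrite gd scalerDl.
Qed.

End ComplexCoordinates.

(** * Primitive elements vanish *)

Definition lpow (K : fieldType) (V : vectType K) (f : 'End(V)) n : 'End(V) :=
  iter n (comp_lfun f) \1%VF.
Arguments lpow : simpl never.

Lemma lpowS (K : fieldType) (V : vectType K) (f : 'End(V)) n :
  lpow f n.+1 = (f \o lpow f n)%VF.
Proof. by []. Qed.

Section Powers.
Variables (K : fieldType) (V : vectType K).
Implicit Types f g : 'End(V).

Lemma lpow_minimal_relation f : exists N (a : 'I_N -> K),
  lpow f N = \sum_i a i *: lpow f i /\ independent (fun i : 'I_N => lpow f i).
Proof.
pose p N := lpow f N \in <<mkseq (lpow f) N>>%VS.
have free_pow N : (forall n, (n < N)%N -> ~~ p n) -> free (mkseq (lpow f) N).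
  elim: N => [|N IH] np; first exact: nil_free.
  rewrite mkseqS (perm_free (_ : perm_eq _ (lpow f N :: mkseq (lpow f) N))); last first.
    by rewrite perm_rcons.
  by rewrite free_cons IH ?np // => n nN; rewrite np // ltnS ltnW.
have exp : exists N, p N.
  apply: contrapT => /forallNP np; pose d := \dim (fullv : {vspace 'End(V)}).
  have /eqP dE : free (mkseq (lpow f) d.+1) by apply: free_pow => n _; apply/negP.
  have := dimvS (subvf <<mkseq (lpow f) d.+1>>%VS).
  by rewrite dE size_mkseq ltnn.
case: (ex_minnP exp) => N pN Nmin.
have Nfree : free (mkseq (lpow f) N).
  by apply: free_pow => n nN; apply/negP => /Nmin; rewrite leqNgt nN.
have sz : size (mkseq (lpow f) N) == N by rewrite size_mkseq.
pose X : N.-tuple 'End(V) := Tuple sz.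
exists N, (fun i => coord X i (lpow f N)); split.
  rewrite {1}(coord_span (X := X) pN); apply: eq_bigr => i _.
  by rewrite nth_mkseq.
move=> a a0; have Xfree : free X := Nfree.
apply: (elimT freeP Xfree a); rewrite -[RHS]a0.
by apply: eq_bigr => i _; rewrite nth_mkseq.
Qed.

Lemma lpow_primitive f n : lpow (vtensm f \1 + vtensm \1 f)%VF n =
  \sum_(k < n.+1) 'C(n, k)%:R *: vtensm (lpow f k) (lpow f (n - k)).
Proof.
pose T n k := vtensm (lpow f k) (lpow f (n - k)).
elim: n => [|n IH]; first by rewrite big_ord1 scale1r -[RHS]/(vtensm \1%VF \1%VF) vtensm1.
rewrite lpowS IH comp_combr.
have step (k : 'I_n.+1) : ((vtensm f \1 + vtensm \1 f) \o T n k)%VF = T n.+1 k.+1 + T n.+1 k.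
  rewrite comp_lfunDl -!vtensmM !comp_lfun1l -lpowS -lpowS /T subSS.
  by rewrite subSn // -ltnS.
transitivity (\sum_(k < n.+1) 'C(n, k)%:R *: T n.+1 k.+1 + \sum_(k < n.+2) 'C(n, k)%:R *: T n.+1 k).
  rewrite [X in _ = _ + X]big_ord_recr /= bin_small // scale0r addr0 -big_split.
  by apply: eq_bigr => k _; rewrite step scalerDr.
rewrite [X in _ + X]big_ord_recl [RHS]big_ord_recl addrCA; congr (_ + _); first by rewrite !bin0.
rewrite -big_split; apply: eq_bigr => k _ /=.
by rewrite -scalerDl -natrD addnC.
Qed.

(** Comparing the two expansions of a minimal polynomial relation evaluated at
    f @ 1 + 1 @ f, the coefficient of f ^ (N - 1) @ f is N f = 0. *)
Lemma primitive_zero f : [pchar K] =i pred0 ->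
  (forall N (a : 'I_N -> K), lpow f N = \sum_i a i *: lpow f i ->
    lpow (vtensm f \1 + vtensm \1 f)%VF N =
    \sum_i a i *: lpow (vtensm f \1 + vtensm \1 f)%VF i) ->
  f = 0.
Proof.
move=> K0 rel; have [[|N] [a [aE fI]]] := lpow_minimal_relation f.
  have id0 : (\1%VF : 'End(V)) = 0 by rewrite -[LHS]/(lpow f 0) aE big_ord0.
  by rewrite -[f]comp_lfun1l id0 comp_lfun0l.
have := rel _ _ aE; rewrite lpow_primitive.
pose b i k : K := 'C(i, k)%:R.
have -> : \sum_i a i *: lpow (vtensm f \1 + vtensm \1 f)%VF i =
    \sum_(k < N.+1) vtensm (lpow f k) (\sum_(i < N.+1) (a i * b i k) *: lpow f (i - k)).
  under [RHS]eq_bigr do rewrite vtensm_combr.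
  rewrite exchange_big; apply: eq_bigr => i _ /=; rewrite lpow_primitive scaler_sumr.
  rewrite (big_ord_widen N.+1 (fun k => a i *: ('C(i, k)%:R *: vtensm (lpow f k) (lpow f (i - k))))) //.
  rewrite big_mkcond; apply: eq_bigr => k _; rewrite scalerA; case: ifP => // ik.
  by rewrite /b bin_small ?mulr0 ?scale0r // ltnNge -ltnS ik.
rewrite big_ord_recr /= binn scale1r subnn -[lpow f 0]/(\1%VF) aE vtensm_combl -big_split /=.
have -> : \sum_(k < N.+1) (b N.+1 k *: vtensm (lpow f k) (lpow f (N.+1 - k)) +
      a k *: vtensm (lpow f k) \1%VF) =
    \sum_(k < N.+1) vtensm (lpow f k) (b N.+1 k *: lpow f (N.+1 - k) + a k *: \1%VF).
  apply: eq_bigr => k _; rewrite (semilinD (sigma := idfun) (vtensm_linearr _)).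
  by rewrite !(semilinZ (sigma := idfun) (vtensm_linearr _)).
move=> /eqP; rewrite -subr_eq0 -sumrB => /eqP e0.
pose y (k : 'I_N.+1) := b N.+1 k *: lpow f (N.+1 - k) + a k *: \1%VF -
  \sum_(i < N.+1) (a i * b i k) *: lpow f (i - k).
have : y ord_max = 0.
  apply: (tensm_indep fI); rewrite -[RHS]e0; apply: eq_bigr => k _.
  rewrite (semilinD (sigma := idfun) (vtensm_linearr _)).
  by rewrite (semilinN (sigma := idfun) (vtensm_linearr _)).
rewrite /y big_ord_recr /= [X in _ - (X + _)]big1 ?add0r; last first.
  by move=> i _; rewrite /b bin_small ?mulr0 ?scale0r.
rewrite /b binn mulr1 subnn addrK subSn // subnn binSn lpowS comp_lfun1r => /eqP.
rewrite scaler_eq0 => /orP [|/eqP //].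
by rewrite (iffLR (pcharf0P K) K0).
Qed.

End Powers.

(** * Finiteness of the complex points *)

Section Points.
Variables (R : rcfType) (L : complex_field R).
Variables (C : symmoncat R) (F : symmonfunctor C (Vec R)).
Variables (P : C) (Pgen : forall X : C, retract_of P X).
Hypothesis Crigid : rigid C.
Local Notation CO := (CO L F).
Local Notation Cm := (Cm L F).
Local Notation CJ := (CJ L F).
Local Notation C1 := (C1 L F).
Local Notation cnatural := (@cnatural R L C F).
Local Notation cmonoidal := (@cmonoidal R L C F).
Local Notation m := (endo_dim F P).
Local Notation rho := (@rho R L C F P Pgen).
Local Notation ccomult := (@ccomult R L C F P Pgen).
Local Notation ccounit := (@ccounit R L C F P Pgen).

Lemma cnatural_comp a b : cnatural a -> cnatural b -> cnatural (fun X => (a X \o b X)%VF).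
Proof. by move=> na nb X Y f; rewrite comp_lfunA na -comp_lfunA nb comp_lfunA. Qed.

Lemma cnatural1 : cnatural (fun X => \1%VF).
Proof. by move=> X Y f; rewrite comp_lfun1l comp_lfun1r. Qed.

Lemma cmonoidal_comp a b : cmonoidal a -> cmonoidal b -> cmonoidal (fun X => (a X \o b X)%VF).
Proof.
move=> [aM a1] [bM b1]; split=> [X Y|]; last by rewrite -comp_lfunA b1 a1.
by rewrite -comp_lfunA bM comp_lfunA aM -comp_lfunA -vtensmM.
Qed.

Lemma cmonoidal1 : cmonoidal (fun X => \1%VF).
Proof. by split=> [X Y|]; rewrite ?vtensm1 comp_lfun1l ?comp_lfun1r. Qed.

Lemma cnatural_lpow a n : cnatural a -> cnatural (fun X => lpow (a X) n).
Proof.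
move=> na; elim: n => [|n IH]; first exact: cnatural1.
exact: (cnatural_comp na IH).
Qed.

(** A point derivation translated to the identity is a primitive element. *)
Lemma derivation_zero g d :
  is_character ccomult ccounit g -> is_derivation ccomult g d -> d = 0.
Proof.
move=> /characterP gm gd.
have [b [nb [bM _] bg gb]] := cmonoidal_inverse Crigid (rho_natural _ g) gm.
pose delta X := (b X \o rho d X)%VF.
have nd : cnatural delta by apply: cnatural_comp => //; apply: rho_natural.
have dprim X Y : (delta (X \ox Y) \o CJ X Y =
    CJ X Y \o (vtensm (delta X) \1 + vtensm \1 (delta Y)))%VF.
  rewrite /delta -comp_lfunA (derivationE _ _ gd) comp_lfunA bM -comp_lfunA; congr (_ \o _)%VF.
  by rewrite comp_lfunDr -!vtensmM !bg addrC.
have dE : rho d P = (rho g P \o delta P)%VF by rewrite /delta comp_lfunA gb comp_lfun1l.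
clearbody delta.
have d0 : delta P = 0.
  apply: primitive_zero => [|N a aE]; first exact: Num.Theory.pchar_num.
  apply: (lfun_iso_mono (CJ_iso L F P P)).
  have dpow n : (CJ P P \o lpow (vtensm (delta P) \1 + vtensm \1 (delta P))%VF n =
      lpow (delta (P \ox P)) n \o CJ P P)%VF.
    elim: n => [|n IH]; first by rewrite comp_lfun1l comp_lfun1r.
    by rewrite !lpowS comp_lfunA -dprim -!comp_lfunA IH.
  rewrite comp_combr dpow; under eq_bigr do rewrite dpow.
  rewrite -comp_combl; congr (_ \o _)%VF.
  apply: (@cnatural_retract _ _ _ _ _ Pgen (fun X => lpow (delta X) N)
    (fun X => \sum_i a i *: lpow (delta X) i)) => //.
    exact: cnatural_lpow.
  apply: (@cnatural_comb _ _ _ F _ a (fun i X => lpow (delta X) i)) => i.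
  exact: cnatural_lpow.
apply: (@rho_inj _ _ _ _ _ Pgen).
have -> : rho 0 P = 0 by apply: (semilin0 (sigma := idfun) (@rho_linear _ _ _ _ _ _ P)).
by rewrite dE d0 comp_lfun0r.
Qed.

(** The group of automorphisms of [F] is finite over the complex numbers: its
    algebra of functions has no derivation, hence its points form a basis. *)
Lemma complex_points : exists s : seq 'rV[L]_m,
  [/\ free s, forall x, x \in s <-> cmonoidal (rho x) & <<s>>%VS = fullv].
Proof.
have cC i j k : ccomult i j k = ccomult i k j by rewrite /ccomult comultC.
have cA i a b k : \sum_l ccomult i l k * ccomult l a b = \sum_l ccomult i a l * ccomult l b k.
  have E (f g : 'I_m -> R) : \sum_l rc (f l) * rc (g l) = rc (\sum_l f l * g l) :> L.
    by rewrite rmorph_sum; apply: eq_bigr => l _; rewrite rmorphM.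
  by rewrite !E comultA.
have c1 i k : \sum_j ccounit j * ccomult i j k = (i == k)%:R.
  transitivity (rc (\sum_j @counit _ _ F _ Pgen j * @comult _ _ F _ Pgen i j k) : L).
    by rewrite rmorph_sum; apply: eq_bigr => l _; rewrite rmorphM.
  by rewrite comult1 rmorph_nat.
have [s [sfree schar]] := maximal_characters ccomult ccounit.
exists s; split=> // [x|]; first by rewrite schar; apply: characterP.
exact: (characters_span cC cA c1 sfree schar derivation_zero).
Qed.

End Points.

Section InvolutionAction.
Local Open Scope group_scope.
Variables (K : finGroupType) (sigma : K -> K).
Hypotheses (sigmaK : involutive sigma) (sigmaM : {morph sigma : x y / x * y}).

Lemma involution_groupAction : exists to : groupAction [set: 'Z_2]%G [set: K]%G,
  forall k a, to k a = if a == 0%R then k else sigma k.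
Proof.
pose f k (a : 'Z_2) := if a == 0%R then k else sigma k.
have fact : is_action [set: 'Z_2] f.
  split=> [a x y|x a b _ _]; rewrite /f.
    by case: ifP => // _ /(can_inj sigmaK).
  by case: a => [[|[|//]] ?]; case: b => [[|[|//]] ?] //=; rewrite sigmaK.
pose act := Action fact.
have gact : is_groupAction [set: K] act.
  move=> a _; rewrite inE; apply/andP; split.
    by apply/subsetP => x; rewrite inE.
  apply/morphicP => x y _ _; rewrite !actpermE /= /f.
  by case: ifP.
by exists (GroupAction gact).
Qed.

End InvolutionAction.

(** * The invariant part of an object *)

Section UnitProjection.
Variables (K : fieldType) (C : symmoncat K) (F : symmonfunctor C (Vec K)).
Hypotheses (Ff : faithful F) (Creg : regular C).
Local Notation FO := (FO F).
Local Notation Fm := (Fm F).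
Local Notation F1 := (F1 F).
Local Notation one := (unit_ob : C).

(** The fiber of the unit object is a line, on which endomorphisms are scalars. *)
Lemma unit_endo (f : mor one one) : exists a, f = a *: idm one.
Proof.
have [a aE] := unit_scalar (Fm f); exists a; apply: Ff; rewrite fmapZ fmap1.
apply: (lfun_iso_epi (F1_iso F)); rewrite [LHS]aE -comp_lfunZl.
by rewrite comp_lfun1l.
Qed.

Lemma idem_scalar (Z Z' : C) (a : K) (h : mor Z Z') : a *: h = h -> h <> 0 -> a = 1.
Proof.
move=> ah h0; apply/eqP; rewrite -subr_eq0; apply: contra_notT h0 => a1.
have /eqP : (a - 1) *: h = 0 by rewrite scalerBl ah scale1r subrr.
by rewrite scaler_eq0 (negPf a1) => /eqP.
Qed.

Lemma split_from_unit (Z : C) (u : mor one Z) : u <> 0 -> exists w, w \oc u = idm one.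
Proof.
move=> u0; have [g ugu] := Creg u; exists g.
have [a aE] := unit_endo (g \oc u); rewrite aE (@idem_scalar _ _ a u) ?scale1r //.
by rewrite -[RHS]ugu -compA aE compZr compm1.
Qed.

Lemma split_to_unit (Z : C) (w : mor Z one) : w <> 0 -> exists u, w \oc u = idm one.
Proof.
move=> w0; have [g wgw] := Creg w; exists g.
have [a aE] := unit_endo (w \oc g); rewrite aE (@idem_scalar _ _ a w) ?scale1r //.
by rewrite -[RHS]wgw aE compZl comp1m.
Qed.

Section Projection.
Variable Z : C.

Definition dual_system n (u : 'I_n -> mor one Z) (w : 'I_n -> mor Z one) :=
  forall i j, w i \oc u j = (i == j)%:R *: idm one.

(** The [u i] give independent vectors in the fiber of [Z]. *)
Lemma dual_system_bound n u w : @dual_system n u w -> (n <= \dim (fullv : {vspace FO Z}))%N.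
Proof.
move=> uw; pose x i := Fm (u i) (F1 1).
have xI : independent x.
  move=> a a0 j; have : Fm (w j) (\sum_i a i *: x i) = a j *: F1 1.
    rewrite linear_sum (bigD1 j) //= big1 ?addr0 => [|i ij]; rewrite linearZ /= /x.
      by rewrite -comp_lfunE -FmM uw eqxx scale1r Fm1 id_lfunE.
    rewrite -comp_lfunE -FmM uw eq_sym (negPf ij) scale0r.
    by rewrite (semilin0 (sigma := idfun) (@Fm_linear _ _ F _ _)) zero_lfunE scaler0.
  rewrite a0 linear0 => /esym/eqP; rewrite scaler_eq0 => /orP [/eqP //|/eqP F10].
  case/eqP: (F1_neq0 F); apply/lfunP => y.
  by rewrite lfun_regular F10 scaler0 zero_lfunE.
have sz : size (map x (enum 'I_n)) == n by rewrite size_map size_enum_ord.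
pose X : n.-tuple (FO Z) := Tuple sz.
have XE (i : 'I_n) : X`_i = x i.
  by rewrite (nth_map i) ?size_enum_ord // nth_ord_enum.
have Xfree : free X.
  apply/freeP => a a0; apply: (xI a); rewrite -[RHS]a0.
  by apply: eq_bigr => i _; rewrite XE.
by rewrite -(eqP sz) -(eqP Xfree) dimvS ?subvf.
Qed.

Lemma dual_system_extend n u w (u' : mor one Z) (w' : mor Z one) : @dual_system n u w ->
  (forall i, w i \oc u' = 0) -> (forall i, w' \oc u i = 0) -> w' \oc u' = idm one ->
  exists u2 w2, @dual_system n.+1 u2 w2.
Proof.
move=> uw wu' w'u w'u'.
exists (fun i => if unlift ord_max i is Some j then u j else u').
exists (fun i => if unlift ord_max i is Some j then w j else w').
move=> i j; case: (unliftP ord_max i) => [i' ->|->]; case: (unliftP ord_max j) => [j' ->|->].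
- by rewrite uw (inj_eq (@lift_inj _ _)).
- by rewrite wu' eq_sym (negPf (neq_lift _ _)) scale0r.
- by rewrite w'u (negPf (neq_lift _ _)) scale0r.
- by rewrite eqxx scale1r.
Qed.

(** The projection onto the largest multiple of the unit inside [Z]: a dual
    system of maximal length sees all the maps from and to the unit. *)
Lemma unit_projection : exists n (u : 'I_n -> mor one Z) (w : 'I_n -> mor Z one),
  let p := \sum_i (u i \oc w i) in
  (forall v : mor one Z, p \oc v = v) /\ (forall v : mor Z one, v \oc p = v).
Proof.
pose q n := `[< exists u w, @dual_system n u w >].
have q0 : exists n, q n.
  exists 0%N; apply/asboolP.
  by exists (fun=> 0), (fun=> 0); case.
have ubq n : q n -> (n <= \dim (fullv : {vspace FO Z}))%N.
  by move=> /asboolP [u [w /dual_system_bound]].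
case: (ex_maxnP q0 ubq) => n /asboolP [u [w uw]] nmax; exists n, u, w => p.
have pu i : p \oc u i = u i.
  rewrite comp_suml (bigD1 i) //= big1 ?addr0 => [|j ji]; rewrite -compA uw.
    by rewrite eqxx scale1r compm1.
  by rewrite (negPf ji) scale0r compm0.
have wp i : w i \oc p = w i.
  rewrite comp_sumr (bigD1 i) //= big1 ?addr0 => [|j ji]; rewrite compA uw.
    by rewrite eqxx scale1r comp1m.
  by rewrite eq_sym (negPf ji) scale0r comp0m.
have pp : p \oc p = p.
  by rewrite {2}/p comp_sumr; apply: eq_bigr => i _; rewrite compA pu.
have nomax u' w' : (forall i, w i \oc u' = 0) -> (forall i, w' \oc u i = 0) ->
    w' \oc u' = idm one -> False.
  move=> h1 h2 h3; have := nmax n.+1; rewrite ltnn => /(_ _)/negP; apply=> //.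
  by apply/asboolP; apply: dual_system_extend uw h1 h2 h3.
split=> v; apply: contrapT => pv.
  have [|g gu'] := @split_from_unit Z (v - (p \oc v)).
    by move=> /eqP; rewrite subr_eq0 => /eqP v0; apply: pv.
  apply: (nomax (v - (p \oc v)) (g - (g \oc p))) => [i|i|].
  - by rewrite compDr compNr compA wp subrr.
  - by rewrite compDl compNl -compA pu subrr.
  - rewrite compDl compNl -compA gu' compDr compNr.
    have -> : p \oc (p \oc v) = p \oc v.
      by rewrite compA pp.
    by rewrite subrr compm0 subr0.
have [|g gu'] := @split_to_unit Z (v - (v \oc p)).
  by move=> /eqP; rewrite subr_eq0 => /eqP v0; apply: pv.
apply: (nomax (g - (p \oc g)) (v - (v \oc p))) => [i|i|].
- by rewrite compDr compNr compA wp subrr.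
- by rewrite compDl compNl -compA pu subrr.
- rewrite compDr compNr gu' compA compDl compNl -compA.
  by rewrite pp subrr comp0m subr0.
Qed.

End Projection.
End UnitProjection.

(** * The automorphism group of the complexified functor *)

(** The group structure of the complex points is only found inside a proof; it is
    put on a copy of their finite type. *)
Section GroupFromTable.
Variables (T : finType) (mul : T -> T -> T) (one : T) (inv : T -> T).
Hypotheses (mulA : associative mul) (mul1 : left_id one mul) (mulV : left_inverse one inv mul).

Definition table_type of associative mul & left_id one mul & left_inverse one inv mul : Type := T.
Local Notation G := (table_type mulA mul1 mulV).

HB.instance Definition _ := Finite.copy G T.
HB.instance Definition _ := Finite_isGroup.Build G mulA mul1 mulV.

Definition table_group : finGroupType := G.

End GroupFromTable.

Section FiberPoints.
Variables (R : rcfType) (L : complex_field R).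
Variables (C : symmoncat R) (F : symmonfunctor C (Vec R)).
Local Notation CO := (CO L F).
Local Notation Cm := (Cm L F).
Local Notation CJ := (CJ L F).
Local Notation C1 := (C1 L F).
Local Notation cnatural := (@cnatural R L C F).
Local Notation cmonoidal := (@cmonoidal R L C F).

(** [K] is the group of complex points of the automorphism group of [F], acting by [r]
    on the complexified fibers; [sigma] is its conjugation by the complex
    conjugation, which is a real structure on this group. *)
Record fiber_points (P : C) (K : finGroupType) (r : K -> forall X, 'End(CO X))
    (sigma : K -> K) : Prop := FiberPoints {
  fp_natural : forall k, cnatural (r k);
  fp_monoidal : forall k, cmonoidal (r k);
  fp1 : forall X, r 1%g X = \1%VF;
  fpM : forall k l X, r (k * l)%g X = (r k X \o r l X)%VF;
  fp_conj : forall k X x, r (sigma k) X x = cconj (r k X (cconj x));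
  fp_indep : forall c : K -> L, \sum_k c k *: r k P = 0 -> forall k, c k = 0;
  fp_span : forall a, cnatural a -> exists c : K -> L, forall X, a X = \sum_k c k *: r k X
}.

Section Existence.
Variables (P : C) (Pgen : forall X : C, retract_of P X).
Hypothesis Crigid : rigid C.
Local Notation m := (endo_dim F P).
Local Notation rho := (@rho R L C F P Pgen).

Lemma rho_conj x X v : rho (map_mx conj x) X v = cconj (rho x X (cconj v)).
Proof.
rewrite /rho !sum_lfunE (semilin_sum (@cconj_semilin _ L _)); apply: eq_bigr => j _.
by rewrite !scale_lfunE mxE (semilinZ (@cconj_semilin _ L _)) cx_cconj cconjK.
Qed.

Lemma cmonoidal_conj x : cmonoidal (rho x) -> cmonoidal (rho (map_mx conj x)).
Proof.
move=> /characterP [xM x1]; apply/characterP; split=> [j k|].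
  rewrite !mxE -rmorphM -xM rmorph_sum; apply: eq_bigr => i _.
  by rewrite mxE rmorphM conj_rc.
rewrite -[RHS](rmorph1 conj) -x1 rmorph_sum; apply: eq_bigr => i _.
by rewrite mxE rmorphM conj_rc.
Qed.

(** A monoidal natural endomorphism is a character of the algebra of functions, and
    is invertible by rigidity; so the list of all characters is a group under
    composition, and complex conjugation permutes it. *)
Lemma automorphism_group : exists K r sigma, @fiber_points P K r sigma.
Proof.
have [s [sfree sP sspan]] := @complex_points R L C F P Pgen Crigid.
pose T := seq_sub s.
have mem_rho a : cnatural a -> cmonoidal a -> exists z : T, forall X, rho (val z) X = a X.
  move=> na ma; have [x xE] := cnatural_coords Pgen na.
  have xs : x \in s.
    apply/sP; have -> : rho x = a by apply: functional_extensionality_dep => X; rewrite xE.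
    by [].
  by exists (SeqSub xs) => X; rewrite xE.
have Tnat (z : T) : cnatural (rho (val z)) by apply: rho_natural.
have Tmon (z : T) : cmonoidal (rho (val z)) by apply/sP/(ssvalP z).
have Tinj (y z : T) : rho (val y) P = rho (val z) P -> y = z by move=> /rho_inj /val_inj.
have mul_ex (y z : T) : exists t : T, forall X, rho (val t) X = (rho (val y) X \o rho (val z) X)%VF.
  by apply: mem_rho; [apply: cnatural_comp | apply: cmonoidal_comp].
have one_ex : exists t : T, forall X, rho (val t) X = \1%VF.
  by apply: mem_rho; [apply: cnatural1 | apply: cmonoidal1].
have inv_ex (y : T) : exists t : T, forall X, (rho (val t) X \o rho (val y) X = \1)%VF.
  have [b [nb mb by1 yb1]] := cmonoidal_inverse Crigid (Tnat y) (Tmon y).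
  by have [t tE] := mem_rho b nb mb; exists t => X; rewrite tE.
have conj_ex (y : T) : exists t : T, forall X v, rho (val t) X v = cconj (rho (val y) X (cconj v)).
  have ys : map_mx conj (val y) \in s by apply/sP/cmonoidal_conj.
  by exists (SeqSub ys) => X v; apply: rho_conj.
pose mul y z := projT1 (cid (mul_ex y z)).
have mulE y z X : rho (val (mul y z)) X = (rho (val y) X \o rho (val z) X)%VF.
  by rewrite /mul; case: cid.
pose one := projT1 (cid one_ex).
have oneE X : rho (val one) X = \1%VF by rewrite /one; case: cid.
pose inv y := projT1 (cid (inv_ex y)).
have invE y X : (rho (val (inv y)) X \o rho (val y) X = \1)%VF by rewrite /inv; case: cid.
pose sigma y := projT1 (cid (conj_ex y)).
have sigmaE y X v : rho (val (sigma y)) X v = cconj (rho (val y) X (cconj v)).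
  by rewrite /sigma; case: cid.
have mulA : associative mul by move=> x y z; apply: Tinj; rewrite !mulE comp_lfunA.
have mul1 : left_id one mul by move=> x; apply: Tinj; rewrite mulE oneE comp_lfun1l.
have mulV : left_inverse one inv mul by move=> x; apply: Tinj; rewrite mulE oneE invE.
pose X := in_tuple s.
pose h (i : 'I_(size s)) : T := SeqSub (mem_nth 0 (ltn_ord i)).
have hbij : bijective h.
  apply: inj_card_bij; last by rewrite card_seq_sub ?card_ord // free_uniq.
  move=> i j [] /eqP; rewrite nth_uniq ?(free_uniq sfree) // => /eqP ij.
  exact: val_inj.
have sumT (V : nmodType) (f : T -> V) : \sum_t f t = \sum_i f (h i).
  by rewrite (reindex h) //; apply: onW_bij.
have rho_sum (c : T -> L) Z : \sum_t c t *: rho (val t) Z = rho (\sum_t c t *: val t) Z.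
  by rewrite (linear_comb _ _ _ (rho_linear Pgen Z)).
exists (table_group mulA mul1 mulV), (fun k Z => rho (val (k : T)) Z), sigma.
split=> //.
- move=> c c0 k; have : \sum_t c t *: val (t : T) = 0.
    apply: (rho_inj (Pgen := Pgen)); rewrite -rho_sum [LHS]c0.
    by rewrite (semilin0 (sigma := idfun) (rho_linear Pgen P)).
  rewrite (sumT _ (fun t : T => c t *: val t)) => /(elimT (freeP (X := X)) sfree) ch0.
  by have [h' _ h'K] := hbij; rewrite -(h'K k) ch0.
- move=> a /(cnatural_coords Pgen) [x xE].
  have [h' hK h'K] := hbij.
  exists (fun t => coord X (h' (t : T)) x) => Z; rewrite xE [RHS]rho_sum.
  suff <- : x = \sum_t coord X (h' t) x *: val (t : T) by [].
  rewrite (sumT _ (fun t : T => coord X (h' t) x *: val t)).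
  rewrite {1}(coord_span (X := X) (v := x)); last by rewrite /= sspan memvf.
  by apply: eq_bigr => i _; rewrite hK.
Qed.

End Existence.
End FiberPoints.

(** * Equivariant maps come from morphisms *)

Section Reconstruction.
Variables (R : rcfType) (L : complex_field R).
Variables (C : symmoncat R) (F : symmonfunctor C (Vec R)).
Local Notation CO := (CO L F).
Local Notation Cm := (Cm L F).
Local Notation CJ := (CJ L F).
Local Notation C1 := (C1 L F).
Local Notation one := (unit_ob : C).
Variables (P : C) (K : finGroupType) (r : K -> forall X, 'End(CO X)) (sigma : K -> K).
Hypotheses (rP : fiber_points P r sigma) (Crigid : rigid C) (Creg : regular C).
Hypothesis Ff : faithful F.

Lemma points_inj k l : r k P = r l P -> k = l.
Proof.
move=> kl; apply/eqP; case: (k =P l) => // /eqP kNl.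
have := fp_indep rP (c := fun i => (i == k)%:R - (i == l)%:R).
have rsum i0 : \sum_i (i == i0)%:R *: r i P = r i0 P.
  rewrite (bigD1 i0) //= eqxx scale1r big1 ?addr0 // => i /negPf ->.
  by rewrite scale0r.
under eq_bigr do rewrite scalerBl.
rewrite sumrB !rsum kl subrr => /(_ erefl k) /eqP.
by rewrite eqxx (negPf kNl) subr0 oner_eq0.
Qed.

Lemma pointsK : involutive sigma.
Proof.
move=> k; apply: points_inj; apply/lfunP => x.
by rewrite !(fp_conj rP) !cconjK.
Qed.

Lemma pointsM : {morph sigma : k l / (k * l)%g}.
Proof.
move=> k l; apply: points_inj; apply/lfunP => x.
by rewrite (fpM rP) comp_lfunE !(fp_conj rP) cconjK (fpM rP) comp_lfunE.
Qed.

Lemma Cm_inj X Y (f g : mor X Y) : Cm f = Cm g -> f = g.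
Proof. by move=> /cx_inj fg; apply: Ff. Qed.

Lemma Cm_linear X Y : real_linear (fun f : mor X Y => Cm f).
Proof. by move=> a f g; rewrite /Cm Fm_linear cx_real_linear. Qed.

Lemma Cm_sum X Y I (s : seq I) (f : I -> mor X Y) :
  Cm (\sum_(i <- s) f i) = \sum_(i <- s) Cm (f i).
Proof. exact: (real_linear_sum (@Cm_linear X Y)). Qed.

(** A map from the unit fixed by all points lies in the image of the projection
    on the unit part: this projection is natural, hence a combination of points
    whose coefficients add up to 1, as one sees on the unit object. *)
Lemma invariant_vector Z (v : 'Hom((L : fieldType)^o, CO Z)) :
  (forall k, r k Z \o v = v)%VF ->
  exists u u' : mor one Z, (v = (Cm u \o C1) + cI *: (Cm u' \o C1))%VF.
Proof.
move=> vinv.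
have exn X := unit_projection Ff Creg X.
pose n X := projT1 (cid (exn X)).
have exu X : exists (u : 'I_(n X) -> mor one X) (w : 'I_(n X) -> mor X one),
  let p := \sum_i (u i \oc w i) in
  (forall v : mor one X, p \oc v = v) /\ (forall v : mor X one, v \oc p = v).
  by rewrite /n; case: cid.
pose u X := projT1 (cid (exu X)).
have exw X : exists (w : 'I_(n X) -> mor X one),
  let p := \sum_i (u X i \oc w i) in
  (forall v : mor one X, p \oc v = v) /\ (forall v : mor X one, v \oc p = v).
  by rewrite /u; case: cid.
pose w X := projT1 (cid (exw X)).
pose p X := \sum_i (u X i \oc w X i).
have pP X : (forall v : mor one X, p X \oc v = v) /\ (forall v : mor X one, v \oc p X = v).
  by rewrite /p /w; case: cid.
have pnat X Y (f : mor X Y) : f \oc p X = p Y \oc f.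
  have l : p Y \oc (f \oc p X) = f \oc p X.
    rewrite {2 3}/p !comp_sumr; apply: eq_bigr => i _.
    by rewrite !compA -(compA (p Y)) (proj1 (pP Y)).
  rewrite -l {1}/p comp_suml [in RHS]/p [in RHS]comp_suml; apply: eq_bigr => i _.
  by rewrite -!compA; congr (_ \oc _); rewrite !compA (proj2 (pP X)).
have p1 : p one = idm one by rewrite -[LHS]compm1; apply: (proj1 (pP one)).
have [c cE] : exists c : K -> L, forall X, Cm (p X) = \sum_k c k *: r k X.
  by apply: (fp_span rP) => X Y f; rewrite -!CmM pnat.
have csum : \sum_k c k = 1.
  have : (Cm (p one) \o C1 = (\sum_k c k) *: C1)%VF.
    rewrite cE comp_combl scaler_suml; apply: eq_bigr => k _.
    by have [_ ->] := fp_monoidal rP k.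
  rewrite p1 Cm1 comp_lfun1l -{1}[C1]scale1r => /eqP.
  rewrite -subr_eq0 -scalerBl scaler_eq0 (negPf (C1_neq0 L F)) orbF subr_eq0.
  by move=> /eqP.
have pv : (Cm (p Z) \o v = v)%VF.
  rewrite cE comp_combl; under eq_bigr do rewrite vinv.
  by rewrite -scaler_suml csum scale1r.
have [G [GC CG]] := C1_iso L F.
pose lam i : L := G (Cm (w Z i) (v 1)).
have wv i : (Cm (w Z i) \o v = lam i *: C1)%VF.
  apply/lfunP => x; rewrite lfun_regular [RHS]lfun_regular scale_lfunE comp_lfunE.
  congr (_ *: _); have /lfunP /(_ (Cm (w Z i) (v 1))) := CG.
  rewrite comp_lfunE id_lfunE => <-; rewrite (lfun_regular C1 (G _)).
  by [].
exists (\sum_i cRe (lam i) *: u Z i), (\sum_i cIm (lam i) *: u Z i).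
rewrite -[LHS]pv /p Cm_sum (semilin_sum (sigma := idfun) (@vcomp_linearl _ _ _ _ _)).
rewrite !Cm_sum !(semilin_sum (sigma := idfun) (@vcomp_linearl _ _ _ _ _)).
rewrite scaler_sumr -big_split; apply: eq_bigr => i _ /=.
rewrite !(real_linearZ (@Cm_linear _ _)) CmM -comp_lfunA wv -!comp_lfunZl -comp_lfunZr.
by rewrite scalerA -scalerDl -complex_decomp.
Qed.

(** Bending [X] by duality turns an equivariant [phi] into a vector of [Y \ox D] fixed
    by all points, where [D] is dual to [X]; such a vector comes from the unit
    object, and bending back exhibits [phi] as a complex combination of images of
    morphisms. Since [phi] is real, it is the image of the real part. *)
Lemma points_full X Y (phi : 'Hom(CO X, CO Y)) :
  (forall k, phi \o r k X = r k Y \o phi)%VF ->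
  (forall x, phi (cconj x) = cconj (phi x)) -> exists f : mor X Y, Cm f = phi.
Proof.
move=> phiK phiT; have [[D [ev [coev [zz _]]]] _] := Crigid X.
have [cev [ccoev [cevE ccoevE zzC]]] := dual_zigzag L F zz.
pose v := (CJ Y D \o (vtensm phi \1 \o ccoev))%VF.
have vinv k : (r k (Y \ox D) \o v = v)%VF.
  have [rM r1] := fp_monoidal rP k.
  have inv : (vtensm (r k X) (r k D) \o ccoev = ccoev)%VF.
    apply: (lfun_iso_mono (CJ_iso L F X D)).
    by rewrite comp_lfunA -rM -comp_lfunA ccoevE comp_lfunA -(fp_natural rP) -comp_lfunA r1.
  rewrite /v [LHS]comp_lfunA rM -[LHS]comp_lfunA; congr (_ \o _)%VF.
  by rewrite -[in RHS]inv !comp_lfunA -!vtensmM comp_lfun1l comp_lfun1r phiK.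
have [u [u' vE]] := invariant_vector vinv.
have [H [HJ JH]] := CJ_iso L F Y D.
pose bend (u : mor one (Y \ox D)) := runit Y \oc (idm Y \oxm ev) \oc assoc Y D X \oc (u \oxm idm X).
pose cu (u : mor one (Y \ox D)) := (H \o Cm u \o C1)%VF.
have bendE u0 : (Cm (bend u0) \o CJ one X \o vtensm C1 \1 =
   vrunit (CO Y) \o vtensm \1 cev \o vassoc _ _ _ \o vtensm (cu u0) \1)%VF.
  by apply: transposeE => //; rewrite /cu !comp_lfunA JH comp_lfun1l.
have [l [ll l'l]] := lunit_iso X.
pose Bend (t : 'Hom((L : fieldType)^o, vtens (CO Y) (CO D))) :=
  (vrunit (CO Y) \o vtensm \1 cev \o vassoc _ _ _ \o vtensm t \1)%VF.
have Bend_cu u0 : (Cm (bend u0 \oc l) \o vlunit (CO X) = Bend (cu u0))%VF.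
  rewrite /Bend -bendE CmM -(CJ_lunit L F X) -!comp_lfunA; congr (_ \o _)%VF.
  by rewrite !comp_lfunA -CmM ll Cm1 comp_lfun1l.
have Bend_phi : (phi \o vlunit (CO X) = Bend (vtensm phi \1 \o ccoev))%VF.
  have pr : (phi \o vrunit (CO X) = vrunit (CO Y) \o vtensm phi \1)%VF by rewrite vrunit_nat.
  have m1 : (vtensm phi \1 \o vtensm \1 cev = vtensm \1 cev \o vtensm phi (vtensm \1 \1))%VF.
    by rewrite -!vtensmM vtensm1 !comp_lfun1l !comp_lfun1r.
  rewrite -zzC !comp_lfunA pr /Bend -!comp_lfunA; congr (_ \o _)%VF.
  rewrite comp_lfunA m1 -comp_lfunA; congr (_ \o _)%VF.
  by rewrite comp_lfunA -vassoc_nat -comp_lfunA -vtensmM comp_lfun1l.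
have Bend_lin : linear Bend.
  move=> a t t'; rewrite /Bend vtensm_linearl.
  by rewrite (vcomp_linearr _ a).
have phiE : phi = Cm (bend u \oc l) + cI *: Cm (bend u' \oc l).
  apply: (lfun_iso_epi (vlunit_iso (CO X))); rewrite Bend_phi comp_lfunDl -comp_lfunZl.
  rewrite !Bend_cu addrC -Bend_lin; congr Bend.
  apply: (lfun_iso_mono (CJ_iso L F Y D)); rewrite -[LHS]/v vE comp_lfunDr -comp_lfunZr.
  by rewrite /cu !comp_lfunA JH !comp_lfun1l addrC.
exists (bend u \oc l).
have fT := @cx_descend R L _ _ phi phiT.
rewrite -[RHS]fT; congr cx; apply/lfunP => x.
have /lfunP /(_ (iota L x)) := phiE.
rewrite -[X in fun_of_lfun X _ = _]fT cx_iota add_lfunE scale_lfunE !cx_iota.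
rewrite -[iota L (rpart_lfun phi x)]addr0 -[X in _ + X = _](scaler0 _ cI).
by rewrite -(real_linear0 (@iota_real_linear _ L _)) => /cplx_inj [].
Qed.

End Reconstruction.

(** * Representations come from objects *)

Section RepresentationRetract.
Variables (L : numFieldType) (G : finGroupType) (E W : vectType L).
Variables (rE : G -> 'End(E)) (rW : G -> 'End(W)).
Hypothesis (rEM : forall k l, rE (k * l)%g = (rE k \o rE l)%VF).
Hypotheses (rW1 : rW 1%g = \1%VF) (rWM : forall k l, rW (k * l)%g = (rW k \o rW l)%VF).
Hypothesis rE_indep : forall c : G -> L, \sum_k c k *: rE k = 0 -> forall k, c k = 0.

Lemma delta_functional : exists lam : 'Hom('End(E), L^o),
  forall k, lam (rE k) = (k == 1%g)%:R.
Proof.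
have sz : size [seq rE k | k <- enum G] == #|G| by rewrite size_map cardE.
pose X : #|G|.-tuple 'End(E) := Tuple sz.
have XE (i : 'I_#|G|) : X`_i = rE (enum_val i).
  by rewrite (nth_map 1%g) -?cardE // -enum_val_nth.
have Xfree : free X.
  apply/freeP => a a0 i.
  rewrite -[ i ]enum_valK; apply: (rE_indep (c := fun k => a (enum_rank k))).
  rewrite -[RHS]a0 (reindex (fun i : 'I_#|G| => enum_val i : G)) /=; last first.
    by exists enum_rank => j _; rewrite ?enum_valK ?enum_rankK.
  by apply: eq_bigr => j _; rewrite enum_valK XE.
exists (linfun (fun a => coord X (enum_rank 1%g) a : L^o)) => k.
rewrite linfunE; last by move=> a u v; rewrite linearP.
by rewrite -[k]enum_rankK -XE coord_free // enum_rankK (inj_eq enum_rank_inj) eq_sym.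
Qed.

Let crd (V : vectType L) (i : 'I_(dim V)) : 'Hom(V, L^o) := linfun (fun v => v2r v 0 i : L^o).
Let crdE (V : vectType L) i (v : V) : crd i v = v2r v 0 i.
Proof. by apply: linfunE => a x y; rewrite linearP !mxE. Qed.

Let rank1 (V U : vectType L) (eta : 'Hom(V, L^o)) (u : U) : 'Hom(V, U) :=
  linfun (fun v => (eta v : L) *: u).
Let rank1E (V U : vectType L) (eta : 'Hom(V, L^o)) (u : U) v :
  rank1 eta u v = (eta v : L) *: u.
Proof. by apply: linfunE => a x y; rewrite linearP scalerDl scalerA. Qed.

(** Averages of rank one maps are equivariant; with coefficients given by a
    functional that separates [1] from the other group elements, the composites
    of two such averages add up to a multiple of the identity. *)
Lemma rep_retract : exists (I : finType) (f : I -> 'Hom(E, W)) (g : I -> 'Hom(W, E)),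
  [/\ forall i k, (f i \o rE k = rW k \o f i)%VF,
      forall i k, (g i \o rW k = rE k \o g i)%VF & \sum_i (f i \o g i)%VF = \1%VF].
Proof.
have [lam lamE] := delta_functional.
pose x p := \sum_q (lam (rank1 (crd q) (tbase p)) : L) *: tbase q : E.
have lamx a : (lam a : L) = \sum_p v2r (a (x p)) 0 p.
  have {1}-> : a = \sum_q \sum_p v2r (a (tbase q)) 0 p *: rank1 (crd q) (tbase p).
    apply/lfunP => v; rewrite {1}[v]tbase_sum linear_sum sum_lfunE; apply: eq_bigr => q _.
    rewrite linearZ /= {1}[a _]tbase_sum scaler_sumr sum_lfunE; apply: eq_bigr => p _.
    by rewrite scale_lfunE rank1E crdE scalerA mulrC -scalerA.
  rewrite exchange_big linear_sum; apply: eq_bigr => p _ /=.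
  rewrite /x !linear_sum summxE; apply: eq_bigr => q _ /=.
  by rewrite !linearZ mxE /GRing.scale /= mulrC.
pose I : finType := ('I_(dim W) * 'I_(dim E))%type.
pose f (i : I) := \sum_k (rW k \o rank1 (crd i.2) (tbase i.1) \o rE k^-1%g)%VF.
pose g (i : I) := #|G|%:R^-1 *: \sum_k (rE k \o rank1 (crd i.1) (x i.2) \o rW k^-1%g)%VF.
have avg (V1 V2 : vectType L) (r1 : G -> 'End(V1)) (r2 : G -> 'End(V2)) (t : 'Hom(V1, V2)) l :
    (forall k l, r1 (k * l)%g = (r1 k \o r1 l)%VF) ->
    (forall k l, r2 (k * l)%g = (r2 k \o r2 l)%VF) ->
    ((\sum_k (r2 k \o t \o r1 k^-1%g)) \o r1 l = r2 l \o (\sum_k (r2 k \o t \o r1 k^-1%g)))%VF.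
  move=> r1M r2M; rewrite comp_lfun_suml comp_lfun_sumr (reindex_inj (mulgI l)); apply: eq_bigr => k _.
  by rewrite -(comp_lfunA _ _ (r1 l)) -r1M invMg mulgKV r2M !comp_lfunA.
exists I, f, g; split=> [i k|i k|].
- exact: avg.
- by rewrite /g -comp_lfunZl -comp_lfunZr avg.
have G0 : (#|G|%:R : L) != 0.
  by rewrite Num.Theory.pnatr_eq0 -lt0n; apply/card_gt0P; exists 1%g.
apply/lfunP => y; rewrite sum_lfunE id_lfunE.
have fgE i : (f i \o g i)%VF y = #|G|%:R^-1 *: \sum_k \sum_l
    ((v2r (rW l^-1%g y) 0 i.1 * v2r (rE (k^-1 * l)%g (x i.2)) 0 i.2) *: rW k (tbase i.1)).
  rewrite /g -comp_lfunZr scale_lfunE /f comp_lfun_suml sum_lfunE; congr (_ *: _).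
  apply: eq_bigr => k _; rewrite comp_lfun_sumr sum_lfunE; apply: eq_bigr => l _.
  rewrite !comp_lfunE !rank1E !crdE !linearZ /= rEM comp_lfunE !mxE.
  by rewrite -scalerA.
under eq_bigr do rewrite fgE.
rewrite -scaler_sumr exchange_big /=.
under eq_bigr do rewrite exchange_big /=.
transitivity (#|G|%:R^-1 *: \sum_(k : G) y); last first.
  by rewrite sumr_const -scaler_nat scalerA mulVf // scale1r.
congr (_ *: _); apply: eq_bigr => k _.
rewrite (bigD1 k) //= [X in _ + X]big1 ?addr0 => [|l lk].
  rewrite -(pair_bigA _ (fun t p => (v2r (rW k^-1%g y) 0 t * v2r (rE (k^-1 * k)%g (x p)) 0 p) *:
    rW k (tbase t))) /=.
  transitivity (\sum_t v2r (rW k^-1%g y) 0 t *: rW k (tbase t)).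
    apply: eq_bigr => t _; rewrite -scaler_suml -mulr_sumr -lamx lamE mulVg eqxx.
    by rewrite mulr1.
  rewrite -[RHS](id_lfunE y) -rW1 -(mulgV k) rWM comp_lfunE [X in rW k X]tbase_sum linear_sum.
  by apply: eq_bigr => t _; rewrite linearZ.
rewrite -(pair_bigA _ (fun t p => (v2r (rW l^-1%g y) 0 t * v2r (rE (k^-1 * l)%g (x p)) 0 p) *:
  rW k (tbase t))) /= big1 // => t _.
rewrite -scaler_suml -mulr_sumr -lamx lamE.
have /negPf -> : (k^-1 * l != 1)%g by rewrite -(inj_eq (mulgI k)) mulKVg mulg1.
by rewrite mulr0 scale0r.
Qed.

End RepresentationRetract.

Section RealParts.
Variables (R : rcfType) (L : complex_field R) (V W : vectType L).
Variables (TV : V -> V) (TW : W -> W).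
Hypotheses (TVl : semilin (@conj R L) TV) (TWl : semilin (@conj R L) TW).
Hypotheses (TVK : involutive TV) (TWK : involutive TW).

(** Antilinear involutions of [V] and [W] induce one on the linear maps, for which
    [re_hom] and [im_hom] are the real and imaginary parts. *)
Definition tw (f : 'Hom(V, W)) : 'Hom(V, W) := linfun (fun v => TW (f (TV v))).

Lemma twE f v : tw f v = TW (f (TV v)).
Proof.
by apply: linfunE => a x y; rewrite TVl linearP TWl /= conjK.
Qed.

Definition re_hom f : 'Hom(V, W) := 2%:R^-1 *: (f + tw f).
Definition im_hom f : 'Hom(V, W) := - cI *: (2%:R^-1 *: (f - tw f)).

Lemma re_im_hom f : f = re_hom f + cI *: im_hom f.
Proof.
rewrite /im_hom scalerA mulrN cI2 opprK scale1r -scalerDr addrACA subrr addr0.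
by rewrite -mulr2n -scaler_nat scalerA mulVf ?scale1r // Num.Theory.pnatr_eq0.
Qed.

Let conj_half : conj (2%:R^-1) = 2%:R^-1 :> L.
Proof. by rewrite fmorphV rmorph_nat. Qed.

Lemma re_homT f v : re_hom f (TV v) = TW (re_hom f v).
Proof.
rewrite !scale_lfunE !add_lfunE !twE TVK (semilinZ TWl) (semilinD TWl) TWK.
by rewrite conj_half addrC.
Qed.

Lemma im_homT f v : im_hom f (TV v) = TW (im_hom f v).
Proof.
rewrite !scale_lfunE !add_lfunE !opp_lfunE !twE TVK !(semilinZ TWl) (semilinD TWl).
rewrite (semilinN TWl) TWK conj_half rmorphN conj_cI opprK.
by rewrite scaleNr -!scalerN opprB.
Qed.

End RealParts.

Section Realization.
Variables (R : rcfType) (L : complex_field R).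
Variables (C : symmoncat R) (F : symmonfunctor C (Vec R)).
Local Notation CO := (CO L F).
Local Notation Cm := (Cm L F).
Variables (P : C) (K : finGroupType) (r : K -> forall X, 'End(CO X)) (sigma : K -> K).
Hypotheses (rP : fiber_points P r sigma) (Crigid : rigid C) (Creg : regular C).
Hypothesis Ff : faithful F.
Hypothesis Psplit : splits_idempotents P.
Variables (W : vectType L) (rW : K -> 'End(W)) (TW : W -> W).
Hypotheses (rW1 : rW 1%g = \1%VF) (rWM : forall k l, rW (k * l)%g = (rW k \o rW l)%VF).
Hypotheses (TWl : semilin (@conj R L) TW) (TWK : involutive TW).
Hypothesis TWr : forall k w, rW (sigma k) w = TW (rW k (TW w)).

Let TWr' k w : TW (rW k w) = rW (sigma k) (TW w).
Proof. by rewrite TWr TWK. Qed.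

Let conj_r k X (x : CO X) : cconj (r k X x) = r (sigma k) X (cconj x).
Proof. by rewrite (fp_conj rP) cconjK. Qed.

Let half_equivariant (V V' : vectType L) (r1 : K -> 'End(V)) (r2 : K -> 'End(V'))
    (T1 : V -> V) (T2 : V' -> V') (T1l : semilin (@conj R L) T1) (T2l : semilin (@conj R L) T2) :
  (forall k v, T1 (r1 k v) = r1 (sigma k) (T1 v)) ->
  (forall k v, T2 (r2 k v) = r2 (sigma k) (T2 v)) ->
  forall f : 'Hom(V, V'), (forall k, f \o r1 k = r2 k \o f)%VF ->
  (forall k, re_hom T1 T2 f \o r1 k = r2 k \o re_hom T1 T2 f)%VF /\
  (forall k, im_hom T1 T2 f \o r1 k = r2 k \o im_hom T1 T2 f)%VF.
Proof.
move=> e1 e2 f fr.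
have twr k : (tw T1 T2 f \o r1 k = r2 k \o tw T1 T2 f)%VF.
  apply/lfunP => v; rewrite !comp_lfunE !(twE T1l T2l) e1.
  have /lfunP /(_ (T1 v)) := fr (sigma k); rewrite !comp_lfunE => ->.
  by rewrite e2 (pointsK rP).
split=> k; rewrite /re_hom /im_hom -!comp_lfunZl -!comp_lfunZr.
  by rewrite comp_lfunDl comp_lfunDr fr twr.
by rewrite comp_lfunDl comp_lfunDr comp_lfunNl comp_lfunNr fr twr.
Qed.

(** Every representation is a retract of a sum of copies of the generator, by maps
    that can be made real: if [f = f1 + i f2] and [g = g1 + i g2] then the real part
    of [\sum_i f i \o g i], which is the identity, is the sum of the
    [f1 \o g1 - f2 \o g2]. *)
Lemma real_retract : exists n (f : 'I_n -> 'Hom(CO P, W)) (g : 'I_n -> 'Hom(W, CO P)),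
  [/\ forall i k, (f i \o r k P = rW k \o f i)%VF /\ (g i \o rW k = r k P \o g i)%VF,
      forall i x, f i (cconj x) = TW (f i x),
      forall i w, g i (TW w) = cconj (g i w) &
      \sum_i (f i \o g i)%VF = \1%VF].
Proof.
have [I [f [g [fr gr fg]]]] := rep_retract (fun k l => fpM rP k l P) rW1 rWM (fp_indep rP).
have cl := @cconj_semilin R L (FO F P); have cK := @cconjK R L (FO F P).
have fpart i := half_equivariant cl TWl (fun k => @conj_r k P) TWr' (fr i).
have gpart i := half_equivariant TWl cl TWr' (fun k => @conj_r k P) (gr i).
pose f1 i := re_hom (@cconj R L _) TW (f i); pose f2 i := im_hom (@cconj R L _) TW (f i).
pose g1 i := re_hom TW (@cconj R L _) (g i); pose g2 i := im_hom TW (@cconj R L _) (g i).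
have fT i x : f1 i (cconj x) = TW (f1 i x) /\ f2 i (cconj x) = TW (f2 i x).
  by rewrite /f1 /f2 (re_homT cl TWl cK TWK) (im_homT cl TWl cK TWK).
have gT i w : g1 i (TW w) = cconj (g1 i w) /\ g2 i (TW w) = cconj (g2 i w).
  by rewrite /g1 /g2 (re_homT TWl cl TWK cK) (im_homT TWl cl TWK cK).
have fE i : f i = f1 i + cI *: f2 i by apply: re_im_hom.
have gE i : g i = g1 i + cI *: g2 i by apply: re_im_hom.
have [fr1 fr2] : (forall i k, f1 i \o r k P = rW k \o f1 i)%VF /\ (forall i k, f2 i \o r k P = rW k \o f2 i)%VF.
  by split=> i; have [] := fpart i.
have [gr1 gr2] : (forall i k, g1 i \o rW k = r k P \o g1 i)%VF /\ (forall i k, g2 i \o rW k = r k P \o g2 i)%VF.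
  by split=> i; have [] := gpart i.
clearbody f1 f2 g1 g2.
pose A := \sum_i ((f1 i \o g1 i) - (f2 i \o g2 i))%VF.
pose B := \sum_i ((f1 i \o g2 i) + (f2 i \o g1 i))%VF.
have AB : A + cI *: B = \1%VF.
  rewrite -fg scaler_sumr -big_split; apply: eq_bigr => i _ /=.
  rewrite fE gE !comp_lfunDl !comp_lfunDr -!comp_lfunZl -!comp_lfunZr scalerA cI2 scaleN1r.
  by rewrite scalerDr !addrA [LHS](ACl (1*3*4*2)%AC).
have TN w : TW (- w) = - TW w := semilinN TWl w.
have AT w : A (TW w) = TW (A w).
  rewrite !sum_lfunE (semilin_sum TWl); apply: eq_bigr => i _.
  rewrite !add_lfunE !opp_lfunE (semilinD TWl) TN !comp_lfunE.
  by have [-> ->] := gT i w; have [-> _] := fT i (g1 i w); have [_ ->] := fT i (g2 i w).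
have BT w : B (TW w) = TW (B w).
  rewrite !sum_lfunE (semilin_sum TWl); apply: eq_bigr => i _.
  rewrite !add_lfunE (semilinD TWl) !comp_lfunE.
  by have [-> ->] := gT i w; have [_ ->] := fT i (g1 i w); have [-> _] := fT i (g2 i w).
have A1 : A = \1%VF.
  apply/lfunP => w; rewrite id_lfunE.
  have e1 : A w + cI *: B w = w by rewrite -scale_lfunE -add_lfunE AB id_lfunE.
  have e2 : A w - cI *: B w = w.
    have : TW (A (TW w) + cI *: B (TW w)) = TW (TW w).
      by rewrite -scale_lfunE -add_lfunE AB id_lfunE.
    by rewrite (semilinD TWl) (semilinZ TWl) AT BT !TWK conj_cI scaleNr.
  apply: (@scalerI _ _ (2%:R : L)); first by rewrite Num.Theory.pnatr_eq0.
  rewrite !scaler_nat !mulr2n; have := congr2 (fun u v => u + v) e1 e2.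
  by rewrite /= addrACA subrr addr0.
pose h (V V' : vectType L) (u v : I -> 'Hom(V, V')) (i : 'I_(#|I| + #|I|)) : 'Hom(V, V') :=
  match split i with inl j => u (enum_val j) | inr j => v (enum_val j) end.
exists (#|I| + #|I|)%N, (h _ _ f1 (fun i => - f2 i)), (h _ _ g1 g2); split=> [i k|i x|i w|].
- rewrite /h; case: (split i) => j; split=> //.
  by rewrite comp_lfunNl comp_lfunNr fr2.
- rewrite /h; case: (split i) => j; first by have [] := fT (enum_val j) x.
  by rewrite !opp_lfunE; have [_ ->] := fT (enum_val j) x; rewrite TN.
- by rewrite /h; case: (split i) => j; have [] := gT (enum_val j) w.
rewrite big_split_ord /= -A1 /A big_split /=.
rewrite [\sum_i (f1 i \o g1 i)%VF](reindex (fun j : 'I_#|I| => enum_val j : I)) /=; last first.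
  by exists enum_rank => j _; rewrite ?enum_valK ?enum_rankK.
rewrite [\sum_i - (f2 i \o g2 i)%VF](reindex (fun j : 'I_#|I| => enum_val j : I)) /=; last first.
  by exists enum_rank => j _; rewrite ?enum_valK ?enum_rankK.
congr (_ + _); apply: eq_bigr => j _; rewrite /h.
  by rewrite (unsplitK (inl j : 'I_#|I| + 'I_#|I|)).
by rewrite (unsplitK (inr j : 'I_#|I| + 'I_#|I|)) comp_lfunNl.
Qed.

(** The idempotent of the retraction comes from the category by fullness, and is
    split there. *)
Lemma realization : exists X (h : 'Hom(CO X, W)),
  [/\ lfun_iso h, forall k, (h \o r k X = rW k \o h)%VF & forall x, h (cconj x) = TW (h x)].
Proof.
have [n [f [g [frgr fT gT fg]]]] := real_retract.
have bex i j : exists b : mor P P, Cm b = (g i \o f j)%VF.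
  apply: (points_full rP Crigid Creg Ff) => [k|x].
    by rewrite -comp_lfunA (proj1 (frgr j k)) !comp_lfunA (proj2 (frgr i k)).
  by rewrite !comp_lfunE fT gT.
pose b i j := projT1 (cid (bex i j)).
have bE i j : Cm (b i j) = (g i \o f j)%VF by rewrite /b; case: cid.
clearbody b.
have [|X [p [q [qp pq]]]] := Psplit (b := b).
  move=> i j; apply: (@Cm_inj _ L _ _ Ff); rewrite Cm_sum bE.
  transitivity (g i \o (\sum_k (f k \o g k)) \o f j)%VF; last by rewrite fg comp_lfun1r.
  rewrite comp_lfun_sumr comp_lfun_suml; apply: eq_bigr => k _.
  by rewrite CmM !bE !comp_lfunA.
pose h := (\sum_i (f i \o Cm (q i)))%VF; pose h' := (\sum_i (Cm (p i) \o g i))%VF.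
exists X, h; split=> [|k|x].
- exists h'; split.
    transitivity (\sum_i \sum_j (Cm (p i) \o (g i \o f j) \o Cm (q j)))%VF.
      rewrite /h' comp_lfun_suml; apply: eq_bigr => i _; rewrite /h comp_lfun_sumr; apply: eq_bigr => j _.
      by rewrite !comp_lfunA.
    transitivity (\sum_i \sum_j Cm (p i \oc q i \oc (p j \oc q j)))%VF.
      apply: eq_bigr => i _; apply: eq_bigr => j _.
      by rewrite -bE -qp !CmM !comp_lfunA.
    rewrite -[RHS](Cm1 L F X) -[idm X]comp1m -{1}pq comp_suml Cm_sum; apply: eq_bigr => i _.
    by rewrite -Cm_sum -comp_sumr pq.
  transitivity (\sum_i \sum_j (f i \o Cm (q i \oc p j) \o g j))%VF.
    rewrite /h comp_lfun_suml; apply: eq_bigr => i _; rewrite /h' comp_lfun_sumr; apply: eq_bigr => j _.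
    by rewrite CmM !comp_lfunA.
  rewrite -fg; apply: eq_bigr => i _.
  transitivity ((f i \o g i) \o (\sum_j (f j \o g j)))%VF; last by rewrite fg comp_lfun1r.
  by rewrite comp_lfun_sumr; apply: eq_bigr => j _; rewrite qp bE !comp_lfunA.
- rewrite /h comp_lfun_suml comp_lfun_sumr; apply: eq_bigr => i _.
  by rewrite -comp_lfunA (fp_natural rP) !comp_lfunA (proj1 (frgr i k)).
- rewrite /h !sum_lfunE (semilin_sum TWl); apply: eq_bigr => i _.
  by rewrite !comp_lfunE Cm_cconj fT.
Qed.

End Realization.

(** * Descent along a real structure *)

Section RealForm.
Variables (R : rcfType) (L : complex_field R) (W : vectType L) (T : W -> W).
Hypotheses (Tl : semilin (@conj R L) T) (TK : involutive T).

Lemma free_subseq (s : seq W) :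
  exists b : seq W, [/\ {subset b <= s}, free b & (<<b>> = <<s>>)%VS].
Proof.
elim: s => [|x s [b [bs bfree bspan]]]; first by exists [::]; split=> //; apply: nil_free.
case: (boolP (x \in <<b>>%VS)) => xb.
  exists b; split=> //; first by move=> y /bs; rewrite inE orbC => ->.
  by rewrite span_cons -bspan; apply/esym/addv_idPr; rewrite -memvE.
exists (x :: b); split; first by move=> y; rewrite !inE => /orP [->|/bs ->] //; rewrite orbT.
  by rewrite free_cons xb.
by rewrite !span_cons bspan.
Qed.

(** The vectors [x + T x] and [i (x - T x)] are fixed by the antilinear involution
    [T], and every [x] is a combination of them. *)
Lemma fixed_basis : exists n (b : n.-tuple W),
  [/\ free b, (<<b>> = fullv)%VS & forall i, T (tnth b i) = tnth b i].
Proof.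
pose s := [seq x + T x | x <- vbasis (@fullv L W)] ++
          [seq cI *: (x - T x) | x <- vbasis (@fullv L W)].
have [b [bs bfree bspan]] := free_subseq s.
have sT x : x \in s -> T x = x.
  rewrite mem_cat => /orP [] /mapP [y _ ->].
    by rewrite (semilinD Tl) TK addrC.
  rewrite (semilinZ Tl) (semilinD Tl) (semilinN Tl) TK conj_cI scaleNr -scalerN opprB.
  by congr (_ *: _); rewrite addrC.
exists (size b), (in_tuple b); split=> // [|i]; last by apply/sT/bs/mem_tnth.
apply/eqP; rewrite eqEsubv subvf /= bspan -{1}(span_basis (vbasisP fullv)).
apply/span_subvP => x xb.
have s1 : x + T x \in <<s>>%VS.
  by apply: memv_span; rewrite mem_cat; apply/orP; left; apply/mapP; exists x.
have s2 : cI *: (x - T x) \in <<s>>%VS.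
  by apply: memv_span; rewrite mem_cat; apply/orP; right; apply/mapP; exists x.
have -> : x = (2%:R : L)^-1 *: ((x + T x) - cI *: (cI *: (x - T x))).
  rewrite scalerA cI2 scaleN1r opprK addrACA subrr addr0 -mulr2n -scaler_nat scalerA.
  by rewrite mulVf ?scale1r // Num.Theory.pnatr_eq0.
by apply/memvZ/memvB => //; apply: memvZ.
Qed.

(** A real space whose complexification is [W], with [T] as complex conjugation. *)
Record real_form := RealForm {
  rf_space : vectType R;
  rf_in : 'Hom(cplx L rf_space, W);
  rf_out : 'Hom(W, cplx L rf_space);
  rf_inK : (rf_out \o rf_in = \1)%VF;
  rf_outK : (rf_in \o rf_out = \1)%VF;
  rf_conj : forall x, rf_in (cconj x) = T (rf_in x)
}.

Lemma real_form_exists : inhabited real_form.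
Proof.
have [n [b [bfree bspan bT]]] := fixed_basis.
pose V : vectType R := 'rV[R]_n.
pose f (v : V) : W := \sum_i rc ((v : 'rV_n) 0 i) *: tnth b i.
have fl : real_linear f.
  move=> a u v; rewrite /f scaler_sumr -big_split; apply: eq_bigr => i _ /=.
  by rewrite !mxE rmorphD rmorphM scalerDl scalerA.
have thE v : linfun (clift f : cplx L V -> W) (iota L v) = f v.
  by rewrite (linfunE (clift_semilin fl)) (clift_iota fl).
pose e (i : 'I_n) : V := (delta_mx 0 i : 'rV[R]_n).
pose g (w : W) : cplx L V := \sum_i coord b i w *: iota L (e i).
have gl : linear g.
  move=> a u v; rewrite /g scaler_sumr -big_split; apply: eq_bigr => i _ /=.
  by rewrite linearP scalerDl scalerA.
have fe i : f (e i) = tnth b i.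
  rewrite /f (bigD1 i) //= big1 ?addr0 => [|j jNi]; first by rewrite mxE !eqxx rmorph1 scale1r.
  by rewrite mxE eqxx (negPf jNi) rmorph0 scale0r.
have eE (v : V) : v = \sum_i ((v : 'rV_n) 0 i) *: e i by apply: (row_sum_delta (v : 'rV_n)).
exists; apply: (@RealForm V (linfun (clift f)) (linfun g)) => [||x].
- apply: cplxP => v; rewrite comp_lfunE thE (linfunE gl) id_lfunE /g.
  rewrite [in RHS](eE v) (real_linear_sum (@iota_real_linear R L V)).
  apply: eq_bigr => i _; rewrite (real_linearZ (@iota_real_linear R L V)); congr (_ *: _).
  rewrite /f linear_sum (bigD1 i) //= big1 ?addr0 => [|j jNi].
    by rewrite linearZ /= (tnth_nth 0) coord_free // eqxx mulr1.
  by rewrite linearZ /= (tnth_nth 0) coord_free // eq_sym -val_eqE /= in jNi *; rewrite (negPf jNi) mulr0.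
- apply/lfunP => w; rewrite comp_lfunE (linfunE gl) id_lfunE /g linear_sum /=.
  rewrite [RHS](coord_span (X := b) (v := w)) ?bspan ?memvf //; apply: eq_bigr => i _.
  by rewrite linearZ /= thE fe (tnth_nth 0).
- apply: (@cplx_ext _ _ _ (@conj R L) _ (fun x => linfun (clift f) (cconj x))
    (fun x => T (linfun (clift f) x))) x => [a x y|a x y|v].
  + by rewrite cconj_semilin linearP.
  + by rewrite linearP Tl.
  rewrite cconj_iota thE /f (semilin_sum Tl); apply: eq_bigr => i _.
  by rewrite (semilinZ Tl) conj_rc bT.
Qed.

End RealForm.

(** A monoidal functor to complex vector spaces whose values carry real structures,
    respected by all its data, descends to real vector spaces: every structure map
    commutes with the conjugations, so it comes from a map between the real forms,
    and the coherence laws may be checked after complexification. *)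
Section Descent.
Variables (R : rcfType) (L : complex_field R) (C : symmoncat R).
Local Notation one := (unit_ob : C).
Local Notation Lo := ((L : fieldType)^o : vectType L).
Variables (W : C -> vectType L) (T : forall X, W X -> W X).
Variable Wm : forall X Y : C, mor X Y -> 'Hom(W X, W Y).
Variables (J : forall X Y, 'Hom(vtens (W X) (W Y), W (X \ox Y))) (J1 : 'Hom(Lo, W one)).
Hypothesis Tl : forall X, semilin (@conj R L) (@T X).
Hypotheses (Wml : forall X Y, real_linear (fun f : mor X Y => Wm f)).
Hypotheses (Wm1 : forall X, Wm (idm X) = \1%VF).
Hypotheses (WmM : forall X Y Z (g : mor Y Z) (f : mor X Y), Wm (g \oc f) = (Wm g \o Wm f)%VF).
Hypotheses (WmT : forall X Y (f : mor X Y) x, Wm f (T x) = T (Wm f x)).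
Hypotheses (JT : forall X Y x y, J X Y (T x \otv T y) = T (J X Y (x \otv y))).
Hypotheses (J1T : forall a, J1 (conj a) = T (J1 a)).
Hypotheses (J_iso : forall X Y, lfun_iso (J X Y)) (J1_iso : lfun_iso J1).
Hypotheses (J_nat : forall X X' Y Y' (f : mor X X') (g : mor Y Y'),
  (J X' Y' \o vtensm (Wm f) (Wm g) = Wm (f \oxm g) \o J X Y)%VF).
Hypotheses (J_assoc : forall X Y Z,
  (Wm (assoc X Y Z) \o J (X \ox Y) Z \o vtensm (J X Y) \1 =
   J X (Y \ox Z) \o vtensm \1 (J Y Z) \o vassoc (W X) (W Y) (W Z))%VF).
Hypotheses (J_lunit : forall X, (Wm (lunit X) \o J one X \o vtensm J1 \1 = vlunit (W X))%VF).
Hypotheses (J_runit : forall X, (Wm (runit X) \o J X one \o vtensm \1 J1 = vrunit (W X))%VF).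
Hypotheses (J_braid : forall X Y,
  (Wm (braid X Y) \o J X Y = J Y X \o vbraid (W X) (W Y))%VF).

Local Notation cx := (@cx R L _ _).
Local Notation cmu := (cmu L).
Local Notation cone := (@cone R L).

Section Forms.
Variable rf : forall X, real_form (@T X).
Let D X := rf_space (rf X).
Let th X : 'Hom(cplx L (D X), W X) := rf_in (rf X).
Let th' X : 'Hom(W X, cplx L (D X)) := rf_out (rf X).
Let th'K X : (th' X \o th X = \1)%VF. Proof. exact: rf_inK. Qed.
Let thK X : (th X \o th' X = \1)%VF. Proof. exact: rf_outK. Qed.
Let thT X x : th X (cconj x) = T (th X x). Proof. exact: rf_conj. Qed.
Let th'T X x : th' X (T x) = cconj (th' X x).
Proof.
have {1}-> : x = th X (th' X x) by rewrite -comp_lfunE thK id_lfunE.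
by rewrite -thT -comp_lfunE th'K id_lfunE.
Qed.

Let Dm X Y (f : mor X Y) : 'Hom(D X, D Y) := rpart_lfun (th' Y \o Wm f \o th X)%VF.
Let DJ X Y : 'Hom(vtens (D X) (D Y), D (X \ox Y)) :=
  rpart_lfun (th' (X \ox Y) \o J X Y \o vtensm (th X) (th Y) \o cmu_inv L _ _)%VF.
Let D1 : 'Hom((R^o : vectType R), D one) :=
  rpart_lfun (th' one \o J1 \o cone_inv L)%VF.

Let cx_Dm X Y (f : mor X Y) : cx (Dm f) = (th' Y \o Wm f \o th X)%VF.
Proof. by apply: cx_descend => x; rewrite !comp_lfunE thT WmT th'T. Qed.

Let cx_DJ X Y : (cx (DJ X Y) \o cmu _ _ = th' (X \ox Y) \o J X Y \o vtensm (th X) (th Y))%VF.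
Proof.
rewrite /DJ cx_descend => [|x]; first by rewrite -comp_lfunA cmuK comp_lfun1r.
have [t ->] : exists t, x = cmu _ _ t.
  by exists (cmu_inv L _ _ x); rewrite -comp_lfunE cmu_invK id_lfunE.
pose h t := th' (X \ox Y) (J X Y (vtensm (th X) (th Y) (cmu_inv L _ _ t))).
have hE u : (th' (X \ox Y) \o J X Y \o vtensm (th X) (th Y) \o cmu_inv L _ _)%VF u = h u.
  by rewrite !comp_lfunE.
rewrite !hE; pose f t := h (cconj (cmu _ _ t)); pose g t := cconj (h (cmu _ _ t)).
have hl a u v : h (a *: u + v) = a *: h u + h v by rewrite /h !linearP.
have fl : semilin (@conj R L) f by move=> a u v; rewrite /f linearP cconj_semilin hl.
have gl : semilin (@conj R L) g by move=> a u v; rewrite /g linearP hl cconj_semilin.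
apply: (tens_cplx_ext fl gl) => v w.
by rewrite /f /g /h cconj_cmu !cconj_iota cmu_iota cmu_inv_iota !vtensmE -th'T -JT -!thT !cconj_iota.
Qed.

Let cx_D1 : (cx D1 \o cone = th' one \o J1)%VF.
Proof.
rewrite /D1 cx_descend => [|x]; first by rewrite -comp_lfunA coneK comp_lfun1r.
have [a ->] : exists a, x = cone a by exists (cone_inv L x); rewrite -comp_lfunE cone_invK id_lfunE.
rewrite cconj_cone !comp_lfunE -![cone_inv L (cone _)]comp_lfunE coneK !id_lfunE.
by rewrite J1T th'T.
Qed.

(* Each descended map is characterized by its relation to the original one through
   the isomorphisms [th]. *)
Let th_Dm X Y (f : mor X Y) : (th Y \o cx (Dm f) = Wm f \o th X)%VF.
Proof. by rewrite cx_Dm !comp_lfunA thK comp_lfun1l. Qed.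

Let th_DJ X Y : (th (X \ox Y) \o cx (DJ X Y) \o cmu _ _ = J X Y \o vtensm (th X) (th Y))%VF.
Proof. by rewrite -comp_lfunA cx_DJ !comp_lfunA thK comp_lfun1l. Qed.

Let th_D1 : (th one \o cx D1 \o cone = J1)%VF.
Proof. by rewrite -comp_lfunA cx_D1 comp_lfunA thK comp_lfun1l. Qed.

Let th_iso X : lfun_iso (th X).
Proof. by exists (th' X). Qed.

Let cmu_iso (V V' : vectType R) : lfun_iso (cmu V V').
Proof. by exists (cmu_inv L V V'); rewrite cmuK cmu_invK. Qed.

Let cone_iso : lfun_iso cone.
Proof. by exists (cone_inv L); rewrite coneK cone_invK. Qed.

Let cx_reflect_iso (V V' : vectType R) (f : 'Hom(V, V')) : lfun_iso (cx f) -> lfun_iso f.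
Proof.
move=> [g [gf fg]]; have gc x : g (cconj x) = cconj (g x).
  have {1}-> : x = cx f (g x) by rewrite -comp_lfunE fg id_lfunE.
  by rewrite -cx_cconj -comp_lfunE gf id_lfunE.
exists (rpart_lfun g).
by split; apply: (@cx_inj R L); rewrite cxM cx_descend // cx1.
Qed.

Let lift_iso (V V' V'' : vectType L) (f : 'Hom(V', V'')) (g : 'Hom(V, V')) :
  lfun_iso (f \o g)%VF -> lfun_iso g -> lfun_iso f.
Proof.
move=> fg [g' [g'g gg']]; rewrite -[f]comp_lfun1r -gg' comp_lfunA.
by apply: lfun_iso_comp fg; exists g.
Qed.

Let DJ_iso X Y : lfun_iso (DJ X Y).
Proof.
apply: cx_reflect_iso; apply: lift_iso (cmu_iso _ _); rewrite cx_DJ.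
apply: lfun_iso_comp; first exact: lfun_iso_tens.
by apply: lfun_iso_comp => //; exists (th (X \ox Y)).
Qed.

Let D1_iso : lfun_iso D1.
Proof.
apply: cx_reflect_iso; apply: lift_iso cone_iso; rewrite cx_D1.
by apply: lfun_iso_comp => //; exists (th one).
Qed.

Let DJ_nat X X' Y Y' (f : mor X X') (g : mor Y Y') :
  (DJ X' Y' \o vtensm (Dm f) (Dm g) = Dm (f \oxm g) \o DJ X Y)%VF.
Proof.
apply: (@cx_inj R L); apply: (lfun_iso_mono (th_iso _)); apply: (lfun_iso_epi (cmu_iso _ _)).
rewrite !cxM -!comp_lfunA -cmu_nat !comp_lfunA th_Dm th_DJ.
transitivity (J X' Y' \o vtensm (Wm f) (Wm g) \o vtensm (th X) (th Y))%VF.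
  by rewrite -!comp_lfunA -!vtensmM !th_Dm.
by rewrite J_nat -!comp_lfunA (comp_lfunA (th _)) th_DJ.
Qed.

Let DJ_assoc X Y Z :
  (Dm (assoc X Y Z) \o DJ (X \ox Y) Z \o vtensm (DJ X Y) \1 =
   DJ X (Y \ox Z) \o vtensm \1 (DJ Y Z) \o vassoc (D X) (D Y) (D Z))%VF.
Proof.
apply: (@cx_inj R L); apply: (lfun_iso_mono (th_iso _)).
apply: (lfun_iso_epi (cmu_iso _ _)).
apply: (lfun_iso_epi (lfun_iso_tens (cmu_iso (D X) (D Y)) (lfun_iso1 _))).
rewrite !cxM.
transitivity (Wm (assoc X Y Z) \o J (X \ox Y) Z \o vtensm (J X Y) \1 \o
    vtensm (vtensm (th X) (th Y)) (th Z))%VF.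
  rewrite !comp_lfunA th_Dm -!comp_lfunA; congr (_ \o _)%VF.
  rewrite (comp_lfunA (cx (vtensm _ _))) -cmu_nat !comp_lfunA th_DJ -!comp_lfunA -!vtensmM.
  congr (_ \o _)%VF; congr vtensm; first by rewrite comp_lfunA th_DJ.
  by rewrite cx1 !comp_lfun1l comp_lfun1r.
transitivity (J X (Y \ox Z) \o vtensm \1 (J Y Z) \o vtensm (th X) (vtensm (th Y) (th Z)) \o
    vassoc _ _ _)%VF.
  by rewrite J_assoc -!comp_lfunA vassoc_nat.
rewrite -!comp_lfunA (comp_lfunA (cx (vassoc _ _ _))) cmu_assoc.
rewrite !comp_lfunA; congr (_ \o _)%VF.
rewrite -!comp_lfunA (comp_lfunA (cx (vtensm _ _))) -cmu_nat !comp_lfunA th_DJ -!comp_lfunA -!vtensmM.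
congr (_ \o _)%VF; congr vtensm; first by rewrite cx1 !comp_lfun1r comp_lfun1l.
by rewrite comp_lfunA th_DJ.
Qed.

Let DJ_lunit X : (Dm (lunit X) \o DJ one X \o vtensm D1 \1 = vlunit (D X))%VF.
Proof.
apply: (@cx_inj R L); apply: (lfun_iso_mono (th_iso _)); apply: (lfun_iso_epi (cmu_iso _ _)).
apply: (lfun_iso_epi (lfun_iso_tens cone_iso (lfun_iso1 _))).
rewrite -[RHS]comp_lfunA -[in RHS]comp_lfunA (comp_lfunA (cx _)) cmu_lunit.
rewrite -vlunit_nat -J_lunit !cxM !comp_lfunA th_Dm -!comp_lfunA; congr (_ \o _)%VF.
rewrite (comp_lfunA (cx (vtensm _ _))) -cmu_nat !comp_lfunA th_DJ -!comp_lfunA -!vtensmM.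
congr (_ \o _)%VF; congr vtensm; first by rewrite comp_lfunA th_D1 comp_lfun1r.
by rewrite cx1 !comp_lfun1l !comp_lfun1r.
Qed.

Let DJ_runit X : (Dm (runit X) \o DJ X one \o vtensm \1 D1 = vrunit (D X))%VF.
Proof.
apply: (@cx_inj R L); apply: (lfun_iso_mono (th_iso _)); apply: (lfun_iso_epi (cmu_iso _ _)).
apply: (lfun_iso_epi (lfun_iso_tens (lfun_iso1 _) cone_iso)).
rewrite -[RHS]comp_lfunA -[in RHS]comp_lfunA (comp_lfunA (cx _)) cmu_runit.
rewrite -vrunit_nat -J_runit !cxM !comp_lfunA th_Dm -!comp_lfunA; congr (_ \o _)%VF.
rewrite (comp_lfunA (cx (vtensm _ _))) -cmu_nat !comp_lfunA th_DJ -!comp_lfunA -!vtensmM.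
congr (_ \o _)%VF; congr vtensm; last by rewrite comp_lfunA th_D1 comp_lfun1r.
by rewrite cx1 !comp_lfun1l !comp_lfun1r.
Qed.

Let DJ_braid X Y : (Dm (braid X Y) \o DJ X Y = DJ Y X \o vbraid (D X) (D Y))%VF.
Proof.
apply: (@cx_inj R L); apply: (lfun_iso_mono (th_iso _)); apply: (lfun_iso_epi (cmu_iso _ _)).
rewrite !cxM !comp_lfunA th_Dm -!comp_lfunA cmu_braid !comp_lfunA th_DJ.
by rewrite -!comp_lfunA (comp_lfunA (th _)) th_DJ comp_lfunA J_braid -!comp_lfunA vbraid_nat.
Qed.

Let Dm_linear X Y : linear (@Dm X Y).
Proof.
move=> a f g; apply: (@cx_inj R L); rewrite cx_real_linear !cx_Dm Wml.
by rewrite comp_lfunDr -comp_lfunZr comp_lfunDl -comp_lfunZl.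
Qed.

Let Dm1 X : Dm (idm X) = \1%VF.
Proof. by apply: (@cx_inj R L); rewrite cx_Dm Wm1 comp_lfun1r th'K cx1. Qed.

Let DmM X Y Z (g : mor Y Z) (f : mor X Y) : Dm (g \oc f) = (Dm g \o Dm f)%VF.
Proof.
apply: (@cx_inj R L); apply: (lfun_iso_mono (th_iso _)).
by rewrite th_Dm cxM comp_lfunA th_Dm -comp_lfunA th_Dm comp_lfunA WmM.
Qed.

Definition descent_functor : linfunctor C (Vec R) :=
  @Linfunctor R C (Vec R) D Dm Dm_linear Dm1 DmM.

Definition descent : symmonfunctor C (Vec R) :=
  @Symmonfunctor R C (Vec R) descent_functor DJ D1 DJ_iso D1_iso
    DJ_nat DJ_assoc DJ_lunit DJ_runit DJ_braid.

Lemma descent_faithful : (forall X Y, injective (fun f : mor X Y => Wm f)) -> faithful descent.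
Proof.
move=> Wm_inj X Y f g fg; apply: Wm_inj; apply: (lfun_iso_epi (th_iso X)).
by rewrite -!th_Dm; congr (_ \o cx _)%VF.
Qed.


End Forms.

Lemma real_descent : (forall X, involutive (@T X)) ->
  (forall X Y, injective (fun f : mor X Y => Wm f)) ->
  exists F : symmonfunctor C (Vec R), faithful F.
Proof.
move=> TK Wm_inj.
pose rf X := inhabited_witness (real_form_exists (@Tl X) (TK X)).
by exists (descent rf); apply: (@descent_faithful rf Wm_inj).
Qed.

End Descent.

(** * Semi-linear representations *)

Section ComplexExtension.
Variable R : rcfType.
Local Open Scope complex_scope.

Let decomp (x : R[i]) : x = (complex.Re x)%:C + 'i * (complex.Im x)%:C.
Proof. by rewrite {1}[x]complexE. Qed.

Let re_decomp (a b : R) : complex.Re (a%:C + 'i * b%:C) = a.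
Proof. by rewrite raddfD /= !mul0r mul1r !subr0 ?addr0 ?mul0r. Qed.

Let im_decomp (a b : R) : complex.Im (a%:C + 'i * b%:C) = b.
Proof. by rewrite raddfD /= !mul0r mul1r ?add0r ?addr0. Qed.

Let i2 : 'i * 'i = -1 :> R[i].
Proof. by rewrite -expr2 sqr_i. Qed.

Let conj_real (a : R) : conjc a%:C = a%:C.
Proof. by rewrite /= oppr0. Qed.

Let conj_i : conjc 'i = - 'i :> R[i].
Proof. by apply/eqP; rewrite eq_complex /= oppr0 !eqxx. Qed.

Definition complex_ext : complex_field R :=
  @ComplexField R R[i] (real_complex R) 'i (@complex.Re R) (@complex.Im R)
    (@conjc R : {rmorphism R[i] -> R[i]}) decomp re_decomp im_decomp i2 conj_real conj_i.

End ComplexExtension.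

Section OddInvolution.
Variables (R : rcfType) (G : Z2group) (s : G).
Hypotheses (s_odd : grading s = 1) (sK : (s * s = 1)%g).
Variables (C : symmoncat R) (F : symmonfunctor C (Rep_CR R G)).
Local Notation L := (complex_ext R).

Let W (X : C) : vectType L := srep (F X).
Let T X (x : W X) : W X := sact s x.
Let Wm X Y (f : mor X Y) : 'Hom(W X, W Y) := rephom_val (fmap F f).
Let J X Y : 'Hom(vtens (W X) (W Y), W (X \ox Y)) := rephom_val (smf_mul F X Y).
Let J1 : 'Hom(((L : fieldType)^o : vectType L), W unit_ob) := rephom_val (smf_one F).

(** An odd involution of the group acts on every representation by a real structure
    that is compatible with morphisms and tensor products. *)
Lemma odd_involution_descent : faithful F -> exists F' : symmonfunctor C (Vec R), faithful F'.
Proof.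
move=> Ff.
have Tl X : semilin (@conj R L) (@T X).
  by have := sact_semilin (s := F X) s; rewrite s_odd.
have TK X : involutive (@T X) by move=> x; rewrite /T -sactM sK sact1.
have Wml X Y : real_linear (fun f : mor X Y => Wm f).
  by move=> a f g; rewrite /Wm fmap_linear.
have Wm1 X : Wm (idm X) = \1%VF by rewrite /Wm fmap1.
have WmM X Y Z (g : mor Y Z) (f : mor X Y) : Wm (g \oc f) = (Wm g \o Wm f)%VF.
  by rewrite /Wm fmapM.
have WmT X Y (f : mor X Y) x : Wm f (T x) = T (Wm f x) by apply: rephomP.
have JT X Y x y : J X Y (T x \otv T y) = T (J X Y (x \otv y)).
  by have := rephomP (smf_mul F X Y) s (x \otv y); rewrite /= tens_actE.
have J1T a : J1 (conj a) = T (J1 a).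
  by have := rephomP (smf_one F) s a; rewrite /= /unit_act s_odd.
have iso_val (V V' : semirep R G) (f : mor (l := Rep_CR R G) V V') :
    is_iso f -> lfun_iso (rephom_val f).
  by move=> [g [gf fg]]; exists (rephom_val g); split;
    [have := congr1 val gf | have := congr1 val fg].
have J_iso X Y : lfun_iso (J X Y) by exact: (iso_val _ _ (smf_mul F X Y) (smf_mul_iso F X Y)).
have J1_iso : lfun_iso J1 by exact: (iso_val _ _ (smf_one F) (smf_one_iso F)).
apply: (@real_descent R L C W T Wm J J1 Tl Wml Wm1 WmM WmT JT J1T J_iso J1_iso
  (fun X X' Y Y' f g => congr1 val (smf_mul_nat F f g))
  (fun X Y Z => congr1 val (smf_assoc F X Y Z))
  (fun X => congr1 val (smf_lunit F X))
  (fun X => congr1 val (smf_runit F X))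
  (fun X Y => congr1 val (smf_braid F X Y)) TK).
move=> X Y f g fg; apply: Ff; exact: val_inj.
Qed.

End OddInvolution.

Section PointActions.
Variables (R : rcfType) (L : complex_field R).
Variables (C : symmoncat R) (F : symmonfunctor C (Vec R)).
Local Notation CO := (CO L F).
Local Notation Cm := (Cm L F).
Local Notation CJ := (CJ L F).
Local Notation C1 := (C1 L F).
Variables (P : C) (K : finGroupType) (r : K -> forall X, 'End(CO X)) (sigma : K -> K).
Hypothesis rP : fiber_points P r sigma.

Definition ctwist (a : 'Z_2) : {rmorphism L -> L} := 
  if a == 0 then (idfun : {rmorphism L -> L}) else conj.

(** The pair [(a, k)], read as the product of a power of the complex conjugation
    and of the complex point [k], acts by this composite. *)
Definition point_act (a : 'Z_2) (k : K) X (x : CO X) : CO X :=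
  if a == 0 then r k X x else cconj (r k X x).

Lemma point_act_semilin a k X : semilin (ctwist a) (@point_act a k X).
Proof.
rewrite /point_act /ctwist; case: ifP => _ c x y; rewrite linearP //.
exact: cconj_semilin.
Qed.

Lemma point_act1 X (x : CO X) : point_act 0 1%g x = x.
Proof. by rewrite /point_act eqxx (fp1 rP) id_lfunE. Qed.

Lemma point_actM a b k l X (x : CO X) :
  point_act (a + b) ((if b == 0 then k else sigma k) * l)%g x = point_act a k (point_act b l x).
Proof.
rewrite /point_act (fpM rP) comp_lfunE.
case: a => [[|[|//]] ?]; case: b => [[|[|//]] ?] //=.
  by rewrite (fp_conj rP) cconjK.
by rewrite (fp_conj rP).
Qed.

Lemma point_act_nat a k X Y (f : mor X Y) (x : CO X) :
  Cm f (point_act a k x) = point_act a k (Cm f x).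
Proof.
have e : Cm f (r k X x) = r k Y (Cm f x) by rewrite -!comp_lfunE (fp_natural rP).
by rewrite /point_act; case: ifP; rewrite ?Cm_cconj e.
Qed.

Lemma point_act_CJ a k X Y (x : CO X) (y : CO Y) :
  CJ X Y (point_act a k x \otv point_act a k y) = point_act a k (CJ X Y (x \otv y)).
Proof.
have [rM _] := fp_monoidal rP k.
have e : CJ X Y (r k X x \otv r k Y y) = r k _ (CJ X Y (x \otv y)).
  by rewrite -vtensmE -!comp_lfunE rM.
by rewrite /point_act; case: ifP; rewrite -?cconj_CJ e.
Qed.

Lemma point_act_C1 a k x : C1 (ctwist a x) = point_act a k (C1 x).
Proof.
have [_ r1] := fp_monoidal rP k.
have e y : r k _ (C1 y) = C1 y by rewrite -comp_lfunE r1.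
by rewrite /point_act /ctwist e; case: ifP; rewrite //= -cconj_C1.
Qed.

End PointActions.

Section SemidirectElements.
Variables (K : finGroupType) (to : groupAction [set: 'Z_2]%G [set: K]%G).
Implicit Types (a b : 'Z_2) (k l : K).

Fact sd_pair_subproof a k : (a, k) \in setX [set: 'Z_2]%G [set: K]%G.
Proof. by rewrite !inE. Qed.

Definition sd_pair a k : sdprod_Z2T to := SdPair to (sd_pair_subproof a k).

Lemma sd_pairM a b k l : (sd_pair a k * sd_pair b l)%g = sd_pair (a + b) (to k b * l)%g.
Proof. exact: val_inj. Qed.

Lemma sd_pair1 : sd_pair 0 1%g = 1%g.
Proof. exact: val_inj. Qed.

Lemma sd_pair_sqr : (sd_pair 1%R 1 * sd_pair 1%R 1)%g = 1%g.
Proof. by rewrite sd_pairM gact1 ?inE // mulg1 -sd_pair1; congr sd_pair; apply: val_inj. Qed.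

End SemidirectElements.

Section RepresentationFunctor.
Variable R : rcfType.
Local Notation L := (complex_ext R).
Variables (C : symmoncat R) (F : symmonfunctor C (Vec R)).
Local Notation CO := (CO L F).
Local Notation Cm := (Cm L F).
Local Notation CJ := (CJ L F).
Local Notation C1 := (C1 L F).
Variables (P : C) (K : finGroupType) (r : K -> forall X, 'End(CO X)) (sigma : K -> K).
Hypothesis rP : fiber_points P r sigma.
Variable to : groupAction [set: 'Z_2]%G [set: K]%G.
Hypothesis toE : forall k a, to k a = if a == 0 then k else sigma k.
Local Notation G := (sdprod_Z2T to).
Implicit Types g h : G.

Let fst g : 'Z_2 := (pair_of_sd g).1.
Let snd g : K := (pair_of_sd g).2.
Let act g X (x : CO X) : CO X := point_act r (fst g) (snd g) x.

Let act_semilin X g : semilin (twist R (grading g)) (@act g X).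
Proof. move=> a x y; exact: (@point_act_semilin R L C F K r (fst g) (snd g) X a x y). Qed.

Let act1 X (x : CO X) : act (1%g : G) x = x.
Proof. exact: (point_act1 rP). Qed.

Let actM X g h (x : CO X) : act (g * h)%g x = act g (act h x).
Proof. by rewrite /act -(point_actM rP) -toE. Qed.

Definition point_rep (X : C) : semirep R G := @Semirep R G (CO X) (fun g => @act g X)
  (@act_semilin X) (@act1 X) (@actM X).

Lemma point_rephom_subproof X Y (f : mor X Y) :
  @equivariant R G (point_rep X) (point_rep Y) (Cm f).
Proof. by apply/asboolP => g x; apply: (point_act_nat rP). Qed.

Definition point_map X Y (f : mor X Y) : rephom (point_rep X) (point_rep Y) :=
  Rephom (point_rephom_subproof f).

Lemma point_mul_subproof X Y :
  @equivariant R G (rep_tens (point_rep X) (point_rep Y)) (point_rep (X \ox Y)) (CJ X Y).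
Proof. by apply: equivariant2 => g x y; apply: (point_act_CJ rP). Qed.

Definition point_mul X Y : rephom (rep_tens (point_rep X) (point_rep Y)) (point_rep (X \ox Y)) :=
  Rephom (@point_mul_subproof X Y).

Lemma point_one_subproof : @equivariant R G (rep_unit R G) (point_rep unit_ob) C1.
Proof. by apply/asboolP => g x; apply: (point_act_C1 rP). Qed.

Definition point_one : rephom (rep_unit R G) (point_rep unit_ob) := Rephom point_one_subproof.


Let map_linear X Y : linear (@point_map X Y).
Proof. by move=> a f g; apply/val_inj; exact: (Cm_linear L F a f g). Qed.

Let map1 X : point_map (idm X) = idm (point_rep X : rep_lincat R G).
Proof. by apply/val_inj; exact: (Cm1 L F X). Qed.

Let mapM X Y Z (g : mor Y Z) (f : mor X Y) :
  point_map (g \oc f) = (point_map g : mor (l := rep_lincat R G) _ _) \oc point_map f.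
Proof. by apply/val_inj; exact: (CmM L F g f). Qed.

Definition point_functor : linfunctor C (Rep_CR R G) :=
  @Linfunctor R C (Rep_CR R G) point_rep point_map map_linear map1 mapM.

(** The inverse of a bijective equivariant map is equivariant. *)
Lemma rep_iso (V W : semirep R G) (f : rephom V W) :
  lfun_iso (rephom_val f) -> is_iso (f : mor (l := rep_lincat R G) V W).
Proof.
move=> [h [hf fh]].
have hE : equivariant h.
  apply/asboolP => g v; have {1}-> : v = rephom_val f (h v) by rewrite -comp_lfunE fh id_lfunE.
  by rewrite -[sact g _](rephomP f) -comp_lfunE hf id_lfunE.
by exists (Rephom hE); split; apply/val_inj.
Qed.

Definition point_monoidal : symmonfunctor C (Rep_CR R G).
Proof.
apply: (@Symmonfunctor R C (Rep_CR R G) point_functor point_mul point_one).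
- by move=> X Y; apply: rep_iso; exact: (CJ_iso L F X Y).
- by apply: rep_iso; exact: (C1_iso L F).
- by move=> X X' Y Y' f g; apply/val_inj; exact: (CJ_nat L F f g).
- by move=> X Y Z; apply/val_inj; exact: (CJ_assoc L F X Y Z).
- by move=> X; apply/val_inj; exact: (CJ_lunit L F X).
- by move=> X; apply/val_inj; exact: (CJ_runit L F X).
- by move=> X Y; apply/val_inj; exact: (CJ_braid L F X Y).
Defined.

Hypotheses (Crigid : rigid C) (Creg : regular C) (Ff : faithful F).
Hypothesis Psplit : splits_idempotents P.

Local Notation pt := (@sd_pair K to).

(** Equivariance under the pairs [(0, k)] and [(1, 1)] is commutation with the points
    and with the complex conjugation. *)
Lemma point_equivalence : is_equivalence point_monoidal.
Proof.
apply/equivalenceP; split=> [X Y f g fg|X Y h|W].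
- by apply: (@Cm_inj R L C F Ff); exact: (congr1 val fg).
- have [||f fh] := points_full rP Crigid Creg Ff (X := X) (Y := Y) (phi := rephom_val h).
  + move=> k; apply/lfunP => x; rewrite !comp_lfunE.
    exact: (rephomP h (pt 0 k) x).
  + move=> x; have e Z (z : CO Z) : cconj (r 1%g Z z) = cconj z by rewrite (fp1 rP) id_lfunE.
    by rewrite -(e X x) -(e Y (rephom_val h x)); exact: (rephomP h (pt 1 1%g) x).
  by exists f; apply/val_inj.
pose WL : vectType L := srep W.
have l0 k : linear (fun w : WL => sact (pt 0 k) w : WL).
  exact: (sact_semilin (s := W) (pt 0 k)).
pose rW k : 'End(WL) := linfun (fun w : WL => sact (pt 0 k) w : WL).
have rWE k w : rW k w = sact (pt 0 k) w by rewrite (linfunE (l0 k)).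
pose TW (w : WL) : WL := sact (pt 1 1%g) w.
have rW1 : rW 1%g = \1%VF by apply/lfunP => w; rewrite rWE id_lfunE sd_pair1 sact1.
have rWM k l : rW (k * l)%g = (rW k \o rW l)%VF.
  by apply/lfunP => w; rewrite comp_lfunE !rWE -sactM sd_pairM toE addr0.
have TWl : semilin (@conj R L) TW by exact: (sact_semilin (s := W) (pt 1 1%g)).
have TWK : involutive TW.
  by move=> w; rewrite /TW -sactM sd_pair_sqr sact1.
have TWr k w : rW (sigma k) w = TW (rW k (TW w)).
  rewrite !rWE /TW -!sactM !sd_pairM !toE /= mulg1 mul1g.
  by congr (sact (pt _ _) w); apply: val_inj.
have [X [h [hiso hr hT]]] := realization rP Crigid Creg Ff Psplit rW1 rWM TWl TWK TWr.
have hE : @equivariant R G (point_rep X) W h.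
  apply/asboolP => g x; have -> : g = pt (fst g) (snd g) by apply: val_inj; apply: surjective_pairing.
  have e k : h (r k X x) = sact (pt 0 k) (h x) by rewrite -rWE -!comp_lfunE hr.
  rewrite /= /act /point_act /=; move: (fst g) (snd g) => a k.
  case: a => [[|[|//]] a2] /=.
    by rewrite e; congr sact; apply: val_inj; congr pair; apply: val_inj.
  rewrite hT e /TW -sactM sd_pairM toE /= mul1g; congr sact; apply: val_inj; congr pair.
  exact: val_inj.
by exists X, (Rephom hE); apply: rep_iso.
Qed.

End RepresentationFunctor.

Theorem theorem6p23 (R : realType) (C : symmoncat R)
    (hC : symmetric_fusion C) :
  tannakian C <->
  exists (K : finGroupType)
         (to : groupAction [set: 'Z_2]%G [set: K]%G),
    symmon_equivalent C (Rep_CR R (sdprod_Z2T to)).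
Proof.
have [Creg [P [Pgen Psplit]]] := fusion_semisimple hC.
have [Crigid _ _] := hC.
split=> [[F [Ff _]]|[K [to [F /equivalenceP [Ff _ _]]]]].
  have [K [r [sigma rP]]] := @automorphism_group R (complex_ext R) C F P Pgen Crigid.
  have [to toE] := involution_groupAction (pointsK rP) (pointsM rP).
  by exists K, to, (point_monoidal rP toE); apply: point_equivalence.
have [F' F'f] := @odd_involution_descent R _ (sd_pair to 1 1%g) erefl (sd_pair_sqr to) C F Ff.
by exists F'; split=> //; apply: regular_exact.
Qed.
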